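(* Let $A$ be a Frobenius algebra over an algebraically closed field $k$ with diagonalisable Nakayama automorphism. Then its Hochschild cohomology $H^\bullet(A,A)$ is a Batalin-Vilkovisky algebra.
   Context: A Frobenius algebra is a (unital associative) $k$-algebra $A$ with a functional $\varepsilon:A\to k$ such that $A\to A^*=\mathrm{Hom}_k(A,k)$, $a\mapsto\varepsilon_a$, $\varepsilon_a(b):=\varepsilon(ab)$, is bijective. Its Nakayama automorphism $\sigma\in\mathrm{Aut}(A)$ is determined by $\varepsilon(ab)=\varepsilon(\sigma(b)a)$ for all $a,b\in A$. It is diagonalisable (semisimple) if there is a subset $\Sigma\subseteq k\setminus\{0\}$ with $A=\bigoplus_{\lambda\in\Sigma}A_\lambda$, $A_\lambda=\{a\in A\mid\sigma(a)=\lambda a\}$. $H^\bullet(A,A)$ is the cohomology of the Hochschild complex $\mathrm{Hom}_k(A^{\otimes\bullet},A)$, with its usual Gerstenhaber algebra structure (cup product and Gerstenhaber bracket, up to sign conventions). A Gerstenhaber algebra is a graded commutative algebra $(V,\smile)$, $V=\bigoplus_{p\in\mathbb N}V^p$, with a graded Lie bracket $\{\cdot,\cdot\}:V^{p+1}\otimes V^{q+1}\to V^{p+q+1}$ on $V[1]$ such that $\{\gamma,\alpha\smile\beta\}=\{\gamma,\alpha\}\smile\beta+(-1)^{pq}\alpha\smile\{\gamma,\beta\}$ for $\gamma\in V^{p+1},\alpha\in V^q$. It is a Batalin-Vilkovisky algebra if there is a $k$-linear $B:V^n\to V^{n-1}$, $B^2=0$, with $\{\alpha,\beta\}=(-1)^p\big(B(\alpha\smile\beta)-B(\alpha)\smile\beta-(-1)^p\alpha\smile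 B(\beta)\big)$ for $\alpha\in V^p$, $\beta\in V$. *)

(* Defs.v *)
From HB Require Import structures.
From mathcomp Require Import all_boot all_order all_algebra.
From mathcomp Require Import generic_quotient ring_quotient.
From mathcomp Require Import boolp classical_sets functions.

Set Implicit Arguments.
Unset Strict Implicit.
Unset Printing Implicit Defensive.

Import GRing.Theory.

Local Open Scope quotient_scope.
Local Open Scope classical_set_scope.
Local Open Scope ring_scope.

Definition submodule (k : fieldType) (V : lmodType k) (W : set V) : Prop :=
  W 0 /\ forall (c : k) (u v : V), W u -> W v -> W (c *: u + v).

(* V is the internal direct sum of the subgroups W i, for i ranging over the
   possibly infinite set S. *)
Definition direct_sum (V : zmodType) (I : eqType) (S : set I)
    (W : I -> set V) : Prop :=
  (forall v : V, exists (s : seq I) (c : I -> V),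
     [/\ uniq s, (forall i, i \in s -> S i /\ W i (c i))
       & v = \sum_(i <- s) c i]) /\
  (forall (s : seq I) (c : I -> V),
     uniq s -> (forall i, i \in s -> S i /\ W i (c i)) ->
     \sum_(i <- s) c i = 0 -> forall i, i \in s -> c i = 0).

Section Frobenius.
Variables (k : fieldType) (A : algType k).

Definition frobenius_form (eps : {scalar A}) : Prop :=
  forall phi : {scalar A}, exists! a : A, forall b : A, eps (a * b) = phi b.

Definition nakayama_automorphism (eps : {scalar A})
    (sigma : {lrmorphism A -> A}) : Prop :=
  bijective sigma /\ forall a b : A, eps (a * b) = eps (sigma b * a).

Definition diagonalisable_map (sigma : A -> A) : Prop :=
  exists Sigma : set k,
    ~ Sigma 0 /\
    direct_sum Sigma (fun lambda => [set a : A | sigma a = lambda *: a]).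

End Frobenius.

Section BatalinVilkovisky.
Variables (k : fieldType) (V : lmodType k).

Definition bilinear_map (m : V -> V -> V) : Prop :=
  (forall a, linear (m a)) /\ (forall b, linear (m^~ b)).

(* W p is the component V^p of V.  An element of V^p has degree p - 1 for the
   bracket; since p may be 0, this degree occurs in signs as p.+1, which has
   the same parity.  For the same reason the bracket of V^0 with itself, which
   lies in V^(-1), is required to vanish. *)
Record gerstenhaber_algebra (W : nat -> set V) (cup br : V -> V -> V) : Prop :=
  GerstenhaberAlgebra {
  ger_submodule : forall p, submodule (W p);
  ger_graded : direct_sum setT W;
  ger_cup_bilinear : bilinear_map cup;
  ger_cup_degree : forall p q a b, W p a -> W q b -> W (p + q)%N (cup a b);
  ger_cup_assoc : forall a b c, cup a (cup b c) = cup (cup a b) c;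
  ger_cup_unit : exists e, W 0 e /\ forall a, cup e a = a /\ cup a e = a;
  ger_cup_comm : forall p q a b, W p a -> W q b ->
    cup a b = (-1) ^+ (p * q) *: cup b a;
  ger_br_bilinear : bilinear_map br;
  ger_br_degree : forall p q n a b, W p a -> W q b -> (p + q)%N = n.+1 ->
    W n (br a b);
  ger_br_degree0 : forall a b, W 0 a -> W 0 b -> br a b = 0;
  ger_br_anticomm : forall p q a b, W p a -> W q b ->
    br a b = - ((-1) ^+ (p.+1 * q.+1) *: br b a);
  ger_br_jacobi : forall p q r a b c, W p a -> W q b -> W r c ->
    br a (br b c) = br (br a b) c + (-1) ^+ (p.+1 * q.+1) *: br b (br a c);
  ger_leibniz : forall p q c a b, W p c -> W q a ->
    br c (cup a b) = cup (br c a) b + (-1) ^+ (p.+1 * q) *: cup a (br c b)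
}.

Definition bv_operator (W : nat -> set V) (cup br : V -> V -> V)
    (B : {linear V -> V}) : Prop :=
  [/\ forall n a, W n.+1 a -> W n (B a),
      forall a, W 0 a -> B a = 0,
      forall a, B (B a) = 0
    & forall p a b, W p a ->
        br a b = (-1) ^+ p *:
          (B (cup a b) - cup (B a) b - (-1) ^+ p *: cup a (B b))].

Definition bv_algebra (W : nat -> set V) (cup br : V -> V -> V) : Prop :=
  gerstenhaber_algebra W cup br /\
  exists B : {linear V -> V}, bv_operator W cup br B.

End BatalinVilkovisky.

Section QuotientModule.
Variables (k : fieldType) (V : lmodType k) (U : submodClosed V).

Definition quotmod_ker : {pred V} := U.
HB.instance Definition _ := GRing.isZmodClosed.Build V quotmod_ker
  (GRing.submod_closedB (submodClosedP U)).

Definition quotmod := Quotient.quot quotmod_ker.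
HB.instance Definition _ := GRing.Zmodule.on quotmod.
HB.instance Definition _ := EqQuotient.on quotmod.

Definition quotmod_proj (v : V) : quotmod := \pi_quotmod v.

Definition quotmod_scale (c : k) (x : quotmod) : quotmod :=
  quotmod_proj (c *: repr x).

Lemma quotmod_projE (u v : V) :
  (quotmod_proj u = quotmod_proj v) <-> (u - v \in U).
Proof.
split=> [/eqP|uvU]; first by rewrite /quotmod_proj -[_ == _]Quotient.idealrBE.
by apply/eqP; rewrite /quotmod_proj -[_ == _]Quotient.idealrBE.
Qed.

Lemma quotmod_projD : {morph quotmod_proj : u v / u + v}.
Proof. by move=> u v; rewrite /quotmod_proj !piE. Qed.

Lemma quotmod_reprK (x : quotmod) : quotmod_proj (repr x) = x.
Proof. exact: reprK. Qed.

Lemma quotmod_projZ (c : k) (v : V) :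
  quotmod_proj (c *: v) = quotmod_scale c (quotmod_proj v).
Proof.
apply/quotmod_projE; rewrite -scalerBr; apply: rpredZ.
by apply/quotmod_projE; rewrite quotmod_reprK.
Qed.

Fact quotmod_scaleA (a b : k) (x : quotmod) :
  quotmod_scale a (quotmod_scale b x) = quotmod_scale (a * b) x.
Proof. by rewrite -(quotmod_reprK x) -!quotmod_projZ scalerA. Qed.

Fact quotmod_scale1 : left_id 1 quotmod_scale.
Proof. by move=> x; rewrite -(quotmod_reprK x) -quotmod_projZ scale1r. Qed.

Fact quotmod_scaleDr : right_distributive quotmod_scale +%R.
Proof.
move=> c x y; rewrite -(quotmod_reprK x) -(quotmod_reprK y).
by rewrite -quotmod_projD -!quotmod_projZ -quotmod_projD scalerDr.
Qed.

Fact quotmod_scaleDl (x : quotmod) :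
  {morph quotmod_scale^~ x : a b / a + b}.
Proof.
move=> a b; rewrite -(quotmod_reprK x).
by rewrite -!quotmod_projZ -quotmod_projD scalerDl.
Qed.

HB.instance Definition _ := GRing.Zmodule_isLmodule.Build k quotmod
  quotmod_scaleA quotmod_scale1 quotmod_scaleDr quotmod_scaleDl.

Fact quotmod_proj_linear : linear quotmod_proj.
Proof. by move=> c u v; rewrite quotmod_projD quotmod_projZ. Qed.

HB.instance Definition _ :=
  GRing.isLinear.Build k V quotmod _ quotmod_proj quotmod_proj_linear.

End QuotientModule.

(* The Hochschild complex is the direct sum over n of Hom_k(A^{(x) n}, A), that
   is, of the spaces of n-multilinear maps from A to A.  An element of it is
   encoded as a function f : seq A -> A, whose component of degree n is the
   restriction of f to the sequences of size n. *)
Section Hochschild.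
Variables (k : fieldType) (A : algType k).
Implicit Types (f g : seq A -> A) (s t x z : seq A).

Definition multilinear f : Prop :=
  forall x z (c : k) (a b : A),
    f (x ++ (c *: a + b) :: z) = c *: f (x ++ a :: z) + f (x ++ b :: z).

Definition hcochain f : Prop :=
  multilinear f /\ exists N : nat, forall s, (N <= size s)%N -> f s = 0.

Definition homogeneous (n : nat) f : Prop :=
  forall s, size s != n -> f s = 0.

Definition hdiff f : seq A -> A := fun s =>
  if s is a :: t then
    a * f t
    + \sum_(i < size t)
        (-1) ^+ i.+1 *: f (take i s ++ s`_i * s`_i.+1 :: drop i.+2 s)
    + (-1) ^+ size s *: (f (belast a t) * last a t)
  else 0.

(* The next three operations are meant for f and g homogeneous of respective
   degrees p and q; signs involving p - 1 and q - 1 are written with p.+1 and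
   q.+1. *)
Definition hcup (p q : nat) f g : seq A -> A := fun s =>
  f (take p s) * g (drop p s).

(* Summand i is f(a_1,..,a_i, g(a_(i+1),..,a_(i+q)), a_(i+q+1),..).  The global
   sign (-1)^((p-1)(q-1)) is needed for the graded Leibniz rule in the form of
   gerstenhaber_algebra to hold with the unsigned product hcup. *)
Definition hcirc (p q : nat) f g : seq A -> A := fun s =>
  (-1) ^+ (p.+1 * q.+1) *:
    \sum_(i < p) (-1) ^+ (i * q.+1) *:
      f (take i s ++ g (take q (drop i s)) :: drop (i + q) s).

Definition hbracket (p q : nat) f g : seq A -> A := fun s =>
  hcirc p q f g s - (-1) ^+ (p.+1 * q.+1) *: hcirc q p g f s.

Definition hcocycle_pred : {pred seq A -> A} :=
  fun f => `[< hcochain f /\ hdiff f = 0 >].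

Fact hcochain_lin (c : k) f g :
  hcochain f -> hcochain g -> hcochain (c *: f + g).
Proof.
move=> [fl [N fN]] [gl [M gM]]; split=> [x z d a b|].
  rewrite !fctE fl gl !scalerDr !scalerA [d * c]mulrC -!addrA.
  by congr (_ + _); rewrite addrCA.
exists (maxn N M) => s; rewrite geq_max => /andP[Ns Ms].
by rewrite !fctE fN // gM // scaler0 addr0.
Qed.

Fact hdiff_lin (c : k) f g : hdiff (c *: f + g) = c *: hdiff f + hdiff g.
Proof.
apply/funext => -[|a t]; rewrite !fctE /=; first by rewrite scaler0 addr0.
rewrite mulrDr -scalerAr mulrDl -scalerAl !scalerDr.
rewrite (eq_bigr (fun i : 'I_(size t) =>
  c *: ((-1) ^+ i.+1 *:
     f (take i (a :: t) ++ (a :: t)`_i * t`_i :: drop i.+1 t)) +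
  (-1) ^+ i.+1 *:
     g (take i (a :: t) ++ (a :: t)`_i * t`_i :: drop i.+1 t))); last first.
  by move=> i _; rewrite scalerDr !scalerA mulrC.
rewrite big_split /= -scaler_sumr !scalerA [_ * c]mulrC -scalerA.
have ac (x y u v w r : A) : x + y + (u + v) + (w + r) = x + u + w + (y + v + r).
  by rewrite (addrACA x y u v) (addrACA (x + u) (y + v) w r).
exact: ac.
Qed.

Fact hcocycle_submod : submod_closed hcocycle_pred.
Proof.
have lin (c : k) (f g : seq A -> A) : f \in hcocycle_pred ->
    g \in hcocycle_pred -> c *: f + g \in hcocycle_pred.
  move=> /asboolP[fC fd] /asboolP[gC gd]; apply/asboolP.
  by split; [exact: hcochain_lin | rewrite hdiff_lin fd gd scaler0 addr0].
have C0 : hcochain (0 : seq A -> A).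
  by split=> [x z c a b|]; [rewrite scaler0 addr0 | exists 0%N].
split=> //; apply/asboolP; split=> //.
have := hdiff_lin 1 0 0; rewrite !scale1r addr0 => h.
by apply: (addrI (hdiff 0)); rewrite -h addr0.
Qed.

HB.instance Definition _ :=
  GRing.isSubmodClosed.Build k (seq A -> A) hcocycle_pred
    (GRing.submod_closed_semi hcocycle_submod).

Record hcocycle := HCocycle {
  hcocycle_fun :> seq A -> A;
  _ : hcocycle_fun \in hcocycle_pred }.

HB.instance Definition _ := [isSub for hcocycle_fun].
HB.instance Definition _ := [Choice of hcocycle by <:].
HB.instance Definition _ := [SubChoice_isSubLmodule of hcocycle by <:].

Definition hcoboundary_pred : {pred hcocycle} :=
  fun h : hcocycle => `[< exists2 g, hcochain g & val h = hdiff g >].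

Fact hcoboundary_submod : submod_closed hcoboundary_pred.
Proof.
split=> [|c f g /asboolP[f' f'C fE] /asboolP[g' g'C gE]]; apply/asboolP.
  have /asboolP[C0 d0] : (0 : seq A -> A) \in hcocycle_pred by exact: rpred0.
  by exists 0; rewrite // d0 raddf0.
exists (c *: f' + g'); first exact: hcochain_lin.
by rewrite hdiff_lin -fE -gE linearP.
Qed.

HB.instance Definition _ :=
  GRing.isSubmodClosed.Build k hcocycle hcoboundary_pred
    (GRing.submod_closed_semi hcoboundary_submod).

Definition HH : lmodType k := quotmod hcoboundary_pred.

Definition hclass (f : hcocycle) : HH := quotmod_proj hcoboundary_pred f.

Definition HH_deg (n : nat) : set HH :=
  [set x | exists2 f : hcocycle, homogeneous n f & x = hclass f].

(* m is induced by the operation op on homogeneous cochains; a bilinear m is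
   determined by this property. *)
Definition induced_on_HH (op : nat -> nat -> (seq A -> A) -> (seq A -> A) ->
    (seq A -> A)) (m : HH -> HH -> HH) : Prop :=
  forall (p q : nat) (f g : hcocycle), homogeneous p f -> homogeneous q g ->
    exists2 h : hcocycle,
      hcocycle_fun h = op p q f g & m (hclass f) (hclass g) = hclass h.

End Hochschild.

(* Main.v *)
From HB Require Import structures.
Require Import Defs.
From mathcomp Require Import all_boot all_order all_algebra.
From mathcomp Require Import zify.
From mathcomp Require Import boolp classical_sets functions.
Set Implicit Arguments.
Unset Strict Implicit.
Unset Printing Implicit Defensive.
Import GRing.Theory.
Local Open Scope ring_scope.

(** The form identifies a cochain [f] of degree [n] with the functional
    [ph f : (a_0, .., a_n) |-> eps (a_0 * f (a_1, .., a_n))], and the Hochschild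
    differential with the differential of cyclic words twisted by the Nakayama
    automorphism [sigma] (lemma [ph_hdiff]).  On words of [n + 1] letters the
    signed rotation [tw] has the action of [sigma] as its power of exponent
    [n + 1], and the sum [nrm] over the rotations satisfies
    [nrm (1 - tw) = 1 - sigma] (lemma [nrm_tw]).  The operator [conn], of degree
    -1, sends [f] to the cochain that corresponds to the norm of [eps \o f].  It
    satisfies [d conn + conn d = 1 - T], where [T] is the twist of cochains by
    [sigma] (lemma [conn_hdiff]).  Hence [T] acts as the identity on cohomology.

    As the form represents every functional on [A], a diagonalisable Nakayama automorphism has
    finitely many eigenvalues (lemma [finite_spectrum]).  So [T] is diagonalisable
    with finitely many eigenvalues on the cochains of a given degree, and the
    projection onto the invariant cochains is a polynomial in [T].  It follows
    that every cocycle is cohomologous to an invariant one (lemma [inv_rep]), and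
    that an invariant coboundary is the coboundary of an invariant cochain.  As
    [conn] anticommutes with [d] on invariant cochains, it maps invariant
    coboundaries to coboundaries (lemma [inv_exact]), and it acts on cohomology
    through invariant representatives.  Its square is zero there: up to sign,
    [conn (conn f)] corresponds to the norm of the contraction of [conn f] with
    the unit of [A], which is a coboundary by an explicit formula (lemma
    [conn_sq]).

    The Batalin-Vilkovisky identity comes from a homotopy.  In the norm of
    [eps (f U g)] the first letter of the word is an argument of [f] or of [g]
    (lemma [nrm_cup]).  Insert [g] in the rotations of [eps \o f], at a place that
    follows the first letter; the cyclic differential of this functional compares
    the first part with the functionals of [f o g] and of [g U conn f] (lemma
    [cyd_cins_eps]).  Adding the two parts gives [conn (f U g)] in terms of the
    bracket, up to a coboundary (lemma [conn_cup]).

    The Gerstenhaber structure itself rests on two homotopies: the insertion of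
    [g] in [f] relates the products [f U g] and [g U f] (lemma [hdiff_ins]), and
    the insertion of two cocycles in a third one gives the Leibniz rule (lemma
    [hdiff_ins2]).  The Jacobi identity is then a formal consequence of the
    Batalin-Vilkovisky identity, of the Leibniz rule and of the vanishing of the
    square of the operator (lemma [bv_jacobi]).

    All operations are written as sums over the splittings of a word, with signs
    that depend on the lengths of the parts and on the parities of the cochains
    only; their compatibilities follow from the coassociativity
    of splitting (lemma [spl_assoc]) and from the fact that merging adjacent
    letters is a coderivation (lemma [mrg_spl]). *)

(** * Identities in abelian groups *)

(** Expressions in an abelian group; [ZVar n] stands for the [n]-th entry of an
    environment. *)
Inductive zexp := ZVar of nat | ZZero | ZAdd of zexp & zexp | ZOpp of zexp.

Fixpoint zden (V : zmodType) (env : seq V) (e : zexp) : V :=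
  match e with
  | ZVar n => nth 0 env n
  | ZZero => 0
  | ZAdd e1 e2 => zden env e1 + zden env e2
  | ZOpp e1 => - zden env e1
  end.

(** The number of occurrences of [ZVar n] in [e] with sign [+] (if [b] is
    [false]) or [-] (if [b] is [true]). *)
Fixpoint zcount (b : bool) (e : zexp) (n : nat) : nat :=
  match e with
  | ZVar m => if b then 0 else m == n
  | ZZero => 0
  | ZAdd e1 e2 => zcount b e1 n + zcount b e2 n
  | ZOpp e1 => zcount (~~ b) e1 n
  end.

Lemma zdenE (V : zmodType) (env : seq V) (e : zexp) :
  zden env e =
  \sum_(i < size env) (env`_i *+ zcount false e i - env`_i *+ zcount true e i).
Proof.
elim: e => [n||e1 IH1 e2 IH2|e1 IH1] /=.
- have [lt_n|ge_n] := ltnP n (size env); last first.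
    rewrite nth_default // big1 // => i _.
    by rewrite gtn_eqF ?(leq_trans (ltn_ord i)) // subr0.
  rewrite (bigD1 (Ordinal lt_n)) //= eqxx mulr1n subr0 big1 ?addr0 // => i.
  by rewrite -val_eqE /= eq_sym => /negbTE ->; rewrite subr0.
- by rewrite big1 // => i _; rewrite subr0.
- rewrite IH1 IH2 -big_split; apply: eq_bigr => i _ /=.
  by rewrite !mulrnDr opprD addrACA.
- by rewrite IH1 -sumrN; apply: eq_bigr => i _; rewrite opprB.
Qed.

Lemma zden_eq (V : zmodType) (env : seq V) (e1 e2 : zexp) :
  all (fun i => zcount false e1 i + zcount true e2 i ==
                zcount false e2 i + zcount true e1 i)%N (iota 0 (size env)) ->
  zden env e1 = zden env e2.
Proof.
move=> /allP h; rewrite !zdenE; apply: eq_bigr => i _.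
have := h i; rewrite mem_iota ltn_ord => /(_ isT)/eqP hi.
apply/eqP; rewrite subr_eq addrAC eq_sym subr_eq; apply/eqP.
by rewrite -!mulrnDr hi.
Qed.

(* With this empty database [unify] compares atoms without unfolding constants. *)
Create HintDb abel_opaque discriminated.

Ltac zlookup x l :=
  match l with
  | ?y :: _ => let _ := match goal with _ => unify x y with abel_opaque end in
               constr:(Some 0%N)
  | _ :: ?r => match zlookup x r with
               | Some ?n => constr:(Some (S n))
               | None => constr:(@None nat)
               end
  | _ => constr:(@None nat)
  end.

Ltac zlength l :=
  match l with
  | _ :: ?r => let n := zlength r in constr:(S n)
  | _ => constr:(0%N)
  end.

Ltac zsnoc V l t :=
  match l with
  | ?x :: ?r => let r' := zsnoc V r t in constr:(@cons V x r')
  | _ => constr:(@cons V t nil)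
  end.

Ltac zreify V l t :=
  match t with
  | (?a + ?b)%R =>
      match zreify V l a with
      | (?l1, ?e1) => match zreify V l1 b with
                      | (?l2, ?e2) => constr:((l2, ZAdd e1 e2))
                      end
      end
  | (- ?a)%R => match zreify V l a with (?l1, ?e1) => constr:((l1, ZOpp e1)) end
  | 0%R => constr:((l, ZZero))
  | _ => match zlookup t l with
         | Some ?n => constr:((l, ZVar n))
         | None => let n := zlength l in
                   let l' := zsnoc V l t in
                   constr:((l', ZVar n))
         end
  end.

(** Decides the identities between sums that hold in every abelian group. *)
Ltac abel :=
  match goal with
  | |- @eq ?V ?a ?b =>
      match zreify V (@nil V) a with
      | (?l1, ?e1) => match zreify V l1 b with
          | (?l2, ?e2) => apply: (@zden_eq _ l2 e1 e2); vm_compute; reflexivity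
          end
      end
  end.

(** * Sums over the splittings of a word *)

(** The sign [(-1)^b]. *)
Definition sg (V : zmodType) (b : bool) (v : V) : V := if b then - v else v.

Section Signs.
Variable V : zmodType.
Implicit Types (u v : V) (b c : bool).

Lemma sg0 b : sg b (0 : V) = 0. Proof. by case: b => //=; rewrite /sg oppr0. Qed.
Lemma sgD b u v : sg b (u + v) = sg b u + sg b v.
Proof. by case: b => //=; rewrite /sg opprD. Qed.
Lemma sgN b v : sg b (- v) = - sg b v. Proof. by case: b. Qed.
Lemma sgB b u v : sg b (u - v) = sg b u - sg b v.
Proof. by rewrite sgD sgN. Qed.
Lemma sgsg b c v : sg b (sg c v) = sg (b (+) c) v.
Proof. by case: b; case: c; rewrite /sg /= ?opprK. Qed.
Lemma sgK b v : sg b (sg b v) = v. Proof. by rewrite sgsg addbb. Qed.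
Lemma sg_negb b v : sg (~~ b) v = - sg b v.
Proof. by case: b; rewrite /sg //= opprK. Qed.

End Signs.

Lemma sg_additive (V W : zmodType) (h : V -> W) b v :
  h (- v) = - h v -> h (sg b v) = sg b (h v).
Proof. by case: b. Qed.

Lemma sgMl (R : pzRingType) b (x y : R) : sg b x * y = sg b (x * y).
Proof. by case: b; rewrite /sg ?mulNr. Qed.
Lemma sgMr (R : pzRingType) b (x y : R) : x * sg b y = sg b (x * y).
Proof. by case: b; rewrite /sg ?mulrN. Qed.
Lemma sgZ (R : pzRingType) (V : lmodType R) b (c : R) (v : V) :
  c *: sg b v = sg b (c *: v).
Proof. by case: b; rewrite /sg ?scalerN. Qed.
Lemma signE (R : pzRingType) (V : lmodType R) (n : nat) (v : V) :
  (-1) ^+ n *: v = sg (odd n) v.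
Proof. by rewrite -signr_odd scaler_sign. Qed.

(** [spl G s] is the sum of the [G x y] over all splittings [s = x ++ y]. *)
Fixpoint spl (T : Type) (V : zmodType) (G : seq T -> seq T -> V) (s : seq T) : V :=
  match s with
  | [::] => G [::] [::]
  | a :: t => G [::] s + spl (fun x y => G (a :: x) y) t
  end.

(** [rc H s] is [H x c] if [s = rcons x c], and [0] if [s] is empty. *)
Definition rc (T : Type) (V : zmodType) (H : seq T -> T -> V) (s : seq T) : V :=
  if s is b :: t then H (belast b t) (last b t) else 0.

Section Split.
Variables (T : Type) (V : zmodType).
Implicit Types (G X : seq T -> seq T -> V) (H : seq T -> T -> V) (s t x y : seq T).

Lemma rc_rcons H x c : rc H (rcons x c) = H x c.
Proof. by case: x => //= b x; rewrite belast_rcons last_rcons. Qed.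

Lemma eq_spl_in G G' s : (forall x y, x ++ y = s -> G x y = G' x y) ->
  spl G s = spl G' s.
Proof.
elim: s G G' => [|a s IH] G G' h /=; first exact: h.
rewrite h // (IH _ (fun x y => G' (a :: x) y)) // => x y xy.
by apply: h; rewrite /= xy.
Qed.

Lemma eq_spl G G' s : G =2 G' -> spl G s = spl G' s.
Proof. by move=> h; apply: eq_spl_in. Qed.

Lemma splD G G' s : spl (fun x y => G x y + G' x y) s = spl G s + spl G' s.
Proof.
elim: s G G' => [|a s IH] G G' //=.
by rewrite (IH (fun x y => G (a :: x) y)) addrACA.
Qed.

Lemma splN G s : spl (fun x y => - G x y) s = - spl G s.
Proof.
elim: s G => [|a s IH] G //=.
by rewrite (IH (fun x y => G (a :: x) y)) opprD.
Qed.

Lemma splB G G' s : spl (fun x y => G x y - G' x y) s = spl G s - spl G' s.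
Proof. by rewrite (splD G (fun x y => - G' x y)) splN. Qed.

Lemma spl_sg b G s : spl (fun x y => sg b (G x y)) s = sg b (spl G s).
Proof. by case: b => //; exact: splN. Qed.

Lemma spl0 s : spl (fun _ _ => 0 : V) s = 0.
Proof. by elim: s => //= a s ->; rewrite addr0. Qed.

Lemma spl_eq0 G s : (forall x y, x ++ y = s -> G x y = 0) -> spl G s = 0.
Proof. by move=> h; rewrite -[RHS](spl0 s); apply: eq_spl_in. Qed.

Lemma spl_first G s : (forall a x y, G (a :: x) y = 0) -> spl G s = G [::] s.
Proof. by case: s => //= a s h; rewrite spl_eq0 ?addr0. Qed.

Lemma spl_rcons G s a :
  spl G (rcons s a) = spl (fun x y => G x (rcons y a)) s + G (rcons s a) [::].
Proof.
elim: s G => [|b s IH] G //=.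
by rewrite (IH (fun x y => G (b :: x) y)) addrA.
Qed.

Lemma spl_last G s : (forall x y a, G x (rcons y a) = 0) -> spl G s = G s [::].
Proof. by case/lastP: s => // s a h; rewrite spl_rcons spl_eq0 ?add0r. Qed.

Lemma spl_assoc (K : seq T -> seq T -> seq T -> V) s :
  spl (fun x z => spl (fun u v => K u v z) x) s =
  spl (fun u w => spl (fun v z => K u v z) w) s.
Proof.
elim: s K => [|a s IH] K //=.
by rewrite splD (IH (fun u v z => K (a :: u) v z)) !addrA.
Qed.

Lemma spl_cat_cons G x a z :
  spl G (x ++ a :: z) = spl (fun u v => G u (v ++ a :: z)) x +
                        spl (fun u v => G (x ++ a :: u) v) z.
Proof.
elim: x G => [|b x IH] G //=.
by rewrite (IH (fun x y => G (b :: x) y)) addrA.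
Qed.

Lemma spl_map (h : T -> T) G s :
  spl G (map h s) = spl (fun x y => G (map h x) (map h y)) s.
Proof.
elim: s G => [|a s IH] G //=.
by rewrite (IH (fun x y => G (h a :: x) y)).
Qed.

(* Moving the last letter of [x] to the front of [y] matches the two sums
   except for one term. *)
Lemma spl_telescope X s :
  spl X s = X s [::] + spl (fun r z => rc (fun x c => X x (c :: z)) r) s.
Proof.
elim: s X => [|a s IH] X /=; first by rewrite addr0.
rewrite (IH (fun x y => X (a :: x) y)) add0r.
rewrite [in RHS](eq_spl (G' := fun r z => (if r is [::] then X [::] (a :: z) else 0)
   + rc (fun x c => X (a :: x) (c :: z)) r)); last first.
  by case=> [|b r] z /=; rewrite ?addr0 ?add0r.
by rewrite splD (@spl_first (fun r z => if r is [::] then _ else 0)) // addrCA.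
Qed.

End Split.

Lemma spl_morph (T : Type) (V W : zmodType) (h : V -> W)
    (hD : {morph h : u v / u + v}) (G : seq T -> seq T -> V) s :
  h (spl G s) = spl (fun x y => h (G x y)) s.
Proof. by elim: s G => //= a s IH G; rewrite hD IH. Qed.

(** * Merging adjacent letters *)

Section Merge.
Variable (A : pzRingType) (V : zmodType).
Implicit Types (F : seq A -> V) (s t u w : seq A).

(** The merge of the letter [a] with the first letter of [t]. *)
Definition mrg1 (a : A) F t : V := if t is b :: u then F (a * b :: u) else 0.

(** [mrg F [:: a_1; a_2; ..]] is the alternating sum
    [F [:: a_1 * a_2; a_3; ..] - F [:: a_1; a_2 * a_3; ..] + ..]. *)
Fixpoint mrg F s : V :=
  if s is a :: t then mrg1 a F t - mrg (fun u => F (a :: u)) t else 0.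

Lemma eq_mrg_size F F' s :
  (forall u, size u = (size s).-1 -> F u = F' u) -> mrg F s = mrg F' s.
Proof.
elim: s F F' => //= a [|b s] IH F F' h /=; first by rewrite subr0.
by rewrite h //=; congr (_ - _); apply: IH => u hu; apply: h; rewrite /= hu.
Qed.

Lemma eq_mrg F F' s : F =1 F' -> mrg F s = mrg F' s.
Proof. by move=> h; apply: eq_mrg_size. Qed.

Lemma mrgD F F' s : mrg (fun u => F u + F' u) s = mrg F s + mrg F' s.
Proof.
elim: s F F' => [|a s IH] F F' /=; first by rewrite addr0.
rewrite (IH (fun u => F (a :: u))); case: s {IH} => [|b s] /=; abel.
Qed.

Lemma mrgN F s : mrg (fun u => - F u) s = - mrg F s.
Proof.
elim: s F => [|a s IH] F /=; first by rewrite oppr0.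
rewrite (IH (fun u => F (a :: u))); case: s {IH} => [|b s] /=; abel.
Qed.

Lemma mrg_sg b F s : mrg (fun u => sg b (F u)) s = sg b (mrg F s).
Proof. by case: b => //; exact: mrgN. Qed.

Lemma mrg0 s : mrg (fun=> 0 : V) s = 0.
Proof. by elim: s => //= a [|b s] ->; rewrite /= subr0. Qed.

Lemma mrg_rcons F u a : mrg F (rcons u a) =
  mrg (fun w => F (rcons w a)) u +
  rc (fun w c => sg (odd (size w)) (F (rcons w (c * a)))) u.
Proof.
elim: u F => [|b u IH] F /=; first by rewrite subr0 addr0.
rewrite (IH (fun w => F (b :: w))); case/lastP: u {IH} => [|u c] /=.
  by rewrite /sg /=; abel.
rewrite rc_rcons belast_rcons last_rcons /=.
rewrite sg_negb; case: u => [|d u] /=; abel.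
Qed.

Lemma mrg_cat F u a r : mrg F (u ++ a :: r) =
  mrg (fun w => F (w ++ r)) (rcons u a) +
  sg (odd (size u)) (mrg1 a (fun x => F (u ++ x)) r -
                     mrg (fun x => F (rcons u a ++ x)) r).
Proof.
elim: u F => [|b u IH] F /=; first by rewrite subr0 add0r.
rewrite (IH (fun w => F (b :: w))) sg_negb.
by case: u {IH} => [|c u] /=; rewrite ?cat_rcons; abel.
Qed.

Lemma mrg_map (h : A -> A) (hM : {morph h : x y / x * y}) F s :
  mrg F (map h s) = mrg (fun u => F (map h u)) s.
Proof.
elim: s F => //= a s IH F; rewrite IH.
by case: s {IH} => //= b s; rewrite hM.
Qed.

(** Merging two adjacent letters never crosses a splitting. *)
Lemma mrg_spl (G : seq A -> seq A -> V) s :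
  mrg (spl G) s =
  spl (fun x y => mrg (fun x => G x y) x + sg (odd (size x)) (mrg (G x) y)) s.
Proof.
elim: s G => [|a s IH] G /=; first by rewrite addr0.
rewrite add0r.
have -> : mrg1 a (spl G) s =
    mrg1 a (G [::]) s + spl (fun x y => mrg1 a (fun x => G x y) x) s.
  by case: s {IH} => [|b s] /=; rewrite ?addr0 ?add0r.
rewrite mrgD (IH (fun x y => G (a :: x) y)).
rewrite [in RHS](eq_spl (G' := fun x y => mrg1 a (fun x => G x y) x -
   (mrg (fun x => G (a :: x) y) x + sg (odd (size x)) (mrg (G (a :: x)) y)))).
  by rewrite splB; abel.
by move=> x y; rewrite sg_negb; abel.
Qed.

End Merge.

Lemma mrg_morph (A : pzRingType) (V W : zmodType) (h : V -> W)
    (hB : {morph h : u v / u - v}) (F : seq A -> V) s :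
  h (mrg F s) = mrg (fun u => h (F u)) s.
Proof.
have h0 : h 0 = 0 by rewrite -[0](subrr 0) hB subrr.
by elim: s F => //= a s IH F; rewrite hB IH; case: s {IH} => [|b s] /=; rewrite ?h0.
Qed.

(** * Additive functions of words *)

Section Additive.
Variables (A : pzRingType) (V : zmodType).
Implicit Types (F : seq A -> V) (g : seq A -> A) (s t x y z : seq A).

(** [F] is additive in each letter. *)
Definition madd F : Prop := forall x z a b,
  F (x ++ (a + b) :: z) = F (x ++ a :: z) + F (x ++ b :: z).

Lemma madd0 F x z : madd F -> F (x ++ 0 :: z) = 0.
Proof. by move=> h; apply: (addrI (F (x ++ 0 :: z))); rewrite -h !addr0. Qed.

Lemma maddN F x z a : madd F -> F (x ++ - a :: z) = - F (x ++ a :: z).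
Proof.
by move=> h; apply: (addrI (F (x ++ a :: z))); rewrite -h !subrr madd0.
Qed.

Lemma maddB F x z a b : madd F ->
  F (x ++ (a - b) :: z) = F (x ++ a :: z) - F (x ++ b :: z).
Proof. by move=> h; rewrite h maddN. Qed.

Lemma madd_sg F x z b a : madd F -> F (x ++ sg b a :: z) = sg b (F (x ++ a :: z)).
Proof. by move=> h; case: b => //; apply: maddN. Qed.

Lemma madd_cons F a : madd F -> madd (fun u => F (a :: u)).
Proof. by move=> h x; exact: (h (a :: x)). Qed.

Lemma madd_cat F w : madd F -> madd (fun u => F (w ++ u)).
Proof. by move=> h x z a b; rewrite !catA h. Qed.

Lemma madd_spl F x z (G : seq A -> seq A -> A) s : madd F ->
  F (x ++ spl G s :: z) = spl (fun u v => F (x ++ G u v :: z)) s.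
Proof.
move=> h; apply: (spl_morph (h := fun a => F (x ++ a :: z))) => a b; exact: h.
Qed.

(** A function whose values at the words of length not congruent to [j]
    modulo 2 are killed by [2]; it has parity [j]. *)
Definition par (j : bool) F : Prop := forall s, sg (odd (size s)) (F s) = sg j (F s).

End Additive.

Lemma sgMM (R : pzRingType) b c (x y : R) : sg b x * sg c y = sg (b (+) c) (x * y).
Proof. by rewrite sgMl sgMr sgsg. Qed.

(** * The cup product and the differential *)
Section Operations.
Variables (k : fieldType) (A : algType k).
Implicit Types (f g h : seq A -> A) (s t x y z : seq A) (b j : bool).

(** The identity of [A] as a cochain of degree 1. *)
Definition iota1 s : A := if s is [:: a] then a else 0.

(** The cup product of arbitrary, not necessarily homogeneous, cochains. *)
Definition cup f g s : A := spl (fun x y => f x * g y) s.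

(** [gm b f] is [(-1)^n f] in degree [n] if [b] holds, and [f] otherwise. *)
Definition gm (V : zmodType) b (F : seq A -> V) s : V := sg (b && odd (size s)) (F s).

Lemma cup_iotal f s : cup iota1 f s = if s is a :: t then a * f t else 0.
Proof.
case: s => [|a s]; rewrite /cup /= mul0r // add0r.
by rewrite (@spl_first _ _ (fun x y => iota1 (a :: x) * f y)) // => *; rewrite mul0r.
Qed.

Lemma cup_iotar f s : cup f iota1 s = rc (fun x c => f x * c) s.
Proof.
case/lastP: s => [|s c]; rewrite /cup /= ?mulr0 // rc_rcons spl_rcons mulr0 addr0.
rewrite (@spl_last _ _ (fun x y => f x * iota1 (rcons y c))) // => x y a.
by case: y => [|b y] /=; rewrite ?mulr0 //; case: y => //=; rewrite mulr0.
Qed.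

Lemma cup_assoc f g h s : cup f (cup g h) s = cup (cup f g) h s.
Proof.
rewrite /cup.
rewrite [RHS](eq_spl (G' := fun x z => spl (fun u v => f u * g v * h z) x)); last first.
  by move=> x z; apply: (spl_morph (h := fun a => a * h z)) => a b; exact: mulrDl.
rewrite spl_assoc; apply: eq_spl => x y.
rewrite (spl_morph (h := fun a => f x * a)); first by apply: eq_spl => u v; rewrite mulrA.
by move=> a b; exact: mulrDr.
Qed.

Lemma cupDl f f' g s : cup (fun s => f s + f' s) g s = cup f g s + cup f' g s.
Proof. by rewrite /cup -splD; apply: eq_spl => x y; rewrite mulrDl. Qed.
Lemma cupDr f g g' s : cup f (fun s => g s + g' s) s = cup f g s + cup f g' s.
Proof. by rewrite /cup -splD; apply: eq_spl => x y; rewrite mulrDr. Qed.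
Lemma cupNl f g s : cup (fun s => - f s) g s = - cup f g s.
Proof. by rewrite /cup -splN; apply: eq_spl => x y; rewrite mulNr. Qed.
Lemma cupNr f g s : cup f (fun s => - g s) s = - cup f g s.
Proof. by rewrite /cup -splN; apply: eq_spl => x y; rewrite mulrN. Qed.
Lemma cup_sgl b f g s : cup (fun s => sg b (f s)) g s = sg b (cup f g s).
Proof. by case: b => //; exact: cupNl. Qed.
Lemma cup_sgr b f g s : cup f (fun s => sg b (g s)) s = sg b (cup f g s).
Proof. by case: b => //; exact: cupNr. Qed.
Lemma cup0l g s : cup (fun=> 0) g s = 0.
Proof. by apply: spl_eq0 => *; rewrite mul0r. Qed.
Lemma cup0r f s : cup f (fun=> 0) s = 0.
Proof. by apply: spl_eq0 => *; rewrite mulr0. Qed.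

Lemma eq_cup f f' g g' s : f =1 f' -> g =1 g' -> cup f g s = cup f' g' s.
Proof. by move=> ff gg; apply: eq_spl => x y; rewrite ff gg. Qed.

Lemma mrg_cup f g s :
  mrg (cup f g) s = cup (mrg f) g s + cup (gm true f) (mrg g) s.
Proof.
rewrite (mrg_spl (fun x y => f x * g y)) splD; congr (_ + _); apply: eq_spl => x y.
  by rewrite (mrg_morph (h := fun a => a * g y)) // => u v; exact: mulrBl.
rewrite /gm sgMl /=; congr sg.
by rewrite (mrg_morph (h := fun a => f x * a)) // => u v; exact: mulrBr.
Qed.

(** The differential is the sum of the merges, twisted by the identity cochain. *)
Lemma hdiffE f s :
  hdiff f s = cup iota1 f s - mrg f s + sg (odd (size s)) (cup f iota1 s).
Proof.
rewrite cup_iotal cup_iotar; case: s => [|a s].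
  by rewrite /sg /= subr0 addr0.
rewrite /= signE; congr (_ + _ + _).
rewrite -/(mrg f (a :: s)).
elim: s f a => [|b s IH] f a; first by rewrite big_ord0 /= subr0 oppr0.
rewrite big_ord_recl /= expr1 scaleN1r !drop0 opprB [RHS]addrC; congr (_ + _).
rewrite -[RHS]opprK -/(mrg (fun u => f (a :: u)) (b :: s)) -IH -sumrN.
by apply: eq_bigr => i _; rewrite /= -scaleNr exprS mulN1r.
Qed.

Lemma par_cup i j f g : par i f -> par j g -> par (i (+) j) (cup f g).
Proof.
move=> pf pg s; rewrite /cup -!spl_sg; apply: eq_spl_in => x y <-.
by rewrite size_cat oddD -!sgMM pf pg.
Qed.

Lemma par_iota : par true iota1.
Proof. by case=> [|a [|d s]] //; rewrite /iota1 !sg0. Qed.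

Lemma gm_par b j (F : seq A -> A) : par j F -> gm b F =1 (fun s => sg (b && j) (F s)).
Proof. by move=> p s; rewrite /gm; case: b => //=; exact: p. Qed.

Lemma hdiff_par j f s : par j f ->
  hdiff f s = cup iota1 f s - mrg f s - sg j (cup f iota1 s).
Proof.
move=> pf; rewrite hdiffE; congr (_ + _).
by rewrite (par_cup pf par_iota s) addbT sg_negb.
Qed.

(** * Sums over the insertions of a cochain in a word *)

Section Sweep.
Variable V : zmodType.
Implicit Types (F G : seq A -> V) (Lam T : (seq A -> V) -> seq A -> V).

(** [insl g F s] is the sum over [s = y ++ z] of [F (g y :: z)]. *)
Definition insl g F s : V := spl (fun y z => F (g y :: z)) s.

(** [sweep b Lam F s] is the sum over [s = x ++ t] of
    [Lam (fun u => F (x ++ u)) t], with sign [(-1)^|x|] if [b] holds. *)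
Fixpoint sweep b Lam F s : V :=
  Lam F s + (if s is a :: t then sg b (sweep b Lam (fun u => F (a :: u)) t) else 0).

(** [ins b g F s] is the sum over [s = x ++ y ++ z] of [F (x ++ g y :: z)],
    with sign [(-1)^|x|] if [b] holds. *)
Definition ins b g := sweep b (insl g).

Lemma eq_sweep b Lam Lam' F F' s :
  (forall G G', G =1 G' -> Lam G =1 Lam' G') -> F =1 F' ->
  sweep b Lam F s = sweep b Lam' F' s.
Proof.
move=> hL; elim: s F F' => [|a s IH] F F' hF /=; first by rewrite (hL _ _ hF).
rewrite (hL _ _ hF); congr (_ + sg b _).
by apply: IH => u; exact: hF.
Qed.

Lemma eq_insl g g' F F' s : g =1 g' -> F =1 F' -> insl g F s = insl g' F' s.
Proof. by move=> hg hF; apply: eq_spl => y z; rewrite hg hF. Qed.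

Lemma eq_ins b g g' F F' s : g =1 g' -> F =1 F' -> ins b g F s = ins b g' F' s.
Proof. by move=> hg hF; apply: eq_sweep => // G G' hG t; exact: eq_insl. Qed.

Lemma sweepB b Lam F G s :
  (forall F G s, Lam (fun u => F u - G u) s = Lam F s - Lam G s) ->
  sweep b Lam (fun u => F u - G u) s = sweep b Lam F s - sweep b Lam G s.
Proof.
move=> hL; elim: s F G => [|a s IH] F G /=; first by rewrite hL !addr0.
by rewrite hL (IH (fun u => F (a :: u))) sgB; abel.
Qed.

Lemma inslB g F G s : insl g (fun u => F u - G u) s = insl g F s - insl g G s.
Proof. exact: splB. Qed.

Lemma insB b g F G s : ins b g (fun u => F u - G u) s = ins b g F s - ins b g G s.
Proof. by apply: sweepB => *; exact: inslB. Qed.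

Lemma inslN g F s : insl g (fun u => - F u) s = - insl g F s.
Proof. exact: splN. Qed.

Lemma insN b g F s : ins b g (fun u => - F u) s = - ins b g F s.
Proof.
rewrite /ins; elim: s F => [|a s IH] F; rewrite [LHS]/= [in RHS]/= inslN; first by rewrite !addr0.
rewrite (IH (fun u => F (a :: u))) sgN; abel.
Qed.

Lemma insD b g F G s : ins b g (fun u => F u + G u) s = ins b g F s + ins b g G s.
Proof.
rewrite -[X in _ = _ + X]opprK -insN -insB.
by apply: eq_ins => // u; rewrite opprK.
Qed.

Lemma ins_sg b c g F s : ins b g (fun u => sg c (F u)) s = sg c (ins b g F s).
Proof. by case: c => //; exact: insN. Qed.

Lemma ins0 b g F s : (forall u, u != [::] -> F u = 0) -> ins b g F s = 0.
Proof.
rewrite /ins; elim: s F => [|a s IH] F hF /=.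
  by rewrite /insl /= hF // addr0.
rewrite IH; last by move=> u _; exact: hF.
by rewrite sg0 addr0 /insl spl_eq0 // => x y _; exact: hF.
Qed.

Lemma insDl b g g' F s : madd F ->
  ins b (fun y => g y + g' y) F s = ins b g F s + ins b g' F s.
Proof.
rewrite /ins; elim: s F => [|a s IH] F hF /=.
  by rewrite /insl /= (hF [::]) !addr0.
rewrite (IH (fun u => F (a :: u))); last exact: madd_cons.
rewrite {1}/insl (eq_spl (G' := fun y z => F (g y :: z) + F (g' y :: z))); last first.
  by move=> y z; exact: (hF [::]).
rewrite splD sgD /insl; abel.
Qed.

Lemma ins0l b F s : madd F -> ins b (fun=> 0) F s = 0.
Proof.
move=> hF; have := @insDl b (fun=> 0) (fun=> 0) F s hF.
by rewrite addr0 => /eqP; rewrite -subr_eq0 opprD addNKr oppr_eq0 => /eqP.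
Qed.

(** The commutation of merging with [Lam] passes to [sweep]; the last term of
    the hypothesis accounts for the letter on the left of the inserted part. *)
Lemma mrg_sweep b Lam T F s (C : (seq A -> V) -> Prop) :
  (forall F a, C F -> C (fun u => F (a :: u))) ->
  (forall F G s, Lam (fun u => F u - G u) s = Lam F s - Lam G s) ->
  (forall F G, F =1 G -> Lam F =1 Lam G) ->
  (forall F s, C F -> mrg (Lam F) s = sg b (Lam (mrg F) s) + T F s +
     (if s is a :: t then Lam (mrg1 a F) t else 0)) ->
  C F ->
  mrg (sweep b Lam F) s = sg b (sweep b Lam (mrg F) s) + sweep (~~ b) T F s.
Proof.
move=> CF LB Leq LT; elim: s F => [|a s IH] F hF.
  by have := LT F [::] hF; rewrite /= !addr0.
pose S F s := if s is a :: t then sg b (sweep b Lam (fun u => F (a :: u)) t) else 0.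
have swE G : sweep b Lam G =1 (fun s => Lam G s + S G s) by case.
rewrite (eq_mrg _ (swE F)) mrgD LT // swE.
have -> : mrg (S F) (a :: s) = S (mrg1 a F) s -
    (sweep b Lam (mrg (fun u => F (a :: u))) s +
     sg b (sweep (~~ b) T (fun u => F (a :: u)) s)).
  have -> : mrg (S F) (a :: s) = mrg1 a (S F) s -
      mrg (fun u => sg b (sweep b Lam (fun u => F (a :: u)) u)) s by [].
  rewrite mrg_sg IH; last exact: CF.
  by rewrite sgD sgK; congr (_ - _); case: (s).
have -> : S (mrg F) (a :: s) = sg b (Lam (mrg1 a F) s + S (mrg1 a F) s -
    sweep b Lam (mrg (fun u => F (a :: u))) s) by rewrite -swE -sweepB.
rewrite [sweep (~~ b) T F (a :: s)]/=.
by case: b {LT IH swE} @S => /=; rewrite /sg; abel.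
Qed.
End Sweep.

End Operations.

Section Insertion.
Variables (k : fieldType) (A : algType k).
Implicit Types (f g h : seq A -> A) (s t x y z : seq A) (b j : bool).

Section Values.
Variable V : zmodType.
Implicit Types (F G : seq A -> V).

Lemma insl_hdiff j g F s : madd F -> par j g ->
  mrg (insl g F) s = sg (~~ j) (insl g (mrg F) s) - insl (hdiff g) F s +
    (if s is a :: t then insl g (mrg1 a F) t else 0).
Proof.
move=> hF pg.
have hF1 u v z : F ((u - v) :: z) = F (u :: z) - F (v :: z) := maddB [::] z u v hF.
pose S := spl (fun y z => mrg (fun u => F (g y :: u)) z) s.
pose R := spl (fun y z => mrg1 (g y) F z) s.
have -> : mrg (insl g F) s = insl (mrg g) F s + sg j S.
  rewrite mrg_spl splD -spl_sg; congr (_ + _); apply: eq_spl => y z.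
    by rewrite (mrg_morph (h := fun a => F (a :: z))).
  have hN (w : A) c : sg c (mrg (fun u => F (w :: u)) z) =
      mrg (fun u => F (sg c w :: u)) z.
    by rewrite -mrg_sg; apply: eq_mrg => u; rewrite (madd_sg [::]).
  by rewrite !hN pg.
have -> : insl g (mrg F) s = R - S by rewrite -splB; apply: eq_spl.
have -> : insl (hdiff g) F s = (if s is a :: t then insl g (mrg1 a F) t else 0)
    - insl (mrg g) F s - sg j R.
  have -> : insl (hdiff g) F s = insl (cup (@iota1 k A) g) F s
      - insl (mrg g) F s - sg j (insl (cup g (@iota1 k A)) F s).
    rewrite -spl_sg -!splB; apply: eq_spl => y z.
    by rewrite (hdiff_par _ pg) !hF1 (madd_sg [::]).
  congr (_ - _ - sg j _).
    have F0 z : F (0 :: z) = 0 := madd0 [::] z hF.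
    rewrite /insl; case: s {S R} => [|a s] /=; first by rewrite cup_iotal F0.
    by rewrite cup_iotal F0 add0r; apply: eq_spl => y z; rewrite cup_iotal.
  rewrite /insl /cup.
  rewrite (eq_spl (G' := fun x z => spl (fun u v => F (g u * iota1 v :: z)) x)); last first.
    by move=> x z; rewrite (madd_spl [::]).
  rewrite spl_assoc; apply: eq_spl => u [|a w] /=; rewrite mulr0 ?(madd0 [::]) //.
  rewrite add0r (@spl_first _ _ (fun v z => F (g u * iota1 (a :: v) :: z))) //.
  by move=> c x y; rewrite /= mulr0 (madd0 [::]).
by case: j {pg} => /=; rewrite /sg /=; abel.
Qed.

(** Merging commutes up to sign with the insertion of [g], modulo the insertion
    of the differential of [g]. *)
Lemma mrg_ins j g F s : madd F -> par j g ->
  mrg (ins (~~ j) g F) s = sg (~~ j) (ins (~~ j) g (mrg F) s) - ins j (hdiff g) F s.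
Proof.
move=> hF pg; rewrite /ins (@mrg_sweep _ _ _ _ _ (fun F s => - insl (hdiff g) F s) _ _ (@madd A V)) //.
- congr (_ + _); rewrite negbK /ins.
  elim: s F hF => [|a s IH] F hF; rewrite [LHS]/= [in RHS]/=; first by rewrite !addr0.
  by rewrite (IH (fun u => F (a :: u))); [rewrite sgN; abel | exact: madd_cons].
- by move=> G a; exact: madd_cons.
- by move=> G H t; exact: inslB.
- by move=> G H GH t; exact: eq_insl.
- by move=> G t hG; rewrite (insl_hdiff t hG pg).
Qed.

End Values.

Lemma ins_iota b g s : ins b g (@iota1 k A) s = g s.
Proof.
have L t : insl g (@iota1 k A) t = g t.
  by rewrite /insl spl_last // => x [|e y] a.
case: s => [|a s]; rewrite /ins /= L ?addr0 //.
by rewrite -/(ins _ _) ins0 ?sg0 ?addr0 // => -[].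
Qed.

Lemma insl_cup g f h s :
  insl g (cup f h) s = cup (insl g f) h s + f [::] * insl g h s.
Proof.
rewrite /insl /cup /=.
transitivity (spl (fun y z => f [::] * h (g y :: z) +
   spl (fun u v => f (g y :: u) * h v) z) s); first exact: eq_spl.
rewrite splD addrC; congr (_ + _).
  rewrite -spl_assoc; apply: eq_spl => x y; symmetry.
  by apply: (spl_morph (h := fun a => a * h y)) => a b; exact: mulrDl.
by symmetry; apply: (spl_morph (h := fun a => f [::] * a)) => a b; exact: mulrDr.
Qed.

(** If [Lam] is a coderivation up to [X] at the first place of a word, then
    [sweep] is a coderivation up to the sweep of [X]. *)
Lemma sweep_cup b (Lam X : (seq A -> A) -> seq A -> A) f h s :
  (forall f g s, Lam (fun u => f u + g u) s = Lam f s + Lam g s) ->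
  (forall a g s, Lam (fun u => a * g u) s = a * Lam g s) ->
  (forall f s, Lam (cup f h) s = cup (Lam f) h s + f [::] * Lam h s + X f s) ->
  sweep b Lam (cup f h) s =
    cup (sweep b Lam f) h s + cup (gm b f) (sweep b Lam h) s + sweep b X f s.
Proof.
move=> LD LM LC.
have swD f' g' t : sweep b Lam (fun u => f' u + g' u) t =
    sweep b Lam f' t + sweep b Lam g' t.
  elim: t f' g' => [|a t IH] f' g' /=; first by rewrite LD !addr0.
  by rewrite LD (IH (fun u => f' (a :: u))) sgD; abel.
have swM c g' t : sweep b Lam (fun u => c * g' u) t = c * sweep b Lam g' t.
  elim: t g' => [|a t IH] g' /=; first by rewrite LM !addr0.
  by rewrite LM (IH (fun u => g' (a :: u))) mulrDr sgMr.
elim: s f => [|a s IH] f.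
  by rewrite /= LC /cup /gm /= andbF /sg !addr0.
have -> : sweep b Lam (cup f h) (a :: s) = Lam (cup f h) (a :: s) +
    sg b (sweep b Lam (fun u => f [::] * h (a :: u) +
                                cup (fun u => f (a :: u)) h u) s) by [].
rewrite LC swD (swM _ (fun u => h (a :: u))) IH.
have -> : cup (sweep b Lam f) h (a :: s) = cup (Lam f) h (a :: s) +
    sg b (cup (sweep b Lam (fun u => f (a :: u))) h s).
  rewrite /cup /= addr0 -addrA; congr (_ + _).
  rewrite -spl_sg -splD; apply: eq_spl => x y.
  by rewrite mulrDl sgMl.
have -> : cup (gm b f) (sweep b Lam h) (a :: s) =
    f [::] * Lam h (a :: s) + sg b (f [::] * sweep b Lam (fun u => h (a :: u)) s) +
    sg b (cup (gm b (fun u => f (a :: u))) (sweep b Lam h) s).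
  rewrite /cup /= -spl_sg; congr (_ + _).
    by rewrite /gm /= andbF /sg mulrDr sgMr.
  apply: eq_spl => x y; rewrite /gm sgMl /=.
  by case: b {LC IH swD swM} => //=; rewrite sg_negb sgMl.
rewrite [sweep b X f (a :: s)]/= !sgD; abel.
Qed.

Lemma ins_cup b g f h s :
  ins b g (cup f h) s = cup (ins b g f) h s + cup (gm b f) (ins b g h) s.
Proof.
rewrite /ins (sweep_cup b (X := fun _ _ => 0)).
- suff -> : sweep b (fun _ _ => 0) f s = 0 :> A by rewrite addr0.
  by elim: s f => [|a s IH] f /=; rewrite ?IH ?sg0 addr0.
- by move=> *; exact: splD.
- move=> a g' t; symmetry.
  by apply: (spl_morph (h := fun v => a * v)) => ? ?; exact: mulrDr.
- by move=> f' t; rewrite insl_cup addr0.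
Qed.

End Insertion.

(** * Homotopies for commutativity and for the Leibniz rule *)
Section Homotopies.
Variables (k : fieldType) (A : algType k).
Implicit Types (f g h : seq A -> A) (s t x y z : seq A) (b i j : bool).

Lemma par_cons i f a : par i f -> par (~~ i) (fun u => f (a :: u)).
Proof.
move=> pf s; rewrite sg_negb; apply: oppr_inj; rewrite opprK -sg_negb.
exact: (pf (a :: s)).
Qed.

Lemma par_insl i j g f : madd f -> par i f -> par j g -> par (i (+) ~~ j) (insl g f).
Proof.
move=> fD pf pg s; rewrite -!spl_sg; apply: eq_spl_in => y z <-.
rewrite size_cat oddD -sgsg (par_cons (g y) pf z) sgsg addbC -sgsg.
rewrite -(madd_sg [::]) // pg (madd_sg [::]) // sgsg.
by case: (i); case: (j).
Qed.

Lemma par_sweep i c b (Lam : (seq A -> A) -> seq A -> A) f :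
  (forall i f, madd f -> par i f -> par (i (+) c) (Lam f)) ->
  madd f -> par i f -> par (i (+) c) (sweep b Lam f).
Proof.
move=> hL fD pf s; elim: s i f fD pf => [|a s IH] i f fD pf.
  by rewrite [sweep _ _ _ _]/= addr0; exact: hL.
rewrite [sweep _ _ _ _]/= !sgD (hL _ _ fD pf); congr (_ + _).
rewrite sgsg addbC -sgsg /= sg_negb (IH (~~ i)); [|exact: madd_cons|exact: par_cons].
by rewrite -sg_negb !sgsg; case: (i); case: (b); case: (c).
Qed.

Lemma par_ins i j b g f : madd f -> par i f -> par j g -> par (i (+) ~~ j) (ins b g f).
Proof. by move=> fD pf pg; apply: par_sweep => // i' f' fD' pf'; exact: par_insl. Qed.

(** If [f] and [g] are cocycles, the insertion of [g] in [f] is a homotopy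
    between the two cup products of [f] and [g], up to sign. *)
Lemma hdiff_ins i j f g s : madd f -> par i f -> par j g ->
  hdiff (ins (~~ j) g f) s =
    sg (~~ j) (ins (~~ j) g (hdiff f) s) + ins j (hdiff g) f s
    - sg (~~ j) (cup g f s) + sg (~~ j || i) (cup f g s).
Proof.
move=> fD pf pg.
rewrite (hdiff_par _ (par_ins _ fD pf pg)) (mrg_ins s fD pg).
have -> : ins (~~ j) g (hdiff f) s =
    cup g f s + sg (~~ j) (cup (@iota1 k A) (ins (~~ j) g f) s)
    - ins (~~ j) g (mrg f) s
    - sg i (cup (ins (~~ j) g f) (@iota1 k A) s + sg (~~ j && i) (cup f g s)).
  rewrite (eq_ins _ (g' := g) (F' := fun u => cup (@iota1 k A) f u - mrg f u -
      sg i (cup f (@iota1 k A) u))) //; last by move=> u; exact: hdiff_par.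
  rewrite !insB ins_sg !ins_cup; congr (_ + _ - _ - sg _ (_ + _)).
  - by apply: eq_cup => // u; exact: ins_iota.
  - rewrite -cup_sgl; apply: eq_cup => // u.
    by rewrite (gm_par _ (@par_iota k A)) andbT.
  - rewrite -cup_sgl; apply: eq_cup => u; first by rewrite (gm_par _ pf).
    exact: ins_iota.
by case: (i); case: (j); rewrite /sg /=; abel.
Qed.

Section Brace.
Variables (j1 j2 : bool) (g1 g2 : seq A -> A).

(** The insertions of [g1] at the beginning of a word and of [g2] after it. *)
Definition insl2 (V : zmodType) (F : seq A -> V) s : V :=
  spl (fun y r => ins (~~ j2) g2 (fun u => F (g1 y :: u)) r) s.

(** [ins2 F] is the sum over the insertions of [g1] and of [g2], in this order,
    at disjoint places of a word, each with the sign of [ins]. *)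
Definition ins2 (V : zmodType) := sweep (j1 (+) j2) (@insl2 V).

Hypotheses (p1 : par j1 g1) (p2 : par j2 g2).
Hypotheses (d1 : hdiff g1 =1 fun=> 0) (d2 : hdiff g2 =1 fun=> 0).

Lemma mrg_insl2 (V : zmodType) (F : seq A -> V) s : madd F ->
  mrg (insl2 F) s = sg (j1 (+) j2) (insl2 (mrg F) s)
    - sg (j1 (+) j2) (insl (cup g1 g2) F s)
    + (if s is a :: t then insl2 (mrg1 a F) t else 0).
Proof.
move=> hF.
have hM (a : A) : madd (fun u => F (a :: u)) by exact: madd_cons.
have hFB u v z : F ((u - v) :: z) = F (u :: z) - F (v :: z) := maddB [::] z u v hF.
have hi r : {morph (fun v => ins (~~ j2) g2 (fun u => F (v :: u)) r) : a b / a - b}.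
  by move=> a b /=; rewrite -insB; apply: eq_ins.
have hD r : {morph (fun v => ins (~~ j2) g2 (fun u => F (v :: u)) r) : a b / a + b}.
  by move=> a b /=; rewrite -insD; apply: eq_ins => // u; exact: (hF [::]).
pose S := spl (fun y r => ins (~~ j2) g2 (mrg (fun u => F (g1 y :: u))) r) s.
pose R := spl (fun y r => ins (~~ j2) g2 (mrg1 (g1 y) F) r) s.
pose W := spl (fun y r => ins (~~ j2) g2 (fun u => F (cup g1 (@iota1 k A) y :: u)) r) s.
have -> : mrg (insl2 F) s = (if s is a :: t then insl2 (mrg1 a F) t else 0)
    - sg j1 W + sg j1 (sg (~~ j2) S).
  rewrite /insl2 mrg_spl splD; congr (_ + _); last first.
    rewrite -!spl_sg; apply: eq_spl => y r.
    rewrite (mrg_ins r (hM _) p2) (eq_ins _ _ d2 (fun=> erefl)) ins0l // subr0.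
    rewrite sgsg addbC -sgsg [RHS]sgsg addbC -sgsg; congr sg.
    rewrite -!ins_sg; apply: eq_ins => // u.
    by rewrite -!mrg_sg; apply: eq_mrg => v; rewrite -!(madd_sg [::]) // p1.
  transitivity (spl (fun y r => ins (~~ j2) g2 (fun u => F (cup (@iota1 k A) g1 y :: u)) r) s
      - sg j1 W).
    rewrite -spl_sg -splB; apply: eq_spl => y r.
    rewrite -(mrg_morph (h := fun v => ins (~~ j2) g2 (fun u => F (v :: u)) r)) //.
    rewrite -ins_sg -insB; apply: eq_ins => // u.
    rewrite -(madd_sg [::]) // -hFB; congr (F (_ :: _)).
    by have := d1 y; rewrite (hdiff_par _ p1) => /eqP; rewrite subr_eq0 => /eqP <-; abel.
  congr (_ - _); case: s {S R W} => [|a s] /=.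
    by rewrite ins0 // => u _; rewrite cup_iotal (madd0 [::]).
  rewrite ins0; last by move=> u _; rewrite cup_iotal (madd0 [::]).
  rewrite add0r; by apply: eq_spl => y r; apply: eq_ins => // u; rewrite cup_iotal.
have -> : insl2 (mrg F) s = R - S.
  by rewrite -splB; apply: eq_spl => y r; rewrite -insB.
have -> : R = insl (cup g1 g2) F s + sg (~~ j2) W.
  have -> : insl (cup g1 g2) F s =
      spl (fun u w => spl (fun v z => F (g1 u * g2 v :: z)) w) s.
    by rewrite -spl_assoc; apply: eq_spl => x z; rewrite (madd_spl [::]).
  have -> : W = spl (fun u w =>
      if w is a :: t then ins (~~ j2) g2 (fun r => F (g1 u * a :: r)) t else 0) s.
    rewrite /W.
    transitivity (spl (fun x z => spl (fun u v =>
        ins (~~ j2) g2 (fun r => F (g1 u * iota1 v :: r)) z) x) s).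
      by apply: eq_spl => x z; rewrite (spl_morph (hD z)).
    have I0 u v z : iota1 v = 0 :> A ->
        ins (~~ j2) g2 (fun r => F (g1 u * iota1 v :: r)) z = 0.
      by move=> ->; apply: ins0 => r _; rewrite mulr0 (madd0 [::]).
    rewrite spl_assoc; apply: eq_spl => u [|a w] /=.
      by apply: (I0 u [::]).
    rewrite (I0 u [::]) // add0r (@spl_first _ _ (fun v z =>
      ins (~~ j2) g2 (fun r => F (g1 u * iota1 (a :: v) :: r)) z)) //.
    by move=> c x y; apply: I0.
  rewrite -spl_sg -splD; apply: eq_spl => u [|a w].
    by rewrite sg0.
  by [].
by case: (j1); case: (j2); rewrite /sg /=; abel.
Qed.

Lemma insl2B (V : zmodType) (F G : seq A -> V) s :
  insl2 (fun u => F u - G u) s = insl2 F s - insl2 G s.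
Proof. by rewrite /insl2 -splB; apply: eq_spl => y r; rewrite insB. Qed.

Lemma eq_insl2 (V : zmodType) (F G : seq A -> V) : F =1 G -> insl2 F =1 insl2 G.
Proof. by move=> h s; apply: eq_spl => y r; apply: eq_ins. Qed.

Lemma mrg_ins2 (V : zmodType) (F : seq A -> V) s : madd F ->
  mrg (ins2 F) s = sg (j1 (+) j2) (ins2 (mrg F) s)
    - sg (j1 (+) j2) (ins (~~ (j1 (+) j2)) (cup g1 g2) F s).
Proof.
move=> hF; rewrite /ins2 (@mrg_sweep _ _ _ _ _
  (fun F s => - sg (j1 (+) j2) (insl (cup g1 g2) F s)) _ _ (@madd A V)) //.
- congr (_ + _); rewrite /ins.
  elim: s F hF => [|a s IH] F hF; rewrite [LHS]/= [in RHS]/= ?addr0 //.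
  rewrite (IH (fun u => F (a :: u))); last exact: madd_cons.
  by case: (j1 (+) j2); rewrite /sg /=; abel.
- by move=> G a; exact: madd_cons.
- by move=> G H t; exact: insl2B.
- by move=> G H; exact: eq_insl2.
- by move=> G t hG; exact: mrg_insl2.
Qed.

Lemma ins2_small f s : (forall u, (1 < size u)%N -> f u = 0) -> ins2 f s = 0 :> A.
Proof.
have L0 f' t : (forall u, (1 < size u)%N -> f' u = 0) -> insl2 f' t = 0 :> A.
  move=> hf; apply: spl_eq0 => y r _; apply: ins0 => -[|a u] // _; exact: hf.
rewrite /ins2; elim: s f => [|a s IH] f hf; rewrite [LHS]/= L0 // ?addr0 //.
rewrite IH ?sg0 ?addr0 // => u hu; apply: hf; exact: ltnW.
Qed.

Lemma insl2D f f' s :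
  insl2 (fun u => f u + f' u) s = insl2 f s + insl2 f' s :> A.
Proof. by rewrite /insl2 -splD; apply: eq_spl => y r; rewrite insD. Qed.

Lemma insMl b g (a : A) f s : ins b g (fun u => a * f u) s = a * ins b g f s.
Proof.
have M f' t : insl g (fun u => a * f' u) t = a * insl g f' t.
  symmetry; apply: (spl_morph (h := fun v => a * v)) => ? ?; exact: mulrDr.
rewrite /ins; elim: s f => [|c s IH] f; rewrite [LHS]/= [in RHS]/= M ?addr0 //.
by rewrite (IH (fun u => f (c :: u))) [RHS]mulrDr sgMr.
Qed.

Lemma insl2M (a : A) f s : insl2 (fun u => a * f u) s = a * insl2 f s.
Proof.
rewrite /insl2 (spl_morph (h := fun v => a * v)); last by move=> ? ?; exact: mulrDr.
by apply: eq_spl => y r; rewrite insMl.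
Qed.

Lemma sweep_cupl b (Lam : (seq A -> A) -> seq A -> A) f h s :
  cup (sweep b Lam f) h s = sweep b (fun f s => cup (Lam f) h s) f s.
Proof.
elim: s f => [|a s IH] f; first by rewrite /cup /= !addr0.
rewrite [RHS]/= -IH /cup /= addr0 -addrA; congr (_ + _).
by rewrite -spl_sg -splD; apply: eq_spl => x y; rewrite mulrDl sgMl.
Qed.

Lemma ins2_cup f h s : ins2 (cup f h) s = cup (ins2 f) h s +
  cup (gm (j1 (+) j2) f) (ins2 h) s +
  sg (~~ j2) (cup (ins (~~ j1) g1 (gm (~~ j2) f)) (ins (~~ j2) g2 h) s).
Proof.
pose X f s := spl (fun y r => cup (gm (~~ j2) (fun u => f (g1 y :: u)))
                                  (ins (~~ j2) g2 h) r) s.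
have LC f' t : insl2 (cup f' h) t = cup (insl2 f') h t + f' [::] * insl2 h t + X f' t.
  have -> : cup (insl2 f') h t =
      spl (fun y r => cup (ins (~~ j2) g2 (fun u => f' (g1 y :: u))) h r) t.
    rewrite -spl_assoc; apply: eq_spl => x z.
    by apply: (spl_morph (h := fun v => v * h z)) => ? ?; exact: mulrDl.
  have -> : f' [::] * insl2 h t =
      spl (fun y r => f' [::] * ins (~~ j2) g2 (fun u => h (g1 y :: u)) r) t.
    by apply: (spl_morph (h := fun v => f' [::] * v)) => ? ?; exact: mulrDr.
  rewrite /X -!splD; apply: eq_spl => y r.
  by rewrite [cup _ h r + _]addrC -addrA -ins_cup -insMl -insD; apply: eq_ins.
rewrite /ins2 (sweep_cup _ _ _ insl2D insl2M LC).
congr (_ + _); rewrite /ins -/(ins (~~ j2) g2) sweep_cupl.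
have XE f' t : X f' t =
    sg (~~ j2) (cup (insl g1 (gm (~~ j2) f')) (ins (~~ j2) g2 h) t).
  rewrite -cup_sgl.
  transitivity (spl (fun y r => spl (fun u v =>
    gm (~~ j2) (fun u => f' (g1 y :: u)) u * ins (~~ j2) g2 h v) r) t) => //.
  rewrite -spl_assoc; apply: eq_spl => x z; rewrite -spl_sg.
  rewrite (spl_morph (h := fun v => v * ins (~~ j2) g2 h z)); last first.
    by move=> ? ?; exact: mulrDl.
  apply: eq_spl => y u; rewrite /gm /=.
  by case: (j2) => //=; rewrite sg_negb /sg opprK.
elim: s f => [|a s IH] f; first by rewrite [LHS]/= [in RHS]/= !addr0 XE.
rewrite [LHS]/= [in RHS]/= XE IH sgD; congr (_ + _).
rewrite !sgsg.
have -> : (fun u => gm (~~ j2) f (a :: u)) =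
    (fun u => sg (~~ j2) (gm (~~ j2) (fun u => f (a :: u)) u)).
  apply: funext => u; rewrite /gm /=.
  by case: (j2) => //=; rewrite sg_negb.
have sgS f' t : sweep (~~ j1) (fun f s => cup (insl g1 f) (ins (~~ j2) g2 h) s)
     (fun u => sg (~~ j2) (f' u)) t = sg (~~ j2)
   (sweep (~~ j1) (fun f s => cup (insl g1 f) (ins (~~ j2) g2 h) s) f' t).
  by rewrite -!sweep_cupl -/(ins _ _) -cup_sgl; apply: eq_cup => // u; rewrite -ins_sg.
by rewrite sgS !sgsg; case: (j1); case: (j2).
Qed.

Lemma par_insl2 i f : madd f -> par i f -> par (i (+) (j1 (+) j2)) (insl2 f : seq A -> A).
Proof.
move=> fD pf s; rewrite -!spl_sg; apply: eq_spl_in => y r <-.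
have fDc a : madd (fun u => f (a :: u)) by exact: madd_cons.
rewrite size_cat oddD -sgsg (par_ins _ (fDc _) (par_cons (g1 y) pf) p2 r).
rewrite sgsg addbC -sgsg.
have -> : sg (odd (size y)) (ins (~~ j2) g2 (fun u => f (g1 y :: u)) r) =
    sg j1 (ins (~~ j2) g2 (fun u => f (g1 y :: u)) r).
  rewrite -!ins_sg; apply: eq_ins => // u.
  by rewrite -!(madd_sg [::]) // p1.
by rewrite sgsg; case: (i); case: (j1); case: (j2).
Qed.

(** Insertion in the cocycle [f] is a derivation of the cup product of cocycles,
    up to sign and up to the coboundary of the two-fold insertion. *)
Lemma hdiff_ins2 i f s : madd f -> par i f -> hdiff f =1 (fun=> 0) ->
  hdiff (ins2 f) s = sg (j1 (+) j2)
    (ins (~~ (j1 (+) j2)) (cup g1 g2) f s - cup g1 (ins (~~ j2) g2 f) s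
     + sg (~~ j2 || i) (cup (ins (~~ j1) g1 f) g2 s)).
Proof.
move=> fD pf df.
have pF : par (i (+) (j1 (+) j2)) (ins2 f : seq A -> A).
  by apply: par_sweep => // i' f' fD' pf'; exact: par_insl2.
rewrite (hdiff_par _ pF) mrg_ins2 //.
have I0 u : ins2 (@iota1 k A) u = 0.
  by apply: ins2_small => -[|a [|c v]].
have I1 u : gm (~~ j2) (@iota1 k A) u = sg (~~ j2) (iota1 u).
  by rewrite (gm_par _ (@par_iota k A)) andbT.
have -> : ins2 (mrg f) s = ins2 (cup (@iota1 k A) f) s - sg i (ins2 (cup f (@iota1 k A)) s).
  have hB (F G : seq A -> A) t : ins2 (fun u => F u - G u) t = ins2 F t - ins2 G t.
    by apply: sweepB => *; exact: insl2B.
  have hN (F : seq A -> A) t : ins2 (fun u => - F u) t = - ins2 F t.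
    have := hB (fun=> 0) F t; rewrite (@ins2_small (fun=> 0)) // sub0r => <-.
    by apply: eq_sweep => // [G H GH|u]; [exact: eq_insl2 | rewrite sub0r].
  have hS (F : seq A -> A) t : ins2 (fun u => sg i (F u)) t = sg i (ins2 F t).
    by case: (i) => //; exact: hN.
  rewrite -hS -hB; apply: eq_sweep => [G H|u]; first exact: eq_insl2.
  by have := df u; rewrite (hdiff_par _ pf) => /eqP; rewrite addrAC subr_eq0 => /eqP <-.
rewrite !ins2_cup.
rewrite (eq_cup _ I0 (fun=> erefl)) cup0l.
rewrite [cup (gm (j1 (+) j2) f) _ s](eq_cup _ (fun=> erefl) I0) cup0r.
rewrite [cup (gm (j1 (+) j2) (@iota1 k A)) _ s](eq_cup (f' := fun u => sg (j1 (+) j2) (iota1 u)) _ _ (fun=> erefl)); last first.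
  by move=> u; rewrite (gm_par _ (@par_iota k A)) andbT.
rewrite [cup (ins _ _ (gm _ (@iota1 k A))) _ _](eq_cup (f' := fun u => sg (~~ j2) (g1 u)) _ _ (fun=> erefl)); last first.
  move=> u; rewrite (eq_ins _ _ (fun=> erefl) I1) ins_sg.
  by rewrite ins_iota.
rewrite [cup (ins _ _ (gm _ f)) _ _](eq_cup (f' := fun u => sg (~~ j2 && i) (ins (~~ j1) g1 f u)) (g' := g2)); last first.
- by move=> u; exact: ins_iota.
- by move=> u; rewrite (eq_ins _ _ (fun=> erefl) (gm_par (~~ j2) pf)) ins_sg.
rewrite !cup_sgl.
by case: (i); case: (j1); case: (j2); rewrite /sg /=; abel.
Qed.

End Brace.
End Homotopies.

(** * Twisted cyclic words *)

Lemma mrg_size_sg (A : pzRingType) (V : zmodType) (chi : bool -> bool)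
    (F : seq A -> V) s :
  mrg (fun u => sg (chi (odd (size u))) (F u)) s = sg (chi (~~ odd (size s))) (mrg F s).
Proof.
case: s => [|a s]; first by rewrite sg0.
by rewrite -mrg_sg; apply: eq_mrg_size => u ->; rewrite /= negbK.
Qed.

Section Cyclic.
Variables (k : fieldType) (A : algType k).
Variables (eps : {scalar A}) (sigma : {lrmorphism A -> A}).
Hypothesis epsE : forall a b : A, eps (a * b) = eps (sigma b * a).
Implicit Types (f g h : seq A -> A) (s t x y z u w r : seq A) (i j : bool).
Implicit Types (F psi : seq A -> k) (K : seq A -> seq A -> k).

(** The functional of [n + 1] variables that corresponds to an [n]-cochain. *)
Definition ph f s : k := if s is a :: t then eps (a * f t) else 0.

(** The twisted cyclic rotation, with the sign of a cyclic permutation. *)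
Definition tw psi s : k :=
  rc (fun x c => sg (odd (size x)) (psi (sigma c :: x))) s.

(** The twisted cyclic differential: all the merges of cyclically adjacent letters. *)
Definition cyd psi s : k :=
  if s is a :: t then
    mrg psi s - rc (fun x c => sg (odd (size x)) (psi (sigma c * a :: x))) t
  else 0.

(** The sum over all the rotations of a word [a :: t]: the part [z] of
    [t = r ++ z] is moved, twisted, to the front, and [K] takes the word cut
    after the letter [a]. *)
Definition cyc K s : k :=
  if s is a :: t then
    spl (fun r z => sg (~~ odd (size r) && odd (size z))
                       (K (rcons (map sigma z) a) r)) t
  else 0.

(** The merges of adjacent letters in a word cut in two parts [w] and [r], [w]
    being nonempty. *)
Definition cyc_merge K w r : k :=
  mrg (fun w => K w r) w -
  sg (odd (size w))
    ((if r is b :: r' then rc (fun u a => K (rcons u (a * b)) r') w else 0) -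
     mrg (K w) r).

(** The norm: the signed sum over all the rotations of a word. *)
Definition nrm F := cyc (fun w r => F (w ++ r)).

Lemma eq_cyc K K' s : (forall u a r, K (rcons u a) r = K' (rcons u a) r) ->
  cyc K s = cyc K' s.
Proof. by move=> h; case: s => //= a t; apply: eq_spl => r z; rewrite h. Qed.

Lemma eq_cyc_in K K' s :
  (forall z a r, (size z + size r).+1 = size s ->
     K (rcons (map sigma z) a) r = K' (rcons (map sigma z) a) r) ->
  cyc K s = cyc K' s.
Proof.
case: s => //= a t h; apply: eq_spl_in => r z E; rewrite h // -E size_cat.
by rewrite addnC.
Qed.

Lemma cycD K K' s : cyc (fun w r => K w r + K' w r) s = cyc K s + cyc K' s.
Proof.
case: s => [|a t]; first by rewrite addr0.
by rewrite /= -splD; apply: eq_spl => r z; rewrite sgD.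
Qed.

Lemma cycN K s : cyc (fun w r => - K w r) s = - cyc K s.
Proof.
case: s => [|a t]; first by rewrite oppr0.
by rewrite /= -splN; apply: eq_spl => r z; rewrite sgN.
Qed.

Lemma cyc_sg b K s : cyc (fun w r => sg b (K w r)) s = sg b (cyc K s).
Proof. by case: b => //; exact: cycN. Qed.

Lemma eq_nrm F F' s : F =1 F' -> nrm F s = nrm F' s.
Proof. by move=> h; apply: eq_cyc => u a r; rewrite h. Qed.

Lemma nrmD F F' s : nrm (fun u => F u + F' u) s = nrm F s + nrm F' s.
Proof. exact: cycD. Qed.

Lemma nrmN F s : nrm (fun u => - F u) s = - nrm F s.
Proof. exact: cycN. Qed.

Lemma nrmB F F' s : nrm (fun u => F u - F' u) s = nrm F s - nrm F' s.
Proof. by rewrite (nrmD F (fun u => - F' u)) nrmN. Qed.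

(** The cyclic merge across the two ends of a word becomes, after rotation, an
    ordinary merge inside the part to the left of the cut. *)
Lemma cyd_cyc K s : cyd (cyc K) s = cyc (cyc_merge K) s.
Proof.
case: s => [|a t] //.
pose A1 := spl (fun r z => sg (~~ odd (size r) && odd (size z))
  (mrg (fun w => K (rcons (map sigma w) a) r) z)) t.
pose A2 := spl (fun r z => sg (~~ odd (size r) && odd (size z))
  (rc (fun w c => sg (odd (size w)) (K (rcons w (c * a)) r)) (map sigma z))) t.
pose A3 := spl (fun r z => sg (odd (size r) && odd (size z))
  (if r is b :: r' then K (rcons (map sigma z) (a * b)) r' else 0)) t.
pose A4 := spl (fun r z => sg (odd (size r) && odd (size z))
  (mrg (K (rcons (map sigma z) a)) r)) t.
have -> : cyc (cyc_merge K) (a :: t) = A1 + A2 + A3 - A4.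
  rewrite -!splD -splN -splD; apply: eq_spl => r z.
  rewrite /cyc_merge mrg_rcons size_rcons size_map (mrg_map (rmorphM sigma)).
  have -> : (if r is b :: r' then rc (fun u a0 => K (rcons u (a0 * b)) r')
      (rcons (map sigma z) a) else 0) =
      (if r is b :: r' then K (rcons (map sigma z) (a * b)) r' else 0).
    by case: r => // b r; rewrite rc_rcons.
  rewrite /= sg_negb.
  by case: (odd (size r)); case: (odd (size z)); rewrite /sg /=; abel.
have -> : cyd (cyc K) (a :: t) = mrg1 a (cyc K) t - mrg (fun u => cyc K (a :: u)) t -
   rc (fun x c => sg (odd (size x)) (cyc K (sigma c * a :: x))) t by [].
have -> : mrg1 a (cyc K) t = A3.
  rewrite /A3; case: t {A1 A2 A3 A4} => [|b t] //=.
  rewrite {2}/sg add0r; apply: eq_spl => r z.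
  by rewrite /=; case: (odd (size r)); case: (odd (size z)).
have -> : rc (fun x c => sg (odd (size x)) (cyc K (sigma c * a :: x))) t = - A2.
  rewrite /A2; case/lastP: t {A1 A2 A3 A4} => [|t c]; first by rewrite /= oppr0.
  rewrite rc_rcons spl_rcons /= andbF addr0 -spl_sg -splN; apply: eq_spl_in => r z <-.
  rewrite map_rcons rc_rcons !size_rcons size_map size_cat oddD.
  by rewrite /=; case: (odd (size r)); case: (odd (size z)); rewrite /sg /= ?opprK.
have -> : mrg (fun u => cyc K (a :: u)) t = A4 - A1.
  rewrite /cyc mrg_spl splD; congr (_ + _).
    apply: eq_spl => r z.
    rewrite (mrg_size_sg (fun b => ~~ b && odd (size z))
      (fun x => K (rcons (map sigma z) a) x)) negbK.
    by congr sg; apply: eq_mrg.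
  rewrite -splN; apply: eq_spl => r z.
  rewrite (mrg_size_sg (fun b => ~~ odd (size r) && b)
      (fun x => K (rcons (map sigma x) a) r)).
  by case: (odd (size r)); case: (odd (size z)); rewrite /sg /= ?opprK.
abel.
Qed.

(** The norm is a cochain map, from merging to the twisted cyclic differential. *)
Lemma cyd_nrm F s : cyd (nrm F) s = nrm (mrg F) s.
Proof.
rewrite /nrm cyd_cyc; apply: eq_cyc => u a r.
rewrite /cyc_merge cat_rcons mrg_cat size_rcons /= sg_negb.
have -> : (if r is b :: r' then rc (fun u a0 => F (rcons u (a0 * b) ++ r')) (rcons u a)
    else 0) = mrg1 a (fun x => F (u ++ x)) r.
  by case: r => //= b r; rewrite rc_rcons cat_rcons.
abel.
Qed.

(* The rotations of [tw psi] are those of [psi] shifted by one step, so the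
   difference of the two norms telescopes. *)
Lemma nrm_tw psi s :
  nrm psi s - nrm (tw psi) s = psi s - psi (map sigma s).
Proof.
case: s => [|a s]; first by rewrite !subrr.
pose X r z := sg (~~ odd (size r) && odd (size z)) (psi (rcons (map sigma z) a ++ r)).
have -> : nrm psi (a :: s) = psi (a :: s) + spl (fun r z => rc (fun x c => X x (c :: z)) r) s.
  by rewrite /nrm /= (spl_telescope X) {1}/X andbF.
have -> : nrm (tw psi) (a :: s) = psi (map sigma (a :: s)) +
    spl (fun r z => rc (fun x c => X x (c :: z)) r) s; last by abel.
rewrite /nrm /=.
transitivity (spl (fun r z => (if r is [::] then psi (map sigma (a :: z)) else 0) +
     rc (fun x c => X x (c :: z)) r) s); last first.
  by rewrite splD (@spl_first _ _ (fun r z => if r is [::] then _ else 0)).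
apply: eq_spl => r z; case/lastP: r => [|r c].
  by rewrite cats0 /tw rc_rcons size_map /= addr0 sgK.
have -> : (if rcons r c is [::] then psi (map sigma (a :: z)) else 0) = 0.
  by case: r.
rewrite add0r rc_rcons -rcons_cat /tw rc_rcons /X /= size_cat !size_rcons size_map.
rewrite sgsg; congr sg.
by rewrite oddD /=; case: (odd (size r)); case: (odd (size z)).
Qed.

(** A functional that is invariant under the automorphism [sigma]. *)
Definition invk psi : Prop := forall s, psi (map sigma s) = psi s.

Lemma nrm_tw_inv psi s : invk psi -> nrm (tw psi) s = nrm psi s.
Proof. by move=> h; apply/esym/eqP; rewrite -subr_eq0 nrm_tw h subrr. Qed.

(** The norm of an invariant functional is invariant under rotation. *)
Lemma tw_nrm F s : invk F -> tw (nrm F) s = nrm F s.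
Proof.
move=> hF; case/lastP: s => // s c; rewrite /tw rc_rcons.
case: s => [|a s]; first by rewrite /nrm /= /sg /= -(hF [:: c]).
have -> : nrm F (rcons (a :: s) c) = F (rcons (a :: s) c) +
    spl (fun r z => sg (~~ odd (size r) && ~~ odd (size z))
      (F (rcons (map sigma (rcons z c)) a ++ r))) s.
  rewrite /nrm /= spl_rcons andbF addrC; congr (_ + _).
  by apply: eq_spl => r z; rewrite size_rcons.
have -> : nrm F (sigma c :: a :: s) = sg (~~ odd (size s)) (F (rcons (a :: s) c)) +
    spl (fun r z => sg (odd (size r) && odd (size z))
      (F (rcons (map sigma (rcons z c)) a ++ r))) s.
  rewrite -[F (rcons _ _)]hF map_rcons /nrm /= cats0; congr (_ + _).
  apply: eq_spl => r z.
  by rewrite map_rcons !cat_rcons negbK.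
rewrite sgD sgK; congr (_ + _); rewrite -spl_sg; apply: eq_spl_in => r z <-.
rewrite sgsg /= size_cat oddD.
by case: (odd (size r)); case: (odd (size z)).
Qed.

Lemma nrm_inv F s : invk F -> nrm F (map sigma s) = nrm F s.
Proof.
move=> hF; case: s => // a s; rewrite /nrm /= spl_map; apply: eq_spl => r z.
by rewrite !size_map -map_rcons -map_cat hF.
Qed.

Lemma epsN (a : A) : eps (- a) = - eps a. Proof. exact: raddfN. Qed.

Lemma eps_sg b (a : A) : eps (sg b a) = sg b (eps a).
Proof. by apply: sg_additive; exact: epsN. Qed.

(** Through [ph] the Hochschild differential is the twisted cyclic one. *)
Lemma ph_hdiff f s : ph (hdiff f) s = cyd (ph f) s.
Proof.
case: s => [|a s] //; rewrite /ph /cyd hdiffE cup_iotal cup_iotar.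
rewrite mulrDr mulrBr raddfD raddfB; congr (_ - _ + _).
- by case: s => [|b s] /=; rewrite ?mulr0 ?raddf0 ?mulrA.
- by apply: (@mrg_morph A A k (fun v => eps (a * v))) => u v; rewrite mulrBr raddfB.
- case/lastP: s => [|s c] /=; first by rewrite mulr0 raddf0 oppr0.
  by rewrite !rc_rcons sgMr eps_sg size_rcons /= sg_negb mulrA [in LHS]epsE !mulrA.
Qed.

(** The restriction of the previous formula to words with first letter 1. *)
Lemma eps_hdiff f s :
  eps (hdiff f s) = ph f s - mrg (fun u => eps (f u)) s - tw (ph f) s.
Proof.
rewrite hdiffE cup_iotal cup_iotar raddfD raddfB; congr (_ - _ + _).
- by case: s => [|a s] /=; rewrite ?raddf0.
- by apply: (@mrg_morph A A k eps) => u v; rewrite raddfB.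
- rewrite /tw; case/lastP: s => [|s c] /=; first by rewrite raddf0 oppr0.
  by rewrite !rc_rcons eps_sg size_rcons /= sg_negb [in LHS]epsE.
Qed.

End Cyclic.

(** * Multilinear functions of words *)

Section Multilinear.
Variables (k : fieldType) (A : algType k) (V : lmodType k).
Implicit Types (F : seq A -> V) (f g : seq A -> A) (s t x y z : seq A).

(** Multilinear functions of words, with values in any vector space. *)
Definition mlin F : Prop := forall x z (c : k) (a b : A),
  F (x ++ (c *: a + b) :: z) = c *: F (x ++ a :: z) + F (x ++ b :: z).

Lemma mlin_madd F : mlin F -> madd F.
Proof. by move=> h x z a b; rewrite -[a]scale1r h !scale1r. Qed.

Lemma mlin_cons F a : mlin F -> mlin (fun u => F (a :: u)).
Proof. by move=> h x; exact: (h (a :: x)). Qed.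

Lemma mlin_cat F w : mlin F -> mlin (fun u => F (w ++ u)).
Proof. by move=> h x z c a b; rewrite !catA h. Qed.

Lemma mlin_catr F w : mlin F -> mlin (fun u => F (u ++ w)).
Proof. by move=> h x z c a b; rewrite -!catA h. Qed.

Lemma mlin_rcons F a : mlin F -> mlin (fun u => F (rcons u a)).
Proof. by move=> h x z c b d; rewrite !rcons_cat !rcons_cons h. Qed.

Lemma mlin_map F (h : {linear A -> A}) : mlin F -> mlin (fun u => F (map h u)).
Proof. by move=> hF x z c a b; rewrite !map_cat /= linearP hF. Qed.

Lemma eq_mlin F F' : F =1 F' -> mlin F -> mlin F'.
Proof. by move=> E h x z c a b; rewrite -!E h. Qed.

Lemma mlin0 : mlin (fun=> 0).
Proof. by move=> *; rewrite scaler0 addr0. Qed.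

Lemma mlinD F F' : mlin F -> mlin F' -> mlin (fun s => F s + F' s).
Proof. by move=> h h' x z c a b; rewrite h h' scalerDr addrACA. Qed.

Lemma mlinZ F d : mlin F -> mlin (fun s => d *: F s).
Proof. by move=> h x z c a b; rewrite h scalerDr !scalerA mulrC. Qed.

Lemma mlinN F : mlin F -> mlin (fun s => - F s).
Proof. by move=> h x z c a b; rewrite h opprD scalerN. Qed.

Lemma mlinB F F' : mlin F -> mlin F' -> mlin (fun s => F s - F' s).
Proof. by move=> h h'; apply: mlinD => //; exact: mlinN. Qed.

Lemma mlin_sg b F : mlin F -> mlin (fun s => sg b (F s)).
Proof. by case: b => //; exact: mlinN. Qed.

Lemma mlin_size_sg (chi : nat -> bool) F :
  mlin F -> mlin (fun s => sg (chi (size s)) (F s)).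
Proof. by move=> h x z c a b; rewrite h sgD sgZ !size_cat. Qed.

Lemma mlin_spl (G : seq A -> seq A -> V) :
  (forall y, mlin (fun x => G x y)) -> (forall x, mlin (G x)) -> mlin (spl G).
Proof.
move=> h1 h2 x z c a b; rewrite !spl_cat_cons scalerDr addrACA.
by congr (_ + _); rewrite (spl_morph (h := fun v => c *: v)) -?splD;
  try (by move=> *; exact: scalerDr); apply: eq_spl => u v; rewrite ?h1 ?h2.
Qed.

Lemma mlin_spl_param (T : Type) (G : seq T -> seq T -> seq A -> V) r :
  (forall u v, mlin (G u v)) -> mlin (fun s => spl (fun u v => G u v s) r).
Proof.
move=> h x z c a b; rewrite (spl_morph (h := fun v => c *: v)) -?splD.
  by apply: eq_spl => u v; rewrite h.
by move=> *; exact: scalerDr.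
Qed.

Lemma mlin_slot F f w z : mlin F -> multilinear f -> mlin (fun u => F (w ++ f u :: z)).
Proof. by move=> hF hf x y c a b; rewrite hf hF. Qed.

(** [sweep] as a sum over splittings. *)
Lemma sweepE b (Lam : (seq A -> V) -> seq A -> V) F s : sweep b Lam F s =
  spl (fun x t => sg (b && odd (size x)) (Lam (fun u => F (x ++ u)) t)) s.
Proof.
elim: s F => [|a s IH] F; first by rewrite /= andbF addr0.
rewrite [LHS]/= IH [RHS]/= andbF -spl_sg; congr (_ + _).
apply: eq_spl => x t; rewrite sgsg.
by case: b {IH}; case: (odd (size x)).
Qed.

Lemma mlin_insl g F : multilinear g -> mlin F -> mlin (insl g F).
Proof.
move=> hg hF; apply: mlin_spl => [z|y]; last exact: mlin_cons.
exact: (@mlin_slot F g [::] z).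
Qed.

Lemma mlin_sweep b (Lam : (seq A -> V) -> seq A -> V) F :
  (forall F, mlin F -> mlin (Lam F)) ->
  (forall c F F' s, Lam (fun u => c *: F u + F' u) s = c *: Lam F s + Lam F' s) ->
  (forall F F', F =1 F' -> Lam F =1 Lam F') ->
  mlin F -> mlin (sweep b Lam F).
Proof.
move=> h1 h2 h3 hF; apply: (eq_mlin (fun s => esym (sweepE b Lam F s))).
apply: mlin_spl => [t|x]; last by apply: mlin_sg; apply: h1; exact: mlin_cat.
apply: (mlin_size_sg (fun n => b && odd n)) => x z c a d.
by rewrite -h2; apply: h3 => u; rewrite -!catA hF.
Qed.

Lemma insl_lin g c F F' s :
  insl g (fun u => c *: F u + F' u) s = c *: insl g F s + insl g F' s.
Proof.
rewrite /insl splD (spl_morph (h := fun v => c *: v)) //.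
by move=> *; exact: scalerDr.
Qed.

Lemma mlin_ins b g F : multilinear g -> mlin F -> mlin (ins b g F).
Proof.
move=> hg; apply: mlin_sweep => [G hG|c G G' s|G G' h].
- exact: mlin_insl.
- exact: insl_lin.
- by move=> s; exact: eq_insl.
Qed.

Lemma ins_lin b g c F F' s :
  ins b g (fun u => c *: F u + F' u) s = c *: ins b g F s + ins b g F' s.
Proof.
rewrite /ins !sweepE (spl_morph (h := fun v => c *: v)); last first.
  by move=> *; exact: scalerDr.
by rewrite -splD; apply: eq_spl => x t; rewrite insl_lin sgD sgZ.
Qed.

End Multilinear.

Section MultilinearOps.
Variables (k : fieldType) (A : algType k).
Implicit Types (f g : seq A -> A) (s : seq A).

Lemma mlin_cup f g : multilinear f -> multilinear g -> multilinear (cup f g).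
Proof.
move=> hf hg; apply: (@mlin_spl _ _ A) => [y|x] u v c a b.
  by rewrite hf mulrDl scalerAl.
by rewrite hg mulrDr scalerAr.
Qed.

Lemma mlin_ins2 j1 j2 g1 g2 f : multilinear g1 -> multilinear g2 -> multilinear f ->
  multilinear (ins2 j1 j2 g1 g2 f).
Proof.
move=> h1 h2; apply: (@mlin_sweep _ _ A) => [F hF|c F F' s|F F' h].
- apply: (@mlin_spl _ _ A) => [r|y]; last by apply: mlin_ins => //; exact: mlin_cons.
  move=> x z c a b; rewrite h1 -ins_lin; apply: eq_ins => // u.
  exact: (hF [::]).
- rewrite /insl2 (spl_morph (h := fun v => c *: v)); last by move=> *; exact: scalerDr.
  by rewrite -splD; apply: eq_spl => y r; rewrite ins_lin.
- exact: eq_insl2.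
Qed.

Lemma mlin_hdiff0 f : (forall s, hdiff f s = 0) -> multilinear (hdiff f).
Proof. by move=> h x z c a b; rewrite !h scaler0 addr0. Qed.

End MultilinearOps.

(** * The Connes operator of a Frobenius algebra *)

Section Frobenius.
Variables (k : fieldType) (A : algType k).
Variables (eps : {scalar A}) (sigma : {lrmorphism A -> A}).
Hypothesis frob : frobenius_form eps.
Hypothesis nak : nakayama_automorphism eps sigma.
Implicit Types (f g h : seq A -> A) (s t u w r : seq A) (i j : bool).
Implicit Types (F psi : seq A -> k^o).

Local Notation ph := (ph eps).
Local Notation cyd := (cyd sigma).
Local Notation cyc := (cyc sigma).
Local Notation nrm := (nrm sigma).
Local Notation invk := (invk sigma).

Lemma epsE (a b : A) : eps (a * b) = eps (sigma b * a).
Proof. exact: nak.2. Qed.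

Lemma eps_sigma (a : A) : eps (sigma a) = eps a.
Proof. by rewrite -[a in RHS]mul1r epsE mulr1. Qed.

Lemma epsD (a b : A) : eps (a + b) = eps a + eps b.
Proof. exact: raddfD. Qed.

Lemma epsB (a b : A) : eps (a - b) = eps a - eps b.
Proof. exact: raddfB. Qed.

(** Every functional on [A] is [a |-> eps (a * x)] for some [x]; the form is
    defined with [x] on the other side, hence the use of [sigma]. *)
Lemma frob_ex (phi : A -> k) : linear (phi : A -> k^o) ->
  exists x, forall a, eps (a * x) = phi a.
Proof.
move=> lin.
pose L := GRing.isLinear.Build k A k^o _ phi lin.
pose Phi : {linear A -> k^o} := HB.pack phi L.
have [x [hx _]] := frob (Phi : {scalar A}).
have [sg' _ sgK] := nak.1.
by exists (sg' x) => a; rewrite epsE sgK hx.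
Qed.

Lemma eps_nondeg (x y : A) : (forall a, eps (a * x) = eps (a * y)) -> x = y.
Proof.
move=> h; apply: (bij_inj nak.1).
have lin : linear ((fun b => eps (sigma x * b)) : A -> k^o).
  by move=> c a b; rewrite mulrDr -scalerAr linearP.
pose Phi : {linear A -> k^o} := HB.pack (fun b => eps (sigma x * b))
  (GRing.isLinear.Build k A k^o _ _ lin).
have [z [hz uz]] := frob (Phi : {scalar A}).
rewrite -(uz (sigma x)) // -(uz (sigma y)) // => b.
by rewrite -epsE -h epsE.
Qed.

(** The cochain [f] with [eps (a * f s) = psi (a :: s)], for multilinear [psi];
    [0] is the value where no such element exists. *)
Definition rep psi s : A := xget 0 [set x | forall a, eps (a * x) = psi (a :: s)].

Lemma repE psi s (a : A) : mlin psi -> eps (a * rep psi s) = psi (a :: s).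
Proof.
move=> h; have lin : linear ((fun a => psi (a :: s)) : A -> k^o).
  by move=> c b d; exact: (h [::]).
have [x hx] := frob_ex lin.
exact: (xgetPex 0 (ex_intro (fun x => forall a, eps (a * x) = psi (a :: s)) x hx)).
Qed.

Lemma ph_rep psi s : mlin psi -> psi [::] = 0 -> ph (rep psi) s = psi s.
Proof. by move=> h h0; case: s => [|a s] //=; rewrite repE. Qed.

Lemma ph_inj f g s : (forall a, ph f (a :: s) = ph g (a :: s)) -> f s = g s.
Proof. by move=> h; apply: eps_nondeg => a; exact: (h a). Qed.

Lemma rep_multilinear psi : mlin psi -> multilinear (rep psi).
Proof.
move=> h x z c a b; apply: eps_nondeg => d.
rewrite repE // -cat_cons h mulrDr -scalerAr linearP !repE //.
Qed.

Lemma rep0 psi s : mlin psi -> (forall a, psi (a :: s) = 0) -> rep psi s = 0.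
Proof.
by move=> h h0; apply: eps_nondeg => a; rewrite repE // h0 mulr0 raddf0.
Qed.

Lemma mlin_cyc (K : seq A -> seq A -> k^o) :
  (forall r, mlin (fun w => K w r)) -> (forall w, mlin (K w)) ->
  mlin (cyc K : seq A -> k^o).
Proof.
move=> h1 h2 [|d x] z c a b.
  have E (t : A) : cyc K (t :: z) = spl (fun r z => sg (~~ odd (size r) && odd (size z))
      (K (map sigma z ++ [:: t]) r)) z.
    by apply: eq_spl => r w; rewrite cats1.
  rewrite !cat0s !E.
  apply: (@mlin_spl_param k A k^o A (fun r z u =>
    sg (~~ odd (size r) && odd (size z)) (K (map sigma z ++ u) r)) z _ [::] [::]).
  by move=> r w; apply: mlin_sg; apply: (mlin_cat (F := fun u => K u r)).
have h : mlin (spl (fun r z => sg (~~ odd (size r) && odd (size z))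
                       (K (rcons (map sigma z) d) r)) : seq A -> k^o).
  apply: mlin_spl => [w|r].
    apply: (mlin_size_sg (fun n => ~~ odd n && odd (size w))); exact: h2.
  apply: (mlin_size_sg (fun n => ~~ odd (size r) && odd n)).
  apply: (mlin_map (F := fun u => K (rcons u d) r) sigma).
  exact: (mlin_rcons (F := fun u => K u r)).
exact: h.
Qed.

Lemma mlin_nrm F : mlin F -> mlin (nrm F : seq A -> k^o).
Proof.
by move=> h; apply: mlin_cyc => [r|w]; [exact: mlin_catr | exact: mlin_cat].
Qed.

Lemma mlin_eps f : multilinear f -> mlin (fun s => eps (f s) : k^o).
Proof. by move=> h x z c a b; rewrite h linearP. Qed.

Lemma mlin_ph f : multilinear f -> mlin (ph f : seq A -> k^o).
Proof.
move=> h [|d x] z c a b /=; first by rewrite mulrDl -scalerAl linearP.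
by rewrite h mulrDr -scalerAr linearP.
Qed.

(** The Connes operator on cochains: the cochain that corresponds to the norm of
    [eps \o f]. *)
Definition conn f : seq A -> A := rep (nrm (fun s => eps (f s))).

Lemma ph_conn f s : multilinear f -> ph (conn f) s = nrm (fun s => eps (f s)) s.
Proof. by move=> h; rewrite ph_rep //; apply: mlin_nrm; exact: mlin_eps. Qed.

Lemma conn_multilinear f : multilinear f -> multilinear (conn f).
Proof. by move=> h; apply: rep_multilinear; apply: mlin_nrm; exact: mlin_eps. Qed.

Lemma nrm_lin (c : k) (F F' : seq A -> k) s :
  nrm (fun u => c * F u + F' u) s = c * nrm F s + nrm F' s.
Proof.
rewrite (nrmD _ (fun u => c * F u)); congr (_ + _).
case: s => [|a s]; first by rewrite mulr0.
symmetry; rewrite /nrm /= (spl_morph (h := fun v : k => c * v)).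
  by apply: eq_spl => r z; rewrite sgMr.
by move=> *; exact: mulrDr.
Qed.

Lemma conn_lin c f g s : multilinear f -> multilinear g ->
  conn (fun s => c *: f s + g s) s = c *: conn f s + conn g s.
Proof.
move=> hf hg; apply: eps_nondeg => a.
have hfg : multilinear (fun s => c *: f s + g s).
  by apply: (@mlinD _ _ A (fun s => c *: f s) g) => //; apply: (@mlinZ _ _ A f).
rewrite mulrDr -scalerAr linearP.
rewrite -[eps (a * conn _ s)]/(ph (conn (fun s => c *: f s + g s)) (a :: s)).
rewrite -[eps (a * conn f s)]/(ph (conn f) (a :: s)).
rewrite -[eps (a * conn g s)]/(ph (conn g) (a :: s)).
rewrite !ph_conn // -nrm_lin.
by apply: eq_nrm => u; rewrite linearP.
Qed.

(** A cochain that commutes with the Nakayama automorphism. *)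
Definition invc f : Prop := forall s, f (map sigma s) = sigma (f s).

Lemma invk_eps f : invc f -> invk (fun s => eps (f s)).
Proof. by move=> h s; rewrite h eps_sigma. Qed.

Lemma invk_ph f : invc f -> invk (ph f).
Proof. by move=> h [|a s] //=; rewrite h -rmorphM eps_sigma. Qed.

Lemma invc_cup f g : invc f -> invc g -> invc (cup f g).
Proof.
move=> hf hg s; rewrite /cup spl_map (spl_morph (h := sigma)); last exact: rmorphD.
by apply: eq_spl => x y; rewrite hf hg rmorphM.
Qed.

Lemma invc_conn f : multilinear f -> invc f -> invc (conn f).
Proof.
move=> hf h s; have [sg' sgK' sgK] := nak.1; apply: eps_nondeg => a.
rewrite -[a]sgK -rmorphM eps_sigma.
have := nrm_inv (sg' a :: s) (invk_eps h).
by rewrite -!ph_conn.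
Qed.

(** The action of the Nakayama automorphism on cochains, [tau] being its
    inverse. *)
Definition twist (tau : A -> A) f s : A := tau (f (map sigma s)).

(** The Connes operator is a homotopy from the identity to the twist. *)
Lemma conn_hdiff (tau : A -> A) f s : (forall a, sigma (tau a) = a) ->
  multilinear f -> multilinear (hdiff f) ->
  hdiff (conn f) s + conn (hdiff f) s = f s - twist tau f s.
Proof.
move=> tauK hf hdf; apply: eps_nondeg => a.
rewrite mulrDr mulrBr epsD epsB.
have -> : eps (a * twist tau f s) = ph f (map sigma (a :: s)).
  by rewrite -[LHS]eps_sigma rmorphM; congr (eps (_ * _)); exact: tauK.
rewrite -[eps (a * f s)]/(ph f (a :: s)) -nrm_tw.
rewrite -[eps (a * hdiff _ s)]/(ph (hdiff (conn f)) (a :: s)).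
rewrite -[eps (a * conn _ s)]/(ph (conn (hdiff f)) (a :: s)) ph_conn //.
rewrite (ph_hdiff epsE).
have -> : cyd (ph (conn f)) (a :: s) = cyd (nrm (fun s => eps (f s))) (a :: s).
  congr (cyd _ _); apply: funext => u; exact: ph_conn.
rewrite cyd_nrm (eq_nrm _ _ (eps_hdiff epsE f)) !nrmB; abel.
Qed.

End Frobenius.

(** * The square of the Connes operator *)
Section ConnesSquare.
Variables (k : fieldType) (A : algType k).
Variables (eps : {scalar A}) (sigma : {lrmorphism A -> A}).
Hypothesis frob : frobenius_form eps.
Hypothesis nak : nakayama_automorphism eps sigma.
Implicit Types (f g h : seq A -> A) (s t u w r : seq A) (i j : bool).

Local Notation ph := (ph eps).
Local Notation cyd := (cyd sigma).
Local Notation nrm := (nrm sigma).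
Local Notation tw := (tw sigma).
Local Notation conn := (conn eps sigma).
Local Notation invc := (invc sigma).
Local Notation rep := (rep eps).
Let epsE := epsE nak.

Lemma eq_nrm_pos (F F' : seq A -> k) s :
  (forall a u, F (a :: u) = F' (a :: u)) -> nrm F s = nrm F' s.
Proof. by move=> h; apply: eq_cyc => -[|b u] a r; rewrite /= h. Qed.

(** The contraction with the unit of [A] anticommutes with the differential, up
    to the product of the contraction with [iota1]. *)
Lemma hdiff_cons1 f s :
  hdiff f (1 :: s) = cup (@iota1 k A) (fun u => f (1 :: u)) s -
                     hdiff (fun u => f (1 :: u)) s.
Proof.
rewrite !hdiffE !cup_iotal !cup_iotar /= sg_negb.
case/lastP: s => [|s c] /=.
  by rewrite /sg /= mul1r mulr1; abel.
rewrite belast_rcons last_rcons rc_rcons.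
by case: s => [|b s] /=; rewrite !mul1r; abel.
Qed.

(** For invariant [f] with closed [conn f], the cochain [conn (conn f)] is a
    coboundary. *)
Lemma conn_sq f s : multilinear f -> invc f -> (forall s, hdiff (conn f) s = 0) ->
  conn (conn f) s =
  hdiff (rep (nrm (ph (fun u => conn f (1 :: 1 :: u))))) s.
Proof.
move=> hf invf dg; set g := conn f.
have hg : multilinear g by exact: conn_multilinear.
have invg : invc g by exact: invc_conn.
pose g1 u := g (1 :: u); pose h u := g (1 :: 1 :: u).
have hh : multilinear h.
  by apply: (@mlin_cons _ _ A g1); apply: (@mlin_cons _ _ A g).
have invf1 (f' : seq A -> A) : invc f' -> invc (fun u => f' (1 :: u)).
  by move=> If s'; rewrite -If /= rmorph1.
have phE : ph g = nrm (fun s => eps (f s)).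
  by apply: funext => u; exact: ph_conn.
(* [eps \o g] is a rotation of [ph g1], by the rotation invariance of [ph g] *)
have epsg c u : eps (g (c :: u)) = - tw (ph g1) (c :: u).
  have -> : eps (g (c :: u)) = ph g [:: 1, c & u] by rewrite /= mul1r.
  rewrite [in LHS]phE -tw_nrm; last exact: invk_eps.
  rewrite -phE (lastI c u) /tw -rcons_cons !rc_rcons /= sg_negb.
  by [].
pose psi := ph (cup (@iota1 k A) h).
(* two contractions with the unit express [ph g1] as a sum of terms whose norm
   is zero or a coboundary *)
have phg1 a u : ph g1 (a :: u) = psi (a :: u) - tw psi (a :: u) - mrg (ph h) (a :: u).
  have d1 v : hdiff g1 v = cup (@iota1 k A) g1 v.
    have := dg (1 :: v); rewrite hdiff_cons1 => /eqP.
    by rewrite subr_eq0 => /eqP ->.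
  have g1E v : g1 v = cup (@iota1 k A) h v - hdiff h v.
    by have := hdiff_cons1 g1 v; rewrite d1 cup_iotal mul1r.
  rewrite -[ph g1 _]/(eps (a * g1 u)) g1E mulrBr (epsB eps).
  rewrite -[eps (a * cup _ _ _)]/(psi (a :: u)) -addrA -opprD; congr (_ - _).
  rewrite -[eps (a * hdiff _ _)]/(ph (hdiff h) (a :: u)) (ph_hdiff epsE) addrC.
  rewrite /cyd; congr (_ + _).
  case/lastP: u => [|u c].
    by rewrite /= oppr0 cup_iotal mulr0 raddf0.
  rewrite /tw -rcons_cons !rc_rcons /= sg_negb cup_iotal.
  by rewrite mulrA.
apply: (ph_inj frob nak) => a; rewrite ph_conn //.
have -> : nrm (fun s => eps (g s)) (a :: s) = - nrm (tw (ph g1)) (a :: s).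
  by rewrite -nrmN; apply: eq_nrm_pos => b u; exact: epsg.
rewrite nrm_tw_inv; last by apply: (invk_ph nak); exact: invf1.
rewrite (@eq_nrm_pos (ph g1) (fun u => psi u - tw psi u - mrg (ph h) u)) //.
rewrite !nrmB nrm_tw_inv ?subrr ?sub0r ?opprK; last first.
  apply: (invk_ph nak) => u; rewrite !cup_iotal; case: u => [|b u] /=.
    by rewrite rmorph0.
  by rewrite rmorphM; congr (_ * _); exact: (invf1 g1 (invf1 g invg)).
rewrite (ph_hdiff epsE) -cyd_nrm; congr cyd.
apply/esym/funext => u; apply: (ph_rep frob nak) => //.
exact: (mlin_nrm sigma (mlin_ph eps hh)).
Qed.

End ConnesSquare.

(** * The Batalin-Vilkovisky homotopy *)
Section CyclicInsertion.
Variables (k : fieldType) (A : algType k).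
Variables (sigma : {lrmorphism A -> A}).
Implicit Types (f g h : seq A -> A) (s t u w r : seq A) (b i j : bool).
Implicit Types (F G : seq A -> k^o).

Local Notation cyd := (cyd sigma).
Local Notation cyc := (cyc sigma).
Local Notation tw := (tw sigma).

Lemma mrg_ins_param b g (K : seq A -> seq A -> k) w r :
  mrg (fun w => ins b g (K w) r) w = ins b g (fun x => mrg (fun w => K w x) w) r.
Proof.
elim: w K => [|a w IH] K; first by rewrite /= ins0.
rewrite [LHS]/= (IH (fun w => K (a :: w))) [RHS]insB.
by case: w {IH} => [|c w] //=; rewrite ins0.
Qed.

Lemma ins_size_sg j b g G r : madd G -> par j g ->
  ins b g (fun u => sg (odd (size u)) (G u)) r =
  sg (odd (size r) (+) ~~ j) (ins b g G r).
Proof.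
move=> hG pg; rewrite /ins !sweepE -spl_sg; apply: eq_spl_in => x t <-.
rewrite sgsg addbC -sgsg; congr sg; rewrite /insl -spl_sg.
apply: eq_spl_in => y z <-; rewrite !size_cat /= !oddD.
transitivity (sg (odd (size x) (+) ~~ odd (size z)) (G (x ++ g y :: z))) => //.
have E : sg (odd (size y)) (G (x ++ g y :: z)) = sg j (G (x ++ g y :: z)).
  by rewrite -!(madd_sg _ _ _ _ hG) pg.
have -> : odd (size x) (+) (odd (size y) (+) odd (size z)) (+) ~~ j =
    odd (size x) (+) ~~ odd (size z) (+) j (+) odd (size y).
  by case: (odd (size x)); case: (odd (size y)); case: (odd (size z)); case: (j).
by rewrite -[RHS]sgsg E [RHS]sgsg -addbA addbb addbF.
Qed.

(** The insertions in [rcons r' c] that involve the last letter [c], and those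
    that do not. *)
Lemma ins_rcons b g G r :
  ins b g G r = spl (fun x y => sg (b && odd (size x)) (G (rcons x (g y)))) r +
    rc (fun r' c => ins b g (fun u => G (rcons u c)) r') r.
Proof.
case/lastP: r => [|r c].
  by rewrite /ins /= /insl /= andbF !addr0.
rewrite rc_rcons /ins !sweepE !spl_rcons.
rewrite addrAC; congr (_ + _); last by rewrite /insl /= cats1.
rewrite -splD; apply: eq_spl => x t; rewrite -sgD; congr sg.
rewrite /insl spl_rcons addrC cats1; congr (_ + _).
by apply: eq_spl => y z; rewrite rcons_cat.
Qed.

(** Under [cyc], the word is rotated and [g] is inserted at a place that follows
    its original first letter, which is the last letter of [w]. *)
Definition cins b g F w r : k := sg (b && odd (size w)) (ins b g (fun x => F (w ++ x)) r).

(** Besides the merges in [F], the cyclic differential produces the products of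
    the first letter with the inserted value [g y]. *)
Lemma cyd_cins j g F s : madd F -> par j g -> (forall s, hdiff g s = 0) ->
  cyd (cyc (cins (~~ j) g F)) s =
  sg (~~ j) (cyc (cins (~~ j) g (mrg F)) s) +
  cyc (fun w r => sg (~~ j (+) (j && odd (size w)))
     (spl (fun y x => rc (fun u a => F (u ++ a * g y :: x)) w) r)) s.
Proof.
move=> hF pg dg; rewrite cyd_cyc -cyc_sg -cycD; apply: eq_cyc => u a r.
set b := ~~ j; rewrite /cyc_merge.
have -> : mrg (fun w => cins b g F w r) (rcons u a) =
    sg (b && odd (size u)) (ins b g (fun x => mrg (fun w => F (w ++ x)) (rcons u a)) r).
  rewrite (mrg_size_sg (fun o => b && o) (fun w => ins b g (fun x => F (w ++ x)) r)).
  by rewrite size_rcons negbK mrg_ins_param.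
have -> : mrg (cins b g F (rcons u a)) r = sg (b && ~~ odd (size u))
    (sg b (ins b g (mrg (fun x => F (rcons u a ++ x))) r)).
  rewrite /cins mrg_sg size_rcons /=; congr sg.
  rewrite (mrg_ins _ (madd_cat _ hF) pg) (eq_ins _ _ dg (fun=> erefl)) ins0l ?subr0 //.
  exact: madd_cat.
rewrite {2}/cins size_rcons /=.
have -> : ins b g (fun x => mrg F (rcons u a ++ x)) r =
    ins b g (fun x => mrg (fun w => F (w ++ x)) (rcons u a)) r +
    sg (odd (size u)) (ins b g (mrg1 a (fun x => F (u ++ x))) r -
                       ins b g (mrg (fun x => F (rcons u a ++ x))) r).
  by rewrite -insB -ins_sg -insD; apply: eq_ins => // x; rewrite cat_rcons mrg_cat.
have -> : ins b g (mrg1 a (fun x => F (u ++ x))) r =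
    spl (fun y x => rc (fun u a => F (u ++ a * g y :: x)) (rcons u a)) r +
    sg b (if r is c :: r' then ins b g (fun x => F (u ++ a * c :: x)) r' else 0).
  rewrite /ins; case: r => [|c r]; first by rewrite /= /insl /= rc_rcons sg0.
  by congr (_ + sg b _); apply: eq_spl => y x; rewrite rc_rcons.
have -> : (if r is c :: r' then
    rc (fun u a => cins b g F (rcons u (a * c)) r') (rcons u a) else 0) =
    sg (b && ~~ odd (size u))
      (if r is c :: r' then ins b g (fun x => F (u ++ a * c :: x)) r' else 0).
  case: (r) => [|c r']; first by rewrite sg0.
  rewrite rc_rcons /cins size_rcons; congr sg.
  by apply: eq_ins => // x; rewrite cat_rcons.
rewrite /b.
by case: (j); case: (odd (size u)); rewrite /sg /=; abel.
Qed.

(** The insertions in the rotations of [F] and of [tw F] telescope; there remain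
    the insertion in the unrotated word, and the rotations in which the inserted
    value comes last. *)
Lemma cyc_cins_tw j g F s : madd F -> par j g ->
  cyc (cins (~~ j) g F) s - cyc (cins (~~ j) g (tw F)) s =
  (if s is a :: t then sg (~~ j) (ins (~~ j) g (fun x => F (a :: x)) t) else 0) -
  cyc (fun w r => spl (fun x y =>
    sg (j && odd (size (w ++ x))) (F (sigma (g y) :: w ++ x))) r) s.
Proof.
move=> hF pg; case: s => [|a s]; first by rewrite subrr.
set b := ~~ j.
pose X r z := sg (~~ odd (size r) && odd (size z))
                 (cins b g F (rcons (map sigma z) a) r).
pose E := cyc (fun w r => spl (fun x y =>
    sg (j && odd (size (w ++ x))) (F (sigma (g y) :: w ++ x))) r) (a :: s).
have -> : cyc (cins b g F) (a :: s) = sg b (ins b g (fun x => F (a :: x)) s) +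
    spl (fun r z => rc (fun x c => X x (c :: z)) r) s.
  rewrite [LHS]/= (spl_telescope X); congr (_ + _).
  by rewrite /X /= andbF /cins /= andbT.
suff -> : cyc (cins b g (tw F)) (a :: s) =
    E + spl (fun r z => rc (fun x c => X x (c :: z)) r) s by rewrite -/E; abel.
rewrite /E /= -splD; apply: eq_spl => r z; set w := rcons _ a.
have ow : odd (size w) = ~~ odd (size z) by rewrite size_rcons size_map.
rewrite /cins ins_rcons !sgD; congr (_ + _).
  rewrite -!spl_sg; apply: eq_spl => x y; rewrite -rcons_cat /tw rc_rcons !sgsg.
  congr sg; rewrite size_cat oddD /b.
  by case: (j); case: (odd (size w)); case: (odd (size x)); case: (~~ _ && _).
case/lastP: r => [|r c]; first by rewrite /= !sg0.
rewrite !rc_rcons /X /cins /=.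
have -> : ins b g (fun u => tw F (w ++ rcons u c)) r =
   sg (odd (size w)) (sg (odd (size r) (+) ~~ j)
     (ins b g (fun u => F (sigma c :: w ++ u)) r)).
  rewrite -(ins_size_sg (j := j)) //; last exact: (madd_cat (sigma c :: w) hF).
  rewrite -ins_sg; apply: eq_ins => // u.
  by rewrite -rcons_cat /tw rc_rcons size_cat oddD -sgsg.
rewrite -/w !sgsg ow !size_rcons /= /b; congr sg.
by case: (j); case: (odd (size r)); case: (odd (size z)).
Qed.

End CyclicInsertion.

Section BVHomotopy.
Variables (k : fieldType) (A : algType k).
Variables (eps : {scalar A}) (sigma : {lrmorphism A -> A}).
Hypothesis frob : frobenius_form eps.
Hypothesis nak : nakayama_automorphism eps sigma.
Implicit Types (f g h : seq A -> A) (s t u w r : seq A) (b i j : bool).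

Local Notation ph := (ph eps).
Local Notation cyd := (cyd sigma).
Local Notation cyc := (cyc sigma).
Local Notation nrm := (nrm sigma).
Local Notation tw := (tw sigma).
Local Notation conn := (conn eps sigma).
Local Notation invc := (invc sigma).
Let epsE := epsE nak.

Lemma ins_morph (V W : zmodType) (h : V -> W) b g (F : seq A -> V) s :
  {morph h : u v / u + v} -> {morph h : u / - u} ->
  h (ins b g F s) = ins b g (fun u => h (F u)) s.
Proof.
move=> hD hN; rewrite /ins; elim: s F => [|a s IH] F; rewrite [sweep _ _ F _]/= hD.
  by rewrite /insl /= -hD addr0 addr0.
by rewrite (sg_additive _ (hN _)) IH [RHS]/= /insl (spl_morph hD).
Qed.

(** The part of the norm of [eps (f U g)] in which the first letter is in [f]. *)
Definition cupf f g s : k :=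
  cyc (fun w r => spl (fun x y => eps (f (w ++ x) * g y)) r) s.

(* The words in which the first letter is in [g] are rotated, using the
   invariance of [f], to put [g] in front. *)
Lemma nrm_cup i j f g s : par i f -> par j g -> invc f ->
  nrm (fun u => eps (cup f g u)) s = cupf f g s + sg (i && j) (cupf g f s).
Proof.
move=> pf pg invf; case: s => [|a s]; first by rewrite /= sg0 addr0.
rewrite /nrm /cupf /= -spl_sg.
have eps_spl G t : eps (spl G t) = spl (fun x y => eps (G x y)) t.
  by apply: spl_morph => u v; exact: raddfD.
rewrite (eq_spl (G' := fun r z => sg (~~ odd (size r) && odd (size z))
    (spl (fun x y => eps (f (rcons (map sigma z) a ++ x) * g y)) r) +
   spl (fun u v => sg (~~ odd (size r) && odd (size z))
     (eps (g (rcons (map sigma v) a ++ r) * f u))) z)); last first.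
  move=> r z; rewrite cat_rcons /cup spl_cat_cons (epsD eps) sgD addrC !eps_spl.
  congr (_ + _).
    by congr sg; apply: eq_spl => x y; rewrite cat_rcons.
  rewrite spl_map -spl_sg; apply: eq_spl => u v.
  by rewrite invf -epsE cat_rcons.
rewrite splD; congr (_ + _).
rewrite [LHS](eq_spl_in (G' := fun r z => spl (fun u v => sg (i && j)
   (sg (~~ odd (size (r ++ u)) && odd (size v))
     (eps (g (rcons (map sigma v) a ++ r) * f u)))) z)).
  rewrite -(spl_assoc (fun r u v => sg (i && j)
   (sg (~~ odd (size (r ++ u)) && odd (size v))
     (eps (g (rcons (map sigma v) a ++ r) * f u))))).
  apply: eq_spl => r z; rewrite -!spl_sg; apply: eq_spl_in => x y <-.
  by [].
move=> r z _; apply: eq_spl_in => u v <-; rewrite sgsg !size_cat !oddD.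
set W := rcons _ a ++ r.
have oW : odd (size W) = ~~ odd (size v) (+) odd (size r).
  by rewrite size_cat size_rcons size_map oddD.
have E : sg (odd (size u) && odd (size W)) (eps (g W * f u)) =
         sg (i && j) (eps (g W * f u)).
  transitivity (sg (odd (size u) && j) (eps (g W * f u))).
    by case: (odd (size u)) => //=; rewrite -!eps_sg -!sgMl pg.
  case: (j); rewrite ?andbT ?andbF //.
  by rewrite -!eps_sg -!sgMr pf.
move: E; rewrite oW => E.
have -> : ~~ odd (size r) && (odd (size u) (+) odd (size v)) =
    ~~ (odd (size r) (+) odd (size u)) && odd (size v) (+)
    odd (size u) && (~~ odd (size v) (+) odd (size r)).
  by case: (odd (size u)); case: (odd (size v)); case: (odd (size r)).
by rewrite -[LHS]sgsg E sgsg addbC.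
Qed.

(** The homotopy for one half of the norm of [eps (f U g)]. *)
Lemma cyd_cins_eps i j f g s : multilinear f -> multilinear g ->
  par i f -> par j g -> (forall s, hdiff f s = 0) -> (forall s, hdiff g s = 0) ->
  cyd (cyc (cins (~~ j) g (fun u => eps (f u)))) s =
  ph (ins (~~ j) g f) s - sg (~~ j (+) (i && j)) (cupf f g s)
    - ph (cup g (conn f)) s.
Proof.
move=> hf hg pf pg df dg.
have mF : madd (fun u => eps (f u)) by exact: mlin_madd (mlin_eps eps hf).
rewrite (cyd_cins _ _ mF pg dg); congr (_ + _).
  have -> : cyc (cins (~~ j) g (mrg (fun u => eps (f u)))) s =
      cyc (cins (~~ j) g (ph f)) s - cyc (cins (~~ j) g (tw (ph f))) s.
    rewrite -cycN -cycD; apply: eq_cyc => u a r.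
    rewrite /cins -sgN -sgD -insB; congr sg; apply: eq_ins => // x.
    have := eps_hdiff epsE f (rcons u a ++ x); rewrite df raddf0 => /eqP.
    by rewrite eq_sym subr_eq add0r subr_eq addrC -subr_eq eq_sym => /eqP.
  rewrite (cyc_cins_tw _ _ (mlin_madd (mlin_ph eps hf)) pg).
  have -> : cyc (fun w r => spl (fun x y =>
      sg (j && odd (size (w ++ x))) (ph f (sigma (g y) :: w ++ x))) r) s =
      sg (i && j) (cupf f g s).
    rewrite -cyc_sg; apply: eq_cyc => u a r.
    rewrite -spl_sg; apply: eq_spl => x y.
    rewrite [ph _ _]/= -epsE -!eps_sg; congr (eps _); rewrite -!sgMl; congr (_ * _).
    by case: (j); rewrite ?andbF ?andbT // pf.
  rewrite sgB sgsg; congr (_ - _); case: s => [|a s]; first by rewrite sg0.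
  rewrite sgK /=; symmetry.
  apply: (ins_morph (h := fun v => eps (a * v))) => u; first by move=> v; rewrite mulrDr raddfD.
  by rewrite mulrN raddfN.
case: s => [|a s]; first by rewrite oppr0.
rewrite /= /cup (spl_morph (h := fun v => eps (a * v))); last first.
  by move=> u v; rewrite mulrDr raddfD.
have E y v : eps (a * (g y * conn f v)) = spl (fun x z =>
    sg (~~ odd (size x) && odd (size z))
     (eps (f (rcons (map sigma z) (a * g y) ++ x)))) v.
  rewrite mulrA -[LHS]/(ph (conn f) (a * g y :: v)) ph_conn //.
transitivity (- spl (fun y v => spl (fun x z =>
    sg (~~ odd (size x) && odd (size z))
     (eps (f (rcons (map sigma z) (a * g y) ++ x)))) v) s); last first.
  by congr (- _); apply: eq_spl => y v; rewrite E.
rewrite -spl_assoc -splN; apply: eq_spl => r z.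
rewrite -splN -!spl_sg; apply: eq_spl_in => y x <-.
rewrite rc_rcons size_rcons size_map cat_rcons.
have P : sg (odd (size y)) (eps (f (map sigma z ++ a * g y :: x))) =
         sg j (eps (f (map sigma z ++ a * g y :: x))).
  have fa b (v : A) : sg b (eps (f (map sigma z ++ a * v :: x))) =
      eps (f (map sigma z ++ a * sg b v :: x)).
    by rewrite sgMr (madd_sg _ _ _ _ (mlin_madd (hf : @mlin _ _ A f))) eps_sg.
  by rewrite !fa pg.
rewrite size_cat oddD /=.
set Y := eps _ in P *.
have P' : sg (odd (size y) && odd (size z)) Y = sg (j && odd (size z)) Y.
  by case: (odd (size z)); rewrite ?andbT ?andbF.
have -> : ~~ (odd (size y) (+) odd (size x)) && odd (size z) =
    ~~ odd (size x) && odd (size z) (+) (odd (size y) && odd (size z)).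
  by case: (odd (size y)); case: (odd (size x)); case: (odd (size z)).
rewrite sgsg addbAC -sgsg P' sgsg -sg_negb; congr sg.
by case: (j); case: (odd (size x)); case: (odd (size z)).
Qed.

End BVHomotopy.

(** * Degrees *)

Section Degrees.
Variables (k : fieldType) (A : algType k).
Implicit Types (f g h : seq A -> A) (s t u w r : seq A) (b i j : bool).

(** A homogeneous cochain has the parity of its degree. *)
Lemma homogeneous_par n f : homogeneous n f -> par (odd n) f.
Proof.
by move=> h s; have [<-//|ne] := eqVneq (size s) n; rewrite h // !sg0.
Qed.

Lemma ins_vanish (V : zmodType) b g (F : seq A -> V) s :
  (forall x y z, x ++ y ++ z = s -> F (x ++ g y :: z) = 0) -> ins b g F s = 0.
Proof.
rewrite /ins; elim: s F => [|a s IH] F h.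
  by rewrite [LHS]/= addr0; exact: (h [::] [::] [::]).
rewrite [LHS]/= IH ?sg0 ?addr0.
  by apply: spl_eq0 => y z E; exact: (h [::]).
by move=> x y z E; apply: (h (a :: x)); rewrite /= E.
Qed.

Lemma ins_homogeneous b p q f g s : madd f -> homogeneous p f -> homogeneous q g ->
  (size s).+1 != (p + q)%N -> ins b g f s = 0.
Proof.
move=> hf pf qg ne; apply: ins_vanish => x y z E.
have [Ey|ny] := eqVneq (size y) q; last by rewrite qg // madd0.
apply: pf; apply: contraNneq ne => <-; rewrite -E -Ey !size_cat /=; lia.
Qed.

Lemma cup_homogeneous p q f g : homogeneous p f -> homogeneous q g ->
  homogeneous (p + q) (cup f g).
Proof.
move=> pf qg s ne; apply: spl_eq0 => x y E.
have [Ex|nx] := eqVneq (size x) p; last by rewrite pf ?mul0r.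
rewrite qg ?mulr0 //; apply: contraNneq ne => Ey.
by rewrite -E size_cat Ex Ey.
Qed.

(** The component of degree [n] of a cochain. *)
Definition dcomp n f s : A := if size s == n then f s else 0.

Lemma eq_hdiff_size f g s : (forall u, size u = (size s).-1 -> f u = g u) ->
  hdiff f s = hdiff g s.
Proof.
rewrite !hdiffE !cup_iotal !cup_iotar; case: s => [|a s] h //.
rewrite h // (eq_mrg_size h); congr (_ + sg _ _).
by rewrite /= h // size_belast.
Qed.

Lemma hdiff0 s : hdiff (fun=> 0 : A) s = 0.
Proof. by rewrite hdiffE cup0r cup0l mrg0 sg0 subrr addr0. Qed.

Lemma hdiff_comp n f s : hdiff (dcomp n f) s = dcomp n.+1 (hdiff f) s.
Proof.
case: s => [|a s]; first by rewrite /dcomp.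
rewrite {2}/dcomp [size (a :: s)]/= eqSS; have [E|ne] := eqVneq (size s) n.
  by apply: eq_hdiff_size => u eu; rewrite /dcomp eu /= E eqxx.
rewrite -[RHS](hdiff0 (a :: s)); apply: eq_hdiff_size => u eu.
by rewrite /dcomp eu /= (negbTE ne).
Qed.

Lemma comp_homogeneous n f : homogeneous n (dcomp n f).
Proof. by move=> s /negbTE h; rewrite /dcomp h. Qed.

Lemma comp_multilinear n f : multilinear f -> multilinear (dcomp n f).
Proof.
move=> h x z c a b; rewrite /dcomp !size_cat /=.
by case: ifP => // _; rewrite scaler0 addr0.
Qed.

Lemma comp_sum N f s : (forall s, (N <= size s)%N -> f s = 0) ->
  f s = \sum_(n < N) dcomp n f s.
Proof.
move=> h; have [le|lt] := leqP N (size s).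
  rewrite h // big1 // => n _; rewrite /dcomp gtn_eqF //.
  exact: leq_trans (ltn_ord n) le.
rewrite (bigD1 (Ordinal lt)) //= {1}/dcomp eqxx big1 ?addr0 // => n.
by rewrite -val_eqE /= eq_sym /dcomp => /negbTE ->.
Qed.

Lemma homogeneous_hcochain n f : multilinear f -> homogeneous n f -> hcochain f.
Proof.
move=> hf h; split=> //; exists n.+1 => s lt; apply: h.
by rewrite gtn_eqF.
Qed.

Lemma hdiff_linear c f g s :
  hdiff (fun s => c *: f s + g s) s = c *: hdiff f s + hdiff g s.
Proof. by rewrite (hdiff_lin c f g). Qed.

Lemma hdiffD f g s : hdiff (fun s => f s + g s) s = hdiff f s + hdiff g s.
Proof.
rewrite -[hdiff f s]scale1r -hdiff_linear; congr (hdiff _ s).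
by apply: funext => u; rewrite scale1r.
Qed.

Lemma hdiffZ c f s : hdiff (fun s => c *: f s) s = c *: hdiff f s.
Proof.
rewrite -[RHS]addr0 -(hdiff0 s) -hdiff_linear; congr (hdiff _ s).
by apply: funext => u; rewrite addr0.
Qed.

Lemma hdiffN f s : hdiff (fun s => - f s) s = - hdiff f s.
Proof.
rewrite -scaleN1r -hdiffZ; congr (hdiff _ s).
by apply: funext => u; rewrite scaleN1r.
Qed.

Lemma hdiffB f g s : hdiff (fun s => f s - g s) s = hdiff f s - hdiff g s.
Proof. by rewrite (hdiffD f (fun s => - g s)) hdiffN. Qed.

Lemma hdiff_sg b f s : hdiff (fun s => sg b (f s)) s = sg b (hdiff f s).
Proof. by case: b => //; exact: hdiffN. Qed.

End Degrees.

Section ConnesDegrees.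
Variables (k : fieldType) (A : algType k).
Variables (eps : {scalar A}) (sigma : {lrmorphism A -> A}).
Hypothesis frob : frobenius_form eps.
Hypothesis nak : nakayama_automorphism eps sigma.
Implicit Types (f g h : seq A -> A) (s t u w r : seq A) (b i j : bool).

Local Notation ph := (ph eps).
Local Notation cyc := (cyc sigma).
Local Notation conn := (conn eps sigma).
Local Notation invc := (invc sigma).
Local Notation rep := (rep eps).

Lemma cyc_vanish (K : seq A -> seq A -> k) s :
  (forall w r, w != [::] -> size (w ++ r) = size s -> K w r = 0) -> cyc K s = 0.
Proof.
move=> h; rewrite (eq_cyc_in (K' := fun _ _ => 0)).
  by case: s {h} => //= a s; apply: spl_eq0 => *; rewrite sg0.
move=> z a r E; apply: h; first by rewrite -size_eq0 size_rcons.
by rewrite size_cat size_rcons size_map -E.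
Qed.

Lemma conn_homogeneous n f : multilinear f -> homogeneous n.+1 f ->
  homogeneous n (conn f).
Proof.
move=> hf h s ne; apply: (rep0 frob nak); first exact: mlin_nrm (mlin_eps _ hf).
move=> a; apply: cyc_vanish => w r _ E; rewrite h ?raddf0 // E.
by rewrite eqSS.
Qed.

Lemma conn_homogeneous0 f s : multilinear f -> homogeneous 0 f -> conn f s = 0.
Proof.
move=> hf h; apply: (rep0 frob nak); first exact: mlin_nrm (mlin_eps _ hf).
by move=> a; apply: cyc_vanish => w r _ E; rewrite h ?raddf0 // E.
Qed.

Lemma mlin_cins b g (F : seq A -> k^o) : multilinear g -> mlin F ->
  mlin (cyc (cins b g F) : seq A -> k^o).
Proof.
move=> hg hF; apply: mlin_cyc => [r|w].
  apply: (mlin_size_sg (fun n => b && odd n)) => x z c a d.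
  rewrite -ins_lin; apply: eq_ins => // u; rewrite -!catA.
  exact: hF.
apply: mlin_sg; apply: mlin_ins => //; exact: mlin_cat.
Qed.

(** The Batalin-Vilkovisky identity for invariant cocycles, up to a coboundary. *)
Lemma conn_cup p q f g : let i := odd p in let j := odd q in
  multilinear f -> multilinear g -> homogeneous p f -> homogeneous q g ->
  (forall s, hdiff f s = 0) -> (forall s, hdiff g s = 0) -> invc f -> invc g ->
  exists2 h, hcochain h &
  forall s, conn (cup f g) s =
    sg (~~ j (+) (i && j)) (ins (~~ j) g f s - cup g (conn f) s) +
    sg (~~ i) (ins (~~ i) f g s - cup f (conn g) s) - hdiff h s.
Proof.
move=> i j hf hg pf qg df dg invf invg.
have mf := mlin_cins (~~ j) hg (mlin_eps eps hf).
have mg := mlin_cins (~~ i) hf (mlin_eps eps hg).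
pose hfg := rep (cyc (cins (~~ j) g (fun u => eps (f u)))).
pose hgf := rep (cyc (cins (~~ i) f (fun u => eps (g u)))).
have cyc0 n m (f' g' : seq A -> A) b s : multilinear f' -> homogeneous n f' ->
    homogeneous m g' -> (n + m <= size s)%N ->
    cyc (cins b g' (fun u => eps (f' u))) s = 0.
  move=> hf' hn hm le; apply: cyc_vanish => w r _ E.
  rewrite /cins ins_vanish ?sg0 // => x y z E'.
  have [Ey|ny] := eqVneq (size y) m; last first.
    by rewrite hm // catA (madd0 _ _ (mlin_madd (hf' : @mlin _ _ A f'))) raddf0.
  rewrite hn ?raddf0 //; apply/eqP => En.
  move: En E le; rewrite -E' -Ey !size_cat /=; lia.
exists (fun s => sg (~~ j (+) (i && j)) (hfg s) + sg (~~ i) (hgf s)).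
  split.
    apply: (@mlinD _ _ A (fun s => sg _ (hfg s)) (fun s => sg _ (hgf s))).
      exact: (@mlin_sg _ _ A _ hfg (rep_multilinear frob nak mf)).
    exact: (@mlin_sg _ _ A _ hgf (rep_multilinear frob nak mg)).
  exists (p + q)%N => s le; rewrite /hfg /hgf.
  rewrite (rep0 frob nak mf) ?(rep0 frob nak mg) ?sg0 ?addr0 // => a.
    by apply: (cyc0 q p) => //=; rewrite addnC ltnW.
  by apply: (cyc0 p q) => //=; rewrite ltnW.
move=> s; have hcup : multilinear (cup f g) by exact: mlin_cup.
apply: (ph_inj frob nak (g := fun s => _ + _ - hdiff _ s)) => a.
have phr b f' g' : mlin (cyc (cins b g' (fun u => eps (f' u))) : seq A -> k^o) ->
    ph (hdiff (rep (cyc (cins b g' (fun u => eps (f' u)))))) (a :: s) =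
    cyd sigma (cyc (cins b g' (fun u => eps (f' u)))) (a :: s).
  move=> m; rewrite (ph_hdiff (epsE nak)); congr (cyd sigma _ _).
  by apply: funext => u; apply: (ph_rep frob nak).
have pi := homogeneous_par pf; have pj := homogeneous_par qg.
have Ef := cyd_cins_eps frob nak (a :: s) hf hg pi pj df dg.
have Eg := cyd_cins_eps frob nak (a :: s) hg hf pj pi dg df.
rewrite -phr // in Ef; rewrite -phr // in Eg.
rewrite ph_conn // (nrm_cup nak _ pi pj invf).
have LD (u v : A) : eps (a * (u + v)) = eps (a * u) + eps (a * v).
  by rewrite mulrDr (epsD eps).
have LN (u : A) : eps (a * - u) = - eps (a * u) by rewrite mulrN raddfN.
have LS b (u : A) : eps (a * sg b u) = sg b (eps (a * u)) by rewrite sgMr eps_sg.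
have {}Ef : cupf eps sigma f g (a :: s) = sg (~~ j (+) (i && j))
    (eps (a * ins (~~ j) g f s) - eps (a * cup g (conn f) s) - eps (a * hdiff hfg s)).
  move: Ef; rewrite /= -/i -/j -/hfg => ->.
  by case: (~~ j (+) (i && j)); rewrite /sg; abel.
have {}Eg : cupf eps sigma g f (a :: s) = sg (~~ i (+) (j && i))
    (eps (a * ins (~~ i) f g s) - eps (a * cup f (conn g) s) - eps (a * hdiff hgf s)).
  move: Eg; rewrite /= -/i -/j -/hgf => ->.
  by case: (~~ i (+) (j && i)); rewrite /sg; abel.
rewrite [ph _ _]/= hdiffD !hdiff_sg Ef Eg -/i -/j.
rewrite !(LD, LN, LS).
by case: (i); case: (j); rewrite /sg /=; abel.
Qed.

End ConnesDegrees.

(** * The invariant subcomplex *)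

Section Spectrum.
Variables (k : fieldType) (A : algType k).
Variables (eps : {scalar A}) (sigma : {lrmorphism A -> A}).
Hypothesis frob : frobenius_form eps.
Hypothesis nak : nakayama_automorphism eps sigma.

(** Every element of [A] is a sum of eigenvectors of [sigma] for the eigenvalues
    in the list [S]. *)
Definition spectrum (S : seq k) : Prop := forall a : A, exists c : k -> A,
  (forall l, l \in S -> sigma (c l) = l *: c l) /\ a = \sum_(l <- S) c l.

Lemma eps_eigen (l m : k) (a b : A) : sigma a = l *: a -> sigma b = m *: b ->
  eps (a * b) != 0 -> l * m = 1.
Proof.
move=> ha hb ne; have := eps_sigma nak (a * b).
have -> : sigma (a * b) = sigma a * sigma b by exact: rmorphM.
rewrite ha hb -scalerAl -scalerAr scalerA linearZ /= => E.
by apply: (mulIf ne); rewrite mul1r.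
Qed.

(** Only the product of the eigenspaces for [l] and [l^-1] is seen by the form.
    If there were infinitely many eigenvalues, a functional that is nonzero on
    every eigenspace would not be represented by an element of [A], which has
    finitely many components. *)
Lemma finite_spectrum : diagonalisable_map sigma ->
  exists S : seq k, (forall l, l \in S -> l != 0) /\ spectrum S.
Proof.
move=> [Sig [Sig0 [dex duniq]]].
have Sne l : Sig l -> l != 0 by move=> h; apply/eqP => l0; apply: Sig0; rewrite -l0.
have sigL (x : k) (u v : A) : sigma (x *: u + v) = x *: sigma u + sigma v.
  exact: linearP.
pose isdec (b : A) (sc : seq k * (k -> A)) := [/\ uniq sc.1,
   (forall i, i \in sc.1 -> Sig i /\ sigma (sc.2 i) = i *: sc.2 i)
   & b = \sum_(i <- sc.1) sc.2 i].
have decX b : exists sc, isdec b sc.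
  by have [s [c [h1 h2 h3]]] := dex b; exists (s, c); split.
have [dec decP] := choice decX.
pose ext (sc : seq k * (k -> A)) l := if l \in sc.1 then sc.2 l else 0.
have extP b sc : isdec b sc -> forall l, Sig l -> sigma (ext sc l) = l *: ext sc l.
  move=> [_ h _] l Sl; rewrite /ext; case: ifP => [/h[]//|_].
  by rewrite raddf0 scaler0.
have ext_sum b sc (U : seq k) : isdec b sc -> uniq U -> {subset sc.1 <= U} ->
    b = \sum_(i <- U) ext sc i.
  move=> [us _ {1}->] uU sub; rewrite -big_mkcond -big_filter; apply: perm_big.
  apply: uniq_perm => //; first exact: filter_uniq.
  move=> i; rewrite mem_filter; apply/idP/andP => [h|[]//].
  by split=> //; exact: sub.
have SigS b l : l \in (dec b).1 -> Sig l by case: (decP b) => _ h _ /h[].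
(* the component of an element for an eigenvalue does not depend on the decomposition *)
have ext_uniq b (U : seq k) (c : k -> A) : uniq U ->
    (forall i, i \in U -> Sig i /\ sigma (c i) = i *: c i) ->
    b = \sum_(i <- U) c i -> forall l, ext (dec b) l = ext (U, c) l.
  move=> uU hc bE l.
  have dU : isdec b (U, c) by [].
  pose W := undup (U ++ (dec b).1).
  have uW : uniq W by exact: undup_uniq.
  have sU : {subset U <= W} by move=> i h; rewrite mem_undup mem_cat h.
  have sD : {subset (dec b).1 <= W} by move=> i h; rewrite mem_undup mem_cat h orbT.
  have SW i : i \in W -> Sig i.
    by rewrite mem_undup mem_cat => /orP[/hc[]//|]; exact: SigS.
  have [lW|lW] := boolP (l \in W); last first.
    by rewrite /ext (negbTE (contra (@sU l) lW)) (negbTE (contra (@sD l) lW)).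
  apply/eqP; rewrite -subr_eq0; apply/eqP.
  apply: (duniq W (fun i => ext (dec b) i - ext (U, c) i)) => //.
  - move=> i iW; split; first exact: SW.
    by rewrite /= raddfB /= (extP _ _ (decP b)) ?(extP _ _ dU) ?scalerBr //; exact: SW.
  - by rewrite sumrB -(ext_sum _ _ _ (decP b)) // -(ext_sum _ _ _ dU) // subrr.
pose P l (x : A) : Prop := x <> 0 /\ sigma x = l^-1 *: x.
pose e l : A := xget 0 (P l).
have eP l : sigma (e l) = l^-1 *: e l.
  rewrite /e; case: xgetP => [x -> []//|_]; first by rewrite raddf0 scaler0.
(* the formal sum over all eigenvalues of the functionals [eps (e l * _)] *)
pose phi b : k := \sum_(l <- (dec b).1) eps (e l * ext (dec b) l).
have phiE b (U : seq k) : uniq U -> {subset (dec b).1 <= U} ->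
    phi b = \sum_(l <- U) eps (e l * ext (dec b) l).
  move=> uU sub; case: (decP b) => us _ _.
  rewrite [RHS](bigID (fun l => l \in (dec b).1)) /= [X in _ + X]big1 ?addr0.
    rewrite -big_filter; apply: perm_big; apply: uniq_perm => //; first exact: filter_uniq.
    move=> i; rewrite mem_filter; apply/idP/andP => [h|[]//].
    by split=> //; exact: sub.
  by move=> l /negbTE nl; rewrite /ext nl mulr0 raddf0.
have phi_lin : linear (phi : A -> k^o).
  move=> x b b'; set b2 := x *: b + b'.
  pose W := undup ((dec b).1 ++ (dec b').1).
  have uW : uniq W by exact: undup_uniq.
  have sD : {subset (dec b).1 <= W} by move=> i h; rewrite mem_undup mem_cat h.
  have sD' : {subset (dec b').1 <= W} by move=> i h; rewrite mem_undup mem_cat h orbT.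
  have SW i : i \in W -> Sig i.
    by rewrite mem_undup mem_cat => /orP[]; exact: SigS.
  have E2 : forall l, ext (dec b2) l = ext (W, fun i => x *: ext (dec b) i + ext (dec b') i) l.
    apply: ext_uniq => // [i iW|].
      split; first exact: SW.
      rewrite sigL (extP _ _ (decP b)) ?(extP _ _ (decP b')) ?scalerDr ?scalerA; try exact: SW.
      by rewrite mulrC.
    rewrite big_split /= -scaler_sumr -(ext_sum _ _ _ (decP b)) //.
    by rewrite -(ext_sum _ _ _ (decP b')).
  pose W2 := undup (W ++ (dec b2).1).
  have uW2 : uniq W2 by exact: undup_uniq.
  have sW : {subset W <= W2} by move=> i h; rewrite mem_undup mem_cat h.
  rewrite (phiE b2 W2) //; last by move=> i h; rewrite mem_undup mem_cat h orbT.
  rewrite (phiE b W2) //; last by move=> i /sD/sW.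
  rewrite (phiE b' W2) //; last by move=> i /sD'/sW.
  rewrite scaler_sumr -big_split; apply: eq_bigr => l _ /=.
  rewrite E2 /ext /=; case: ifP => lW; first by rewrite mulrDr -scalerAr linearP.
  have /negbTE -> : l \notin (dec b).1 by apply: contraFN lW => /sD.
  have /negbTE -> : l \notin (dec b').1 by apply: contraFN lW => /sD'.
  by rewrite !mulr0 raddf0 scaler0 addr0.
have [x hx] := frob_ex frob nak phi_lin.
have [U [c [uU hc xE]]] := dex (sigma x).
have xphi b : \sum_(i <- U) eps (c i * b) = phi b.
  rewrite -hx (epsE nak) xE mulr_suml; symmetry.
  exact: (big_morph eps (epsD eps) (raddf0 eps)).
(* an eigenvalue that is not used by the element representing [phi] is missed
   by [phi], against nondegeneracy *)
have eigU l (v : A) : Sig l -> v != 0 -> sigma v = l *: v -> l \in U.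
  move=> Sl vne vE; set m := l^-1.
  have [ene eE] : P m (e m).
    apply: (xgetPex 0); exists v; split; first exact/eqP.
    by rewrite /m invrK.
  rewrite /m invrK in eE.
  have [b bne] : exists b, eps (e m * b) != 0.
    apply: contrapT => nb; apply: ene; apply: (eps_nondeg frob nak) => a.
    have [sg' sgK' sgK] := nak.1.
    rewrite mulr0 raddf0 -[a]sgK -(epsE nak); apply/eqP; apply: contraT => ne.
    by case: nb; exists (sg' a).
  have [Ub [cb [uUb hcb bE]]] := dex b.
  have [i iU ine] : exists2 i, i \in Ub & eps (e m * cb i) != 0.
    apply: contrapT => ni; move/eqP: bne; apply.
    rewrite bE mulr_sumr (big_morph eps (epsD eps) (raddf0 eps)) big_seq big1 // => i iU.
    by apply/eqP; apply: contraT => ne; case: ni; exists i.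
  have [Si iE] := hcb i iU.
  have im : i = m.
    have := eps_eigen eE iE ine => /(congr1 (fun z => m * z)).
    by rewrite mulr1 mulrA mulVf ?mul1r // Sne.
  have phi_ne : phi (cb i) != 0.
    have E1 : forall l', ext (dec (cb i)) l' = ext ([:: i], cb) l'.
      apply: ext_uniq => //; last by rewrite big_seq1.
      by move=> i'; rewrite inE => /eqP ->.
    pose W := undup (i :: (dec (cb i)).1).
    rewrite (phiE _ W); [|exact: undup_uniq|by move=> z h; rewrite mem_undup inE h orbT].
    rewrite (bigD1_seq i) ?undup_uniq //=; last by rewrite mem_undup inE eqxx.
    rewrite big1 ?addr0; last first.
      by move=> l' /negbTE ne; rewrite E1 /ext /= inE ne mulr0 raddf0.
    by rewrite E1 /ext /= inE eqxx im; rewrite im in ine.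
  have [n nU nne] : exists2 n, n \in U & eps (c n * cb i) != 0.
    apply: contrapT => ni; move/eqP: phi_ne; apply.
    rewrite -xphi big_seq big1 // => n nU.
    by apply/eqP; apply: contraT => ne; case: ni; exists n.
  have [_ nE] := hc n nU.
  have := eps_eigen nE iE nne => nm.
  have -> : l = n.
    by rewrite -[l]mul1r -nm im /m mulfVK // Sne.
  exact: nU.
exists U; split=> [l /hc[/Sne]//|a].
exists (ext (dec a)); split=> [l /hc[Sl _]|]; first exact: extP (decP a) _ Sl.
pose W := undup (U ++ (dec a).1).
rewrite {1}(ext_sum _ _ W (decP a)); first last.
- by move=> i h; rewrite mem_undup mem_cat h orbT.
- exact: undup_uniq.
rewrite (bigID (fun l => l \in U)) /= [X in _ + X]big1_seq ?addr0.
  rewrite -big_filter; apply: perm_big; apply: uniq_perm => //.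
    by rewrite filter_uniq // undup_uniq.
  move=> i; rewrite mem_filter mem_undup mem_cat; by case: (i \in U).
move=> l /andP[nU _]; apply/eqP; apply: contraNT nU => ne.
have lD : l \in (dec a).1 by apply: contraNT ne => /negbTE nl; rewrite /ext nl.
apply: (eigU l _ (SigS _ _ lD) ne); apply: extP (decP a) _ (SigS _ _ lD).
Qed.

End Spectrum.

Section Invariant.
Variables (k : fieldType) (A : algType k).
Variables (eps : {scalar A}) (sigma : {lrmorphism A -> A}).
Hypothesis frob : frobenius_form eps.
Hypothesis nak : nakayama_automorphism eps sigma.
Variable S : seq k.
Hypotheses (S0 : forall l, l \in S -> l != 0) (spec : spectrum sigma S).
Variable tau : A -> A.
Hypotheses (sigmaK : cancel sigma tau) (tauK : cancel tau sigma).
Implicit Types (f g h : seq A -> A) (s t u : seq A) (l m : k).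

Local Notation conn := (conn eps sigma).
Local Notation invc := (invc sigma).
Local Notation twist := (twist sigma tau).

Lemma tau_lin c a b : tau (c *: a + b) = c *: tau a + tau b.
Proof. by apply: (can_inj sigmaK); rewrite tauK linearP /= !tauK. Qed.

Lemma tauM a b : tau (a * b) = tau a * tau b.
Proof. by apply: (can_inj sigmaK); rewrite tauK rmorphM /= !tauK. Qed.

Lemma tauD a b : tau (a + b) = tau a + tau b.
Proof. by rewrite -[a]scale1r tau_lin !scale1r. Qed.

Lemma tau0 : tau 0 = 0.
Proof. by apply: (can_inj sigmaK); rewrite tauK raddf0. Qed.

Lemma tauZ c a : tau (c *: a) = c *: tau a.
Proof. by rewrite -[c *: a]addr0 tau_lin tau0 addr0. Qed.

Lemma tauN a : tau (- a) = - tau a.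
Proof. by rewrite -scaleN1r tauZ scaleN1r. Qed.

(** [s] consists of eigenvectors for eigenvalues of product [n]. *)
Fixpoint eigs s (n : k) : Prop :=
  if s is a :: t then exists l m, [/\ l \in S, sigma a = l *: a, eigs t m & n = l * m]
  else n = 1.

(** A multilinear function is determined by its values at words of
    eigenvectors. *)
Lemma multilinear_eig0 f : multilinear f ->
  (forall s n, eigs s n -> f s = 0) -> forall s, f s = 0.
Proof.
move=> hf h s; elim: s f hf h => [|a s IH] f hf h; first exact: h.
have [c [hc ->]] := spec a.
have fD x y : f ((x + y) :: s) = f (x :: s) + f (y :: s).
  exact: (mlin_madd (hf : @mlin _ _ A f) [::]).
have f0 : f (0 :: s) = 0 by exact: (madd0 [::] _ (mlin_madd (hf : @mlin _ _ A f))).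
rewrite (big_morph (fun v => f (v :: s)) fD f0) big_seq big1 // => l lS.
apply: (IH (fun u => f (c l :: u))); first exact: (@mlin_cons _ _ A f).
move=> t n ht; apply: (h _ (l * n)) => /=.
by exists l, n; split=> //; exact: hc.
Qed.

Lemma eigs_map f s n : multilinear f -> eigs s n -> f (map sigma s) = n *: f s.
Proof.
elim: s n f => [|a s IH] n f hf /=; first by move=> ->; rewrite scale1r.
move=> [l [m [lS ha hs ->]]]; rewrite ha.
have fZ (c : k) x u : f (c *: x :: u) = c *: f (x :: u).
  have := hf [::] u c x 0; rewrite addr0 /= => ->.
  by rewrite (madd0 [::] _ (mlin_madd (hf : @mlin _ _ A f))) addr0.
rewrite fZ (IH m (fun u => f (a :: u))) ?scalerA //.
exact: (@mlin_cons _ _ A f).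
Qed.

(** The products of [n] eigenvalues. *)
Fixpoint eigprods (n : nat) : seq k :=
  if n is n'.+1 then [seq l * m | l <- S, m <- eigprods n'] else [:: 1].

Lemma eigs_prods s n : eigs s n -> n \in eigprods (size s).
Proof.
elim: s n => [|a s IH] n /=; first by move=> ->; rewrite inE.
by move=> [l [m [lS _ /IH hm ->]]]; apply: allpairs_f.
Qed.

(** [pol M f] is the value at [f] of the product of the [twist - m] for [m] in [M]. *)
Definition pol (M : seq k) f : seq A -> A :=
  foldr (fun m h => fun s => twist h s - m *: h s) f M.

Lemma twist_multilinear f : multilinear f -> multilinear (twist f).
Proof.
move=> hf x z c a b; rewrite /twist -tau_lin; congr tau.
exact: (mlin_map (V := A) sigma hf).
Qed.

Lemma pol_ind (P : (seq A -> A) -> Prop) M f :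
  P f -> (forall m h, P h -> P (fun s => twist h s - m *: h s)) -> P (pol M f).
Proof. by move=> Pf hP; elim: M => //= m M IH; exact: hP. Qed.

Lemma pol_multilinear M f : multilinear f -> multilinear (pol M f).
Proof.
move=> hf; apply: pol_ind => // m h hh.
apply: (@mlinB _ _ A (twist h) (fun s => m *: h s)); first exact: twist_multilinear.
exact: (@mlinZ _ _ A h).
Qed.

Lemma pol_homogeneous M n f : homogeneous n f -> homogeneous n (pol M f).
Proof.
move=> hf; apply: pol_ind => // m h hh s ne.
by rewrite /twist !hh ?size_map // tau0 scaler0 subrr.
Qed.

Lemma twist_hdiff f s : hdiff (twist f) s = twist (hdiff f) s.
Proof.
rewrite /twist !hdiffE !cup_iotal !cup_iotar size_map.
rewrite (mrg_map (fun a b => rmorphM sigma a b)).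
have tauB a b : tau (a - b) = tau a - tau b by rewrite tauD tauN.
rewrite tauD tauB (mrg_morph tauB); congr (_ - _ + _).
  by case: s => [|a s] /=; rewrite ?tau0 // tauM sigmaK.
rewrite (sg_additive _ (tauN _)); congr sg.
case/lastP: s => [|s c]; first by rewrite /= tau0.
by rewrite map_rcons !rc_rcons tauM sigmaK.
Qed.

Lemma pol_hdiff M f s : hdiff (pol M f) s = pol M (hdiff f) s.
Proof.
elim: M f s => //= m M IH f s.
rewrite (hdiffB (twist (pol M f))) hdiffZ twist_hdiff IH; congr (_ - _).
by congr (tau _); exact: IH.
Qed.

(* the polynomial [pol M] at a word whose eigenvalues have product [n] *)
Let rho n M v := foldr (fun m v => n *: tau v - m *: v) v M : A.

Lemma pol_eigs M f s n : multilinear f -> eigs s n -> pol M f s = rho n M (f s).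
Proof.
move=> hf hs; elim: M => //= m M IH.
by rewrite /twist (eigs_map (pol_multilinear M hf) hs) tauZ IH.
Qed.

Lemma rhoD n M (u v : A) : rho n M (u + v) = rho n M u + rho n M v.
Proof. by elim: M => //= m M ->; rewrite tauD !scalerDr opprD addrACA. Qed.

Lemma rho0 n M : rho n M 0 = 0.
Proof. by elim: M => //= m M ->; rewrite tau0 !scaler0 subrr. Qed.

Lemma rho_eig n M l v : l \in S -> sigma v = l *: v -> n / l \in M -> rho n M v = 0.
Proof.
move=> lS hv.
have tv : tau v = l^-1 *: v.
  apply: (can_inj sigmaK); rewrite tauK linearZ /= hv scalerA mulVf ?scale1r //.
  exact: S0.
have rE M' : exists c, rho n M' v = c *: v.
  elim: M' => [|m M' [c IH]] /=; first by exists 1; rewrite scale1r.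
  exists (n * c / l - m * c).
  by rewrite IH tauZ tv !scalerA -scalerBl.
elim: M => //= m M IH; rewrite inE => /orP[/eqP <-|/IH ->]; last first.
  by rewrite tau0 !scaler0 subrr.
have [c ->] := rE M.
by rewrite tauZ tv !scalerA -scalerBl mulrAC subrr scale0r.
Qed.

(** These are the possible eigenvalues of the twist on the cochains of degree
    [n]. *)
Definition ratios (n : nat) : seq k := [seq m / l | m <- eigprods n, l <- S].

Lemma pol_ratios n M f s : multilinear f -> homogeneous n f ->
  {subset ratios n <= M} -> pol M f s = 0.
Proof.
move=> hf hn sub; move: s; apply: multilinear_eig0; first exact: pol_multilinear.
move=> s m hs; have [E|ne] := eqVneq (size s) n; last exact: (pol_homogeneous M hn).
rewrite (pol_eigs M hf hs); have [c [hc ->]] := spec (f s).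
rewrite (big_morph (rho m M) (rhoD m M) (rho0 m M)) big_seq big1 // => l lS.
apply: (rho_eig lS (hc l lS)); apply: sub; apply: allpairs_f => //.
by rewrite -E; exact: eigs_prods.
Qed.

(** The eigenvalues other than 1 of the twist on the cochains of degree [n]. *)
Let Mn (n : nat) : seq k := [seq m <- ratios n | m != 1].

(** The scalar by which [pol M] acts on invariant cochains. *)
Let cM (M : seq k) : k := \prod_(m <- M) (1 - m).

Lemma cMn_neq0 n : cM (Mn n) != 0.
Proof.
rewrite /cM prodf_seq_neq0; apply/allP => m; rewrite mem_filter => /andP[ne _].
by rewrite /= subr_eq0 eq_sym.
Qed.

Lemma pol_inv n f : multilinear f -> homogeneous n f -> invc (pol (Mn n) f).
Proof.
move=> hf hn s.
have : pol (1 :: Mn n) f s = 0.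
  apply: pol_ratios hf hn _ => m hm; rewrite inE mem_filter hm andbT.
  by case: eqP.
rewrite /= scale1r => /eqP; rewrite subr_eq0 => /eqP <-.
by rewrite /twist tauK.
Qed.

Lemma pol_fix M f s : invc f -> pol M f s = cM M *: f s.
Proof.
move=> hf; elim: M s => [|m M IH] s; first by rewrite /cM big_nil scale1r.
rewrite /= /twist !IH hf tauZ sigmaK /cM big_cons scalerA -scalerBl.
by rewrite -{1}[\prod_(j <- M) _]mul1r -mulrBl.
Qed.

(** As the twist is homotopic to the identity, [pol M] acts on the classes of
    cocycles as the scalar [cM M]. *)
Lemma pol_cocycle M n f : multilinear f -> homogeneous n f ->
  (forall s, hdiff f s = 0) ->
  exists2 h, hcochain h & forall s, pol M f s - cM M *: f s = hdiff h s.
Proof.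
move=> hf hn df; elim: M => [|m M [h [hh [N hN]] hE]].
  exists (fun=> 0); first by split; [exact: (@mlin0 _ _ A) | exists 0%N].
  by move=> s; rewrite /cM big_nil scale1r subrr hdiff0.
set g := pol M f in hE.
have hg : multilinear g by exact: pol_multilinear.
have gn : homogeneous n g by exact: pol_homogeneous.
have dg s : hdiff g s = 0.
  rewrite pol_hdiff; move: s.
  by apply: (pol_ind (P := fun h => forall s, h s = 0)) => // m' h' h0 s;
    rewrite /twist !h0 tau0 scaler0 subrr.
have hcg : multilinear (conn g) by exact: conn_multilinear.
exists (fun s => (1 - m) *: h s - conn g s).
  split.
    apply: (@mlinB _ _ A (fun s => (1 - m) *: h s) (conn g)) => //.
    exact: (@mlinZ _ _ A h).
  exists (maxn N n) => s; rewrite geq_max => /andP[Ns ns]; rewrite hN // scaler0 sub0r.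
  apply/eqP; rewrite oppr_eq0; apply/eqP.
  case: (n) gn ns => [|n'] gn ns; first exact: conn_homogeneous0.
  by apply: (conn_homogeneous frob nak hg gn); rewrite gtn_eqF.
move=> s; rewrite (hdiffB (fun s => (1 - m) *: h s)) hdiffZ -hE.
have := conn_hdiff frob nak s tauK hg (mlin_hdiff0 dg).
have -> : conn (hdiff g) s = 0.
  apply: (rep0 frob nak).
    exact: (mlin_nrm sigma (mlin_eps eps (mlin_hdiff0 dg))).
  by move=> a; apply: (@cyc_vanish _ _ sigma (fun w r => eps (hdiff g (w ++ r)))) => w r _ _; rewrite dg raddf0.
rewrite addr0 => ->.
rewrite [pol _ _ _]/= -/g /cM big_cons -/(cM M) !scalerBr !scalerBl !scale1r.
by rewrite mulrBl mul1r scalerBl !scalerA; abel.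
Qed.

(** Every cocycle is cohomologous to an invariant one. *)
Lemma inv_rep n f : multilinear f -> homogeneous n f -> (forall s, hdiff f s = 0) ->
  exists f', [/\ multilinear f', homogeneous n f', invc f',
     (forall s, hdiff f' s = 0) &
     exists2 h, hcochain h & forall s, f s - f' s = hdiff h s].
Proof.
move=> hf hn df; have ne := cMn_neq0 n; set c := cM _ in ne.
have [h hh hE] := pol_cocycle (Mn n) hf hn df.
exists (fun s => c^-1 *: pol (Mn n) f s); split.
- by apply: (@mlinZ _ _ A (pol (Mn n) f)); exact: pol_multilinear.
- by move=> s hs; rewrite (pol_homogeneous _ hn) ?scaler0.
- by move=> s; rewrite (pol_inv hf hn) linearZ.
- move=> s; rewrite hdiffZ pol_hdiff.
  suff -> : pol (Mn n) (hdiff f) s = 0 by rewrite scaler0.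
  move: s; apply: (pol_ind (P := fun h => forall s, h s = 0)) => // m' h' h0 s.
  by rewrite /twist !h0 tau0 scaler0 subrr.
exists (fun s => - c^-1 *: h s).
  case: hh => h1 [N h2]; split; first exact: (@mlinZ _ _ A h).
  by exists N => s hs; rewrite h2 ?scaler0.
move=> s; rewrite hdiffZ -hE scalerBr !scaleNr scalerA mulVf // scale1r; abel.
Qed.

(** The Connes operator maps invariant coboundaries to coboundaries. *)
Lemma inv_exact n f h : multilinear f -> homogeneous n.+1 f -> invc f ->
  multilinear h -> homogeneous n h -> (forall s, f s = hdiff h s) ->
  exists2 h', hcochain h' & forall s, conn f s = hdiff h' s.
Proof.
move=> hf hn invf hh hhn fE; have ne := cMn_neq0 n; set c := cM _ in ne.
pose g s := c^-1 *: pol (Mn n) h s.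
have hg : multilinear g.
  by apply: (@mlinZ _ _ A (pol (Mn n) h)); exact: pol_multilinear.
have gn : homogeneous n g by move=> s hs; rewrite /g (pol_homogeneous _ hhn) ?scaler0.
have invg : invc g by move=> s; rewrite /g (pol_inv hh hhn) linearZ.
have fg : hdiff g = f.
  apply: funext => s; rewrite /g hdiffZ pol_hdiff.
  have -> : hdiff h = f by apply: funext => u; rewrite fE.
  by rewrite (pol_fix _ _ invf) scalerA mulVf // scale1r.
have hcg : multilinear (conn g) by exact: conn_multilinear.
exists (fun s => - conn g s).
  split; first exact: (@mlinN _ _ A (conn g)).
  exists n => s ns; apply/eqP; rewrite oppr_eq0; apply/eqP.
  case: (n) gn ns => [|n'] gn' ns; first exact: conn_homogeneous0.
  by apply: (conn_homogeneous frob nak hg gn'); rewrite gtn_eqF.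
move=> s; rewrite hdiffN.
have := conn_hdiff frob nak s tauK hg; rewrite fg => /(_ hf).
by rewrite /twist invg sigmaK subrr => /eqP; rewrite addrC addr_eq0 => /eqP.
Qed.

End Invariant.

(** * The Jacobi identity of a Batalin-Vilkovisky bracket *)

Section BilinearMap.
Variables (k : fieldType) (V : lmodType k) (m : V -> V -> V).
Hypothesis mB : bilinear_map m.
Implicit Types u v w : V.

Lemma bilDr u v w : m u (v + w) = m u v + m u w.
Proof. by have := mB.1 u 1 v w; rewrite !scale1r. Qed.
Lemma bilDl u v w : m (u + v) w = m u w + m v w.
Proof. by have := mB.2 w 1 u v; rewrite !scale1r. Qed.
Lemma bil0r u : m u 0 = 0.
Proof. by apply: (addrI (m u 0)); rewrite -bilDr !addr0. Qed.
Lemma bil0l u : m 0 u = 0.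
Proof. by apply: (addrI (m 0 u)); rewrite -bilDl !addr0. Qed.
Lemma bilNr u v : m u (- v) = - m u v.
Proof. by apply: (addrI (m u v)); rewrite -bilDr !subrr bil0r. Qed.
Lemma bilNl u v : m (- u) v = - m u v.
Proof. by apply: (addrI (m u v)); rewrite -bilDl !subrr bil0l. Qed.
Lemma bilSr b u v : m u (sg b v) = sg b (m u v).
Proof. by case: b => //; exact: bilNr. Qed.
Lemma bilSl b u v : m (sg b u) v = sg b (m u v).
Proof. by case: b => //; exact: bilNl. Qed.

End BilinearMap.

Section Jacobi.
Variables (k : fieldType) (V : lmodType k) (W : nat -> set V).
Variables (cup br : V -> V -> V) (B : {linear V -> V}).
Hypotheses (cupB : bilinear_map cup) (brB : bilinear_map br).
Hypothesis br_deg : forall p q n a b, W p a -> W q b -> (p + q)%N = n.+1 ->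
  W n (br a b).
Hypothesis br_deg0 : forall a b, W 0 a -> W 0 b -> br a b = 0.
Hypothesis leib : forall p q c a b, W p c -> W q a ->
  br c (cup a b) = cup (br c a) b + (-1) ^+ (p.+1 * q) *: cup a (br c b).
Hypothesis bv : bv_operator W cup br B.

Lemma bvE p a b : W p a -> br a b =
  sg (odd p) (B (cup a b)) - sg (odd p) (cup (B a) b) - cup a (B b).
Proof.
by case: bv => _ _ _ h /h ->; rewrite !signE !sgB sgK.
Qed.

(* an element of degree [p - 1]; there is none but [0] if [p = 0] *)
Let W1 p a := if p is p'.+1 then W p' a else a = 0.

Lemma W1B p a : W p a -> W1 p (B a).
Proof. by case: bv => h h0 _ _; case: p => [|p] /=; [exact: h0 | exact: h]. Qed.

Lemma bvE1 p a b : W1 p a -> br a b =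
  sg (~~ odd p) (B (cup a b)) - sg (~~ odd p) (cup (B a) b) - cup a (B b).
Proof.
case: p => [|p] /=; last by rewrite negbK; exact: bvE.
by move=> ->; rewrite (raddf0 B) (bil0l brB) !(bil0l cupB) (raddf0 B) /sg /= !oppr0 !addr0.
Qed.

Lemma leib1l p q c a b : W1 p c -> W q a ->
  br c (cup a b) = cup (br c a) b + sg (odd p && odd q) (cup a (br c b)).
Proof.
case: p => [|p] /=; first by move=> -> _; rewrite !(bil0l brB) (bil0l cupB) (bil0r cupB) addr0.
by move=> h h'; rewrite (leib _ h h') signE oddM.
Qed.

Lemma leib1r p q c a b : W p c -> W1 q a ->
  br c (cup a b) = cup (br c a) b + sg (~~ odd p && ~~ odd q) (cup a (br c b)).
Proof.
case: q => [|q] /= h.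
  by move=> ->; rewrite !(bil0l cupB) !(bil0r brB) (bil0l cupB) sg0 addr0.
by move=> h'; rewrite (leib _ h h') signE oddM negbK.
Qed.

Lemma leib0 p q c a b : W p c -> W q a ->
  br c (cup a b) = cup (br c a) b + sg (~~ odd p && odd q) (cup a (br c b)).
Proof. by move=> h h'; rewrite (leib _ h h') signE oddM. Qed.

Lemma B_sg b v : B (sg b v) = sg b (B v).
Proof. by case: b => //; exact: raddfN. Qed.

(** The operator is a derivation of the bracket. *)
Lemma B_br p a b : W p a -> B (br a b) = br (B a) b - sg (odd p) (br a (B b)).
Proof.
have BB v : B (B v) = 0 by case: bv.
move=> h; rewrite (bvE1 _ (W1B h)) (bvE _ h) (bvE (B b) h) !raddfB /= !B_sg !BB.
rewrite (bil0l cupB) (bil0r cupB).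
by case: (odd p); rewrite /sg /=; abel.
Qed.

Lemma W1_br p q a b : W p a -> W q b -> W1 (p + q) (br a b).
Proof.
move=> ha hb; case E: (p + q)%N => [|n] /=; last exact: br_deg E.
by move: ha hb; case: (p) (q) E => [|?] [|?] // _; exact: br_deg0.
Qed.

(** Both sides are expanded by the definition of the bracket from the operator,
    which is a derivation of the bracket, and by the Leibniz rule. *)
Lemma bv_jacobi p q a b c : W p a -> W q b ->
  br a (br b c) = br (br a b) c + (-1) ^+ (p.+1 * q.+1) *: br b (br a c).
Proof.
move=> ha hb; rewrite signE oddM /=.
rewrite (bvE1 c (W1_br ha hb)) (B_br _ ha) (bvE (br a c) hb) (B_br _ ha).
rewrite (bvE c hb) !(bilDr brB, bilNr brB, bilSr brB).
have -> : br a (B (cup b c)) = sg (odd p) (br (B a) (cup b c) - B (br a (cup b c))).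
  by rewrite (B_br _ ha) opprB addrC subrK sgK.
rewrite (leib1l _ (W1B ha) hb) (leib1r _ ha (W1B hb)) !(leib0 _ ha hb).
rewrite !raddfD /= !B_sg.
rewrite !(bilDr cupB, bilDl cupB, bilNr cupB, bilNl cupB, bilSr cupB, bilSl cupB).
rewrite oddD.
by case: (odd p); case: (odd q); rewrite /sg /= ?raddfN /=; abel.
Qed.

End Jacobi.

(** * Cocycles and their classes *)

Section Cocycles.
Variables (k : fieldType) (A : algType k).
Implicit Types (f g h : seq A -> A) (s t u : seq A) (b : bool).

(** Cochains of finite support in the degree, killed by the differential. *)
Definition cocycle f : Prop := hcochain f /\ forall s, hdiff f s = 0.

(** Coboundaries. *)
Definition exact f : Prop := exists2 h, hcochain h & forall s, f s = hdiff h s.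

Lemma cocycleP f : reflect (cocycle f) (f \in @hcocycle_pred k A).
Proof.
apply: (iffP (asboolP _)) => -[hf df]; split=> //; first by move=> s; rewrite df.
exact: funext.
Qed.

Lemma hcochain_sg b f : hcochain f -> hcochain (fun s => sg b (f s)).
Proof.
move=> [hf [N hN]]; split; first exact: (@mlin_sg _ _ A b f).
by exists N => s hs; rewrite hN ?sg0.
Qed.

Lemma hcochain0 : hcochain (fun _ : seq A => 0 : A).
Proof. by split; [exact: (@mlin0 _ _ A) | exists 0%N]. Qed.

Lemma hcochainD f g : hcochain f -> hcochain g -> hcochain (fun s => f s + g s).
Proof.
move=> hf hg; have := hcochain_lin 1 hf hg; congr hcochain.
by apply: funext => s; rewrite !fctE scale1r.
Qed.

Lemma hcochainN f : hcochain f -> hcochain (fun s => - f s).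
Proof. exact: (@hcochain_sg true). Qed.

Lemma cocycle_sg b f : cocycle f -> cocycle (fun s => sg b (f s)).
Proof.
move=> [hf df]; split; first exact: hcochain_sg.
by move=> s; rewrite hdiff_sg df sg0.
Qed.

Lemma cocycleD f g : cocycle f -> cocycle g -> cocycle (fun s => f s + g s).
Proof.
move=> [hf df] [hg dg]; split; first exact: hcochainD.
by move=> s; rewrite hdiffD df dg addr0.
Qed.

Lemma cocycle_lin c f g : cocycle f -> cocycle g -> cocycle (fun s => c *: f s + g s).
Proof.
move=> [hf df] [hg dg]; split; first exact: hcochain_lin.
by move=> s; rewrite hdiff_linear df dg scaler0 addr0.
Qed.

Lemma cocycle0 : cocycle (fun _ : seq A => 0 : A).
Proof. by split; [exact: hcochain0 | exact: hdiff0]. Qed.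

Lemma exact0 f : (forall s, f s = 0) -> exact f.
Proof.
by move=> h; exists (fun=> 0); [exact: hcochain0 | move=> s; rewrite h hdiff0].
Qed.

Lemma eq_exact f g : exact f -> f =1 g -> exact g.
Proof. by move=> [h hh hE] fg; exists h => // s; rewrite -fg. Qed.

Lemma exact_sg b f : exact f -> exact (fun s => sg b (f s)).
Proof.
move=> [h hh hE]; exists (fun s => sg b (h s)); first exact: hcochain_sg.
by move=> s; rewrite hdiff_sg hE.
Qed.

Lemma exactD f g : exact f -> exact g -> exact (fun s => f s + g s).
Proof.
move=> [h hh hE] [h' hh' hE']; exists (fun s => h s + h' s); first exact: hcochainD.
by move=> s; rewrite hdiffD hE hE'.
Qed.

Lemma exactN f : exact f -> exact (fun s => - f s).
Proof. exact: (@exact_sg true). Qed.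

Lemma exactB f g : exact f -> exact g -> exact (fun s => f s - g s).
Proof. by move=> ef eg; apply: exactD => //; exact: exactN. Qed.

(** The class of a cocycle; functions that are not cocycles are sent to [0]. *)
Definition hcl f : HH A := hclass (insubd (0 : hcocycle A) f).

Lemma hcl_val (F : hcocycle A) : hcl F = hclass F.
Proof. by rewrite /hcl valKd. Qed.

Lemma val_insub_cocycle f : cocycle f -> (insubd (0 : hcocycle A) f : seq A -> A) = f.
Proof. by move=> /cocycleP hf; rewrite val_insubd hf. Qed.

Lemma cocycle_val (F : hcocycle A) : cocycle F.
Proof. by apply/cocycleP; exact: valP. Qed.

Lemma hcl_lin c f g : cocycle f -> cocycle g ->
  hcl (fun s => c *: f s + g s) = c *: hcl f + hcl g.
Proof.
move=> hf hg; rewrite /hcl /hclass -linearP; congr quotmod_proj.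
apply: val_inj; rewrite linearP /= !val_insub_cocycle //.
exact: cocycle_lin.
Qed.

Lemma hclD f g : cocycle f -> cocycle g -> hcl (fun s => f s + g s) = hcl f + hcl g.
Proof.
move=> hf hg; rewrite -[hcl f]scale1r -hcl_lin //; congr hcl.
by apply: funext => s; rewrite scale1r.
Qed.

Lemma hcl_eqP f g : cocycle f -> cocycle g ->
  (hcl f = hcl g <-> exact (fun s => f s - g s)).
Proof.
move=> hf hg; rewrite /hcl /hclass quotmod_projE; split.
  move=> /asboolP[h hh]; rewrite /= !val_insub_cocycle // => E.
  by exists h => // s; rewrite -E.
move=> [h hh hE]; apply/asboolP; exists h => //.
by rewrite /= !val_insub_cocycle //; exact: funext.
Qed.

Lemma hcl_eq0P f : cocycle f -> (hcl f = 0 <-> exact f).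
Proof.
move=> hf; have E0 : hcl (fun=> 0) = 0.
  rewrite /hcl; have -> : insubd (0 : hcocycle A) (fun=> 0) = 0.
    by apply: val_inj; rewrite /= val_insub_cocycle //; exact: cocycle0.
  exact: raddf0.
rewrite -{1}E0 hcl_eqP //; last exact: cocycle0.
by split=> h; apply: (eq_exact h) => s; rewrite subr0.
Qed.

Lemma hcl_sg b f : cocycle f -> hcl (fun s => sg b (f s)) = sg b (hcl f).
Proof.
move=> hf; case: b => //.
have := hcl_lin (-1) hf cocycle0; rewrite (proj2 (hcl_eq0P cocycle0)) ?addr0.
  rewrite scaleN1r => E; rewrite [RHS]/sg -E; congr hcl.
  by apply: funext => s; rewrite scaleN1r addr0.
by apply: exact0.
Qed.

Lemma hcl_surj x : exists2 f, cocycle f & hcl f = x.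
Proof.
exists (repr x : hcocycle A); first exact: cocycle_val.
by rewrite hcl_val; exact: quotmod_reprK.
Qed.

Lemma HH_degP n x : HH_deg n x <-> exists f, [/\ cocycle f, homogeneous n f & hcl f = x].
Proof.
split=> [[F hF ->]|[f [cf hf <-]]].
  by exists F; split=> //; [exact: cocycle_val | exact: hcl_val].
by exists (insubd (0 : hcocycle A) f) => //; rewrite val_insub_cocycle.
Qed.

Lemma cocycle_comp n f : cocycle f -> cocycle (dcomp n f).
Proof.
move=> [[hf [N hN]] df]; split.
  split; first exact: comp_multilinear.
  by exists N => s hs; rewrite /dcomp hN // if_same.
by move=> s; rewrite hdiff_comp /dcomp df if_same.
Qed.

Lemma hcochain_comp n f : hcochain f -> hcochain (dcomp n f).
Proof.
move=> [hf [N hN]]; split; first exact: comp_multilinear.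
by exists N => s hs; rewrite /dcomp hN // if_same.
Qed.

Lemma exact_comp n f : exact f -> exact (dcomp n f).
Proof.
move=> [h hh hE]; case: n => [|n].
  apply: exact0 => s; rewrite /dcomp; case: eqP => // /size0nil ->.
  exact: hE.
exists (dcomp n h); first exact: hcochain_comp.
by move=> s; rewrite hdiff_comp /dcomp hE.
Qed.

Lemma cocycle_sum N (F : nat -> seq A -> A) : (forall n, cocycle (F n)) ->
  cocycle (fun s => \sum_(n < N) F n s) /\
  hcl (fun s => \sum_(n < N) F n s) = \sum_(n < N) hcl (F n).
Proof.
move=> hF; elim: N => [|N [IH1 IH2]].
  have E : (fun s => \sum_(n < 0) F n s) = (fun=> 0).
    by apply: funext => s; rewrite big_ord0.
  by rewrite E big_ord0; split; [exact: cocycle0 | apply/hcl_eq0P; [exact: cocycle0 | exact: exact0]].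
have E : (fun s => \sum_(n < N.+1) F n s) = (fun s => \sum_(n < N) F n s + F N s).
  by apply: funext => s; rewrite big_ord_recr.
by rewrite E big_ord_recr /= -IH2 hclD //; split=> //; exact: cocycleD.
Qed.

Lemma hcl_comp f : cocycle f -> exists N,
  hcl f = \sum_(n < N) hcl (dcomp n f) /\ f = (fun s => \sum_(n < N) dcomp n f s).
Proof.
move=> cf; have [[_ [N hN]] _] := cf; exists N.
have E : f = (fun s => \sum_(n < N) dcomp n f s).
  by apply: funext => s; exact: comp_sum.
split=> //; rewrite {1}E.
by have [] := cocycle_sum N (F := fun n => dcomp n f) (fun n => cocycle_comp n cf).
Qed.

(** The homogeneous classes span the cohomology. *)
Lemma HH_ind (P : HH A -> Prop) : P 0 -> (forall x y, P x -> P y -> P (x + y)) ->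
  (forall n x, HH_deg n x -> P x) -> forall x, P x.
Proof.
move=> P0 PD Ph x; have [f cf <-] := hcl_surj x.
have [N [-> _]] := hcl_comp cf; elim/big_ind: _ => // n _.
apply: (Ph n); apply/HH_degP; exists (dcomp n f); split=> //.
  exact: cocycle_comp.
exact: comp_homogeneous.
Qed.

Lemma HH_deg_submod n : submodule (@HH_deg k A n).
Proof.
split; first apply/HH_degP.
  exists (fun=> 0); split=> //; first exact: cocycle0.
  by apply/hcl_eq0P; [exact: cocycle0 | exact: exact0].
move=> c u v /HH_degP[f [cf hf <-]] /HH_degP[g [cg hg <-]]; apply/HH_degP.
exists (fun s => c *: f s + g s); split; [exact: cocycle_lin| |exact: hcl_lin].
by move=> s hs; rewrite hf // hg // scaler0 addr0.
Qed.

Lemma HH_graded : direct_sum setT (@HH_deg k A).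
Proof.
split=> [v|s c us hc].
  have [f cf <-] := hcl_surj v; have [N [E _]] := hcl_comp cf.
  exists (iota 0 N), (fun n => hcl (dcomp n f)); split; first exact: iota_uniq.
    move=> i _; split=> //; apply/HH_degP; exists (dcomp i f); split=> //.
      exact: cocycle_comp.
    exact: comp_homogeneous.
  by rewrite E -(big_mkord xpredT (fun n => hcl (dcomp n f))) /index_iota subn0.
have cex i : exists f, i \in s -> [/\ cocycle f, homogeneous i f & hcl f = c i].
  have [is_|ns] := boolP (i \in s); last by exists (fun=> 0).
  by have [_ /HH_degP[f hf]] := hc i is_; exists f.
have [F hF] := choice cex.
have sumE (r : seq nat) : {subset r <= s} ->
    cocycle (fun u => \sum_(i <- r) F i u) /\
    hcl (fun u => \sum_(i <- r) F i u) = \sum_(i <- r) c i.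
  elim: r => [|i r IH] sub.
    have E : (fun u => \sum_(i <- [::]) F i u) = (fun=> 0).
      by apply: funext => u; rewrite big_nil.
    by rewrite E big_nil; split; [exact: cocycle0 | apply/hcl_eq0P; [exact: cocycle0 | exact: exact0]].
  have [|IH1 IH2] := IH; first by move=> j hj; apply: sub; rewrite inE hj orbT.
  have [cF _ cE] := hF i (sub i (mem_head _ _)).
  have E : (fun u => \sum_(i <- i :: r) F i u) = (fun u => F i u + \sum_(i <- r) F i u).
    by apply: funext => u; rewrite big_cons.
  by rewrite E big_cons -IH2 -cE hclD //; split=> //; exact: cocycleD.
have [|cS <-] := sumE s; first by [].
move=> /(hcl_eq0P cS) eS i is_.
have [cF hFi <-] := hF i is_; apply/(hcl_eq0P cF).
apply: (eq_exact (exact_comp i eS)) => u; rewrite /dcomp.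
have [E|ne] := eqVneq (size u) i; last by rewrite hFi.
rewrite (bigD1_seq i) //= big1_seq ?addr0 // => j /andP[ji js].
have [_ hFj _] := hF j js; apply: hFj; rewrite E eq_sym.
exact: ji.
Qed.

End Cocycles.

(** * The operations on cohomology *)

Section Lift.
Variables (k : fieldType) (A : algType k).
Implicit Types (f g h : seq A -> A) (s t u : seq A) (b i j : bool).

(** A bilinear operation on cocycles that respects coboundaries passes to
    cohomology. *)
Lemma lift2 (op : (seq A -> A) -> (seq A -> A) -> seq A -> A) :
  (forall f g, cocycle f -> cocycle g -> cocycle (op f g)) ->
  (forall c f f' g, cocycle f -> cocycle f' -> cocycle g ->
     op (fun s => c *: f s + f' s) g =1 (fun s => c *: op f g s + op f' g s)) ->
  (forall c f g g', cocycle f -> cocycle g -> cocycle g' ->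
     op f (fun s => c *: g s + g' s) =1 (fun s => c *: op f g s + op f g' s)) ->
  (forall f g, cocycle f -> exact f -> cocycle g -> exact (op f g)) ->
  (forall f g, cocycle f -> cocycle g -> exact g -> exact (op f g)) ->
  exists m : HH A -> HH A -> HH A, bilinear_map m /\
    forall f g, cocycle f -> cocycle g -> m (hcl f) (hcl g) = hcl (op f g).
Proof.
move=> opC opl opr exl exr.
have rpX x : exists f, cocycle f /\ hcl f = x.
  by have [f cf fx] := hcl_surj x; exists f.
have [rp rpP] := choice rpX.
pose m x y := hcl (op (rp x) (rp y)).
have mE f g : cocycle f -> cocycle g -> m (hcl f) (hcl g) = hcl (op f g).
  move=> cf cg; have [crf ef] := rpP (hcl f); have [crg eg] := rpP (hcl g).
  apply/hcl_eqP; [exact: opC|exact: opC|].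
  move/(hcl_eqP crf cf): ef => ef; move/(hcl_eqP crg cg): eg => eg.
  set f' := rp _ in crf ef *; set g' := rp _ in crg eg *.
  have cdf : cocycle (fun s => -1 *: f s + f' s) by exact: cocycle_lin.
  have cdg : cocycle (fun s => -1 *: g s + g' s) by exact: cocycle_lin.
  have e1 : exact (op (fun s => -1 *: f s + f' s) g').
    by apply: exl => //; apply: (eq_exact ef) => s; rewrite scaleN1r addrC.
  have e2 : exact (op f (fun s => -1 *: g s + g' s)).
    by apply: exr => //; apply: (eq_exact eg) => s; rewrite scaleN1r addrC.
  apply: (eq_exact (exactD e1 e2)) => s.
  by rewrite opl // opr // !scaleN1r; abel.
exists m; split=> //; split=> [x c y z|y c x z] /=.
  have [f cf <-] := hcl_surj x; have [g cg <-] := hcl_surj y.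
  have [g' cg' <-] := hcl_surj z.
  rewrite -hcl_lin // !mE //; last exact: cocycle_lin.
  by rewrite -hcl_lin; [|exact: opC|exact: opC]; congr hcl; apply: funext; exact: opr.
have [f cf <-] := hcl_surj x; have [g cg <-] := hcl_surj y.
have [f' cf' <-] := hcl_surj z.
rewrite -hcl_lin // !mE //; last exact: cocycle_lin.
by rewrite -hcl_lin; [|exact: opC|exact: opC]; congr hcl; apply: funext; exact: opl.
Qed.

(** The Leibniz rule of the Hochschild differential for the cup product. *)
Lemma hdiff_cup f g s :
  hdiff (cup f g) s = cup (hdiff f) g s + cup (gm true f) (hdiff g) s.
Proof.
have -> : cup (hdiff f) g s = cup (cup (@iota1 k A) f) g s - cup (mrg f) g s
    - cup (cup (gm true f) (@iota1 k A)) g s.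
  rewrite -!cupNl -!cupDl; apply: eq_cup => // u; rewrite hdiffE; congr (_ + _).
  rewrite !cup_iotar; case/lastP: u => [|u c]; first by rewrite /= oppr0.
  by rewrite !rc_rcons size_rcons /gm /= sg_negb sgMl.
have -> : cup (gm true f) (hdiff g) s = cup (gm true f) (cup (@iota1 k A) g) s
    - cup (gm true f) (mrg g) s + sg (odd (size s)) (cup f (cup g (@iota1 k A)) s).
  have -> : sg (odd (size s)) (cup f (cup g (@iota1 k A)) s) =
      cup (gm true f) (fun u => sg (odd (size u)) (cup g (@iota1 k A) u)) s.
    rewrite /cup -spl_sg; apply: eq_spl_in => x y <-.
    by rewrite /gm sgMM size_cat oddD.
  by rewrite -cupNr -!cupDr; apply: eq_cup => // u; rewrite hdiffE.
by rewrite hdiffE mrg_cup !cup_assoc; abel.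
Qed.

Lemma hdiff_gm f s : hdiff (gm true f) s = - sg (odd (size s)) (hdiff f s).
Proof.
case: s => [|a s]; first by rewrite /sg /= oppr0.
rewrite -sg_negb -hdiff_sg; apply: eq_hdiff_size => u hu.
by rewrite /gm hu /= negbK.
Qed.

Lemma hcochain_cup f g : hcochain f -> hcochain g -> hcochain (cup f g).
Proof.
move=> [hf [N hN]] [hg [M hM]]; split; first exact: mlin_cup.
exists (N + M)%N => s hs; apply: spl_eq0 => x y E.
have [le|lt] := leqP N (size x); first by rewrite hN ?mul0r.
rewrite hM ?mulr0 //; move: hs; rewrite -E size_cat; lia.
Qed.

Lemma hcochain_gm b f : hcochain f -> hcochain (gm b f).
Proof.
move=> [hf [N hN]]; split; first exact: (@mlin_size_sg _ _ A (fun n => b && odd n)).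
by exists N => s hs; rewrite /gm hN // sg0.
Qed.

Lemma cocycle_cup f g : cocycle f -> cocycle g -> cocycle (cup f g).
Proof.
move=> [hf df] [hg dg]; split; first exact: hcochain_cup.
move=> s; rewrite hdiff_cup (eq_cup _ df (fun=> erefl)) cup0l add0r.
by rewrite (eq_cup _ (fun=> erefl) dg) cup0r.
Qed.

Lemma exact_cupl f g : exact f -> cocycle g -> exact (cup f g).
Proof.
move=> [h hh hE] [hg dg]; exists (cup h g); first exact: hcochain_cup.
move=> s; rewrite hdiff_cup (eq_cup _ hE (fun=> erefl)).
by rewrite (eq_cup _ (fun=> erefl) dg) cup0r addr0.
Qed.

Lemma exact_cupr f g : cocycle f -> exact g -> exact (cup f g).
Proof.
move=> [hf df] [h hh hE]; exists (cup (gm true f) h).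
  by apply: hcochain_cup => //; exact: hcochain_gm.
move=> s; rewrite hdiff_cup [cup (hdiff _) _ _](eq_cup (f' := fun=> 0) _ _ (fun=> erefl)).
  rewrite cup0l add0r; apply: eq_cup => // u.
  by rewrite /gm /= sgK.
by move=> u; rewrite hdiff_gm df sg0 oppr0.
Qed.

(** The component of parity [j] of a cochain. *)
Definition prt j f s : A := if odd (size s) == j then f s else 0.

Lemma par_prt j f : par j (prt j f).
Proof. by move=> s; rewrite /prt; case: eqP => [->//|_]; rewrite !sg0. Qed.

Lemma prt_lin j c f g : prt j (fun s => c *: f s + g s) =
  (fun s => c *: prt j f s + prt j g s).
Proof.
by apply: funext => s; rewrite /prt; case: ifP => // _; rewrite scaler0 addr0.
Qed.

Lemma hcochain_prt j f : hcochain f -> hcochain (prt j f).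
Proof.
move=> [hf [N hN]]; split; last by exists N => s hs; rewrite /prt hN // if_same.
move=> x z c a b; rewrite /prt !size_cat /=; case: ifP => _; first exact: hf.
by rewrite scaler0 addr0.
Qed.

Lemma hdiff_prt j f s : hdiff (prt j f) s = prt (~~ j) (hdiff f) s.
Proof.
case: s => [|a s]; first by rewrite /prt; case: eqP.
rewrite {2}/prt; have -> : (odd (size (a :: s)) == ~~ j) = (odd (size s) == j).
  by rewrite /=; case: (odd (size s)); case: (j).
case: ifP => h; first by apply: eq_hdiff_size => u hu; rewrite /prt hu h.
by rewrite -[RHS](hdiff0 (a :: s)); apply: eq_hdiff_size => u hu; rewrite /prt hu h.
Qed.

Lemma cocycle_prt j f : cocycle f -> cocycle (prt j f).
Proof.
move=> [hf df]; split; first exact: hcochain_prt.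
by move=> s; rewrite hdiff_prt /prt df if_same.
Qed.

Lemma prt_id p f : homogeneous p f -> prt (odd p) f = f.
Proof.
move=> hf; apply: funext => s; rewrite /prt.
by have [<-|ne] := eqVneq (size s) p; rewrite ?eqxx // hf ?if_same.
Qed.

Lemma prt_odd p f : homogeneous p f -> prt (~~ odd p) f = (fun=> 0).
Proof.
move=> hf; apply: funext => s; rewrite /prt.
have [<-|ne] := eqVneq (size s) p; last by rewrite hf ?if_same.
by case: (odd (size s)).
Qed.

(** The bracket of cochains of parities [i] and [j], without reference to their
    degrees. *)
Definition brp i j f g s : A :=
  sg (~~ i && ~~ j) (ins (~~ j) g f s) - ins (~~ i) f g s.

(** The bracket of arbitrary cochains, through their even and odd components. *)
Definition brt f g s : A :=
  brp false false (prt false f) (prt false g) s +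
  brp false true (prt false f) (prt true g) s +
  brp true false (prt true f) (prt false g) s +
  brp true true (prt true f) (prt true g) s.

Lemma hcochain_ins b f g : hcochain f -> hcochain g -> hcochain (ins b g f).
Proof.
move=> [hf [N hN]] [hg [M hM]]; split; first exact: (@mlin_ins _ _ A b g f).
exists (N + M)%N => s hs; apply: ins_vanish => x y z E.
have [le|lt] := leqP M (size y).
  by rewrite hM // (madd0 _ _ (mlin_madd (hf : @mlin _ _ A f))).
rewrite hN //; move: hs; rewrite -E !size_cat /=; lia.
Qed.

Lemma multilinear_madd f : multilinear f -> madd f.
Proof. exact: (@mlin_madd _ _ A f). Qed.

Lemma hcochain_madd f : hcochain f -> madd f.
Proof. by move=> [hf _]; exact: multilinear_madd. Qed.

Lemma hdiff_ins_cocycle i j f g s : cocycle f -> cocycle g -> par i f -> par j g ->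
  hdiff (ins (~~ j) g f) s = sg (~~ j || i) (cup f g s) - sg (~~ j) (cup g f s).
Proof.
move=> [hf df] [hg dg] pf pg; rewrite (hdiff_ins s (hcochain_madd hf) pf pg).
rewrite (eq_ins _ _ dg (fun=> erefl)) ins0l; last exact: hcochain_madd.
by rewrite (eq_ins _ _ (fun=> erefl) df) ins0 // sg0; abel.
Qed.

Lemma hcochain_brp i j f g : hcochain f -> hcochain g -> hcochain (brp i j f g).
Proof.
move=> hf hg.
have h1 : hcochain (fun s => sg (~~ i && ~~ j) (ins (~~ j) g f s)).
  by apply: hcochain_sg; exact: hcochain_ins.
have h2 : hcochain (fun s => - ins (~~ i) f g s).
  by apply: hcochainN; exact: hcochain_ins.
exact: hcochainD h1 h2.
Qed.

Lemma cocycle_brp i j f g : cocycle f -> cocycle g -> par i f -> par j g ->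
  cocycle (brp i j f g).
Proof.
move=> cf cg pf pg; split; first by apply: hcochain_brp; [case: cf | case: cg].
move=> s; rewrite (hdiffB (fun s => sg (~~ i && ~~ j) (ins (~~ j) g f s))) hdiff_sg.
rewrite (hdiff_ins_cocycle _ cf cg pf pg) (hdiff_ins_cocycle _ cg cf pg pf).
by case: (i); case: (j); rewrite /sg /=; abel.
Qed.

Lemma brpC i j f g s : brp i j f g s = - sg (~~ i && ~~ j) (brp j i g f s).
Proof. by rewrite /brp; case: (i); case: (j); rewrite /sg /=; abel. Qed.

(** If [f] is the coboundary of [h'], then up to sign the bracket of [f] and [g]
    is the coboundary of the bracket of [h'] and [g]: the cup products that occur
    in the differentials of the two insertions cancel out. *)
Lemma exact_brpl i j f g : exact f -> cocycle f -> cocycle g -> par i f -> par j g ->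
  prt i f = f -> exact (brp i j f g).
Proof.
move=> [h hh hE] [hf df] [hg dg] pf pg fE; pose h' := prt (~~ i) h.
have hh' : hcochain h' by exact: hcochain_prt.
have ph' : par (~~ i) h' by exact: par_prt.
have hE' s : hdiff h' s = f s.
  by rewrite hdiff_prt negbK -fE /prt -hE.
have E1 s : hdiff (ins (~~ j) g h') s = sg (~~ j) (ins (~~ j) g f s)
    - sg (~~ j) (cup g h' s) + sg (~~ j || ~~ i) (cup h' g s).
  rewrite (hdiff_ins s (hcochain_madd hh') ph' pg).
  rewrite (eq_ins _ _ dg (fun=> erefl)) ins0l ?addr0; last exact: hcochain_madd.
  by rewrite (eq_ins _ _ (fun=> erefl) hE').
have E2 s : hdiff (ins i h' g) s = ins (~~ i) f g s
    - sg i (cup h' g s) + sg (i || j) (cup g h' s).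
  have := hdiff_ins s (hcochain_madd hg) pg ph'; rewrite negbK => ->.
  rewrite (eq_ins _ _ (fun=> erefl) dg) ins0 // sg0 add0r.
  by rewrite (eq_ins _ _ hE' (fun=> erefl)).
exists (fun s => sg (~~ i && ~~ j (+) ~~ j) (ins (~~ j) g h' s) - ins i h' g s).
  apply: (hcochainD (f := fun s => sg _ (ins (~~ j) g h' s)) (g := fun s => - ins i h' g s)).
    by apply: hcochain_sg; exact: hcochain_ins.
  by apply: hcochainN; exact: hcochain_ins.
move=> s; rewrite (hdiffB (fun s => sg _ (ins (~~ j) g h' s))) hdiff_sg E1 E2 /brp.
by case: (i); case: (j); rewrite /sg /=; abel.
Qed.

Lemma exact_prt i f : exact f -> exact (prt i f).
Proof.
move=> [h hh hE]; exists (prt (~~ i) h); first exact: hcochain_prt.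
by move=> s; rewrite hdiff_prt negbK /prt hE.
Qed.

Lemma prt_prt i f : prt i (prt i f) = prt i f.
Proof. by apply: funext => s; rewrite /prt; case: (odd (size s) == i). Qed.

Lemma exact_brpl_prt i j f g : exact f -> cocycle f -> cocycle g ->
  exact (brp i j (prt i f) (prt j g)).
Proof.
move=> ef cf cg; apply: exact_brpl.
- exact: exact_prt.
- exact: cocycle_prt.
- exact: cocycle_prt.
- exact: par_prt.
- exact: par_prt.
- exact: prt_prt.
Qed.

Lemma exact_brpr_prt i j f g : cocycle f -> cocycle g -> exact g ->
  exact (brp i j (prt i f) (prt j g)).
Proof.
move=> cf cg eg.
have e := exact_sg (~~ (~~ i && ~~ j)) (exact_brpl_prt j i eg cg cf).
by apply: (eq_exact e) => s; rewrite [RHS]brpC sg_negb.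
Qed.

Lemma cocycle_brp_prt i j f g : cocycle f -> cocycle g ->
  cocycle (brp i j (prt i f) (prt j g)).
Proof. by move=> cf cg; apply: cocycle_brp; try exact: cocycle_prt; exact: par_prt. Qed.

Lemma ins_lin_param b c f g g' s : multilinear f ->
  ins b (fun s => c *: g s + g' s) f s = c *: ins b g f s + ins b g' f s.
Proof.
move=> hf; rewrite /ins !sweepE (spl_morph (h := fun v => c *: v)); last first.
  by move=> *; exact: scalerDr.
rewrite -splD; apply: eq_spl => x t; rewrite sgZ -sgD; congr sg.
rewrite /insl (spl_morph (h := fun v => c *: v)); last by move=> *; exact: scalerDr.
by rewrite -splD; apply: eq_spl => y z; rewrite hf.
Qed.

Lemma brp_linl i j c f f' g s : multilinear g ->
  brp i j (fun s => c *: f s + f' s) g s = c *: brp i j f g s + brp i j f' g s.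
Proof.
move=> hg; rewrite /brp ins_lin ins_lin_param // sgD -sgZ scalerBr opprD.
by abel.
Qed.

Lemma brp_linr i j c f g g' s : multilinear f ->
  brp i j f (fun s => c *: g s + g' s) s = c *: brp i j f g s + brp i j f g' s.
Proof.
move=> hf; rewrite !(brpC i j) (brp_linl _ _ _ _ _ _ hf) sgD -sgZ scalerN.
abel.
Qed.

Lemma cup_linl c f f' g s :
  cup (fun s => c *: f s + f' s) g s = c *: cup f g s + cup f' g s.
Proof.
rewrite cupDl; congr (_ + _).
rewrite /cup (spl_morph (h := fun v => c *: v)); last by move=> *; exact: scalerDr.
by apply: eq_spl => x y; rewrite scalerAl.
Qed.

Lemma cup_linr c f g g' s :
  cup f (fun s => c *: g s + g' s) s = c *: cup f g s + cup f g' s.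
Proof.
rewrite cupDr; congr (_ + _).
rewrite /cup (spl_morph (h := fun v => c *: v)); last by move=> *; exact: scalerDr.
by apply: eq_spl => x y; rewrite scalerAr.
Qed.

Lemma cocycle_ml f : cocycle f -> multilinear f.
Proof. by case=> [[]]. Qed.

Lemma cup_HH : exists m : HH A -> HH A -> HH A, bilinear_map m /\
  forall f g, cocycle f -> cocycle g -> m (hcl f) (hcl g) = hcl (cup f g).
Proof.
apply: lift2.
- exact: cocycle_cup.
- by move=> c f f' g _ _ _ s; exact: cup_linl.
- by move=> c f g g' _ _ _ s; exact: cup_linr.
- by move=> f g _; exact: exact_cupl.
- by move=> f g cf _; exact: exact_cupr.
Qed.

Lemma brt_HH : exists m : HH A -> HH A -> HH A, bilinear_map m /\
  forall f g, cocycle f -> cocycle g -> m (hcl f) (hcl g) = hcl (brt f g).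
Proof.
apply: lift2.
- by move=> f g cf cg; rewrite /brt; do 3!(apply: cocycleD; last exact: cocycle_brp_prt); exact: cocycle_brp_prt.
- move=> c f f' g cf cf' cg s; rewrite /brt !prt_lin.
  by rewrite !brp_linl ?scalerDr; try (by apply: cocycle_ml; exact: cocycle_prt); abel.
- move=> c f g g' cf cg cg' s; rewrite /brt !prt_lin.
  by rewrite !brp_linr ?scalerDr; try (by apply: cocycle_ml; exact: cocycle_prt); abel.
- by move=> f g cf ef cg; rewrite /brt; do 3!(apply: exactD; last exact: exact_brpl_prt); exact: exact_brpl_prt.
- by move=> f g cf cg eg; rewrite /brt; do 3!(apply: exactD; last exact: exact_brpr_prt); exact: exact_brpr_prt.
Qed.

Lemma brp0l i j g s : multilinear g -> brp i j (fun=> 0) g s = 0.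
Proof.
by move=> hg; rewrite /brp ins0 // ins0l ?sg0 ?subrr //; exact: multilinear_madd.
Qed.

Lemma brp0r i j f s : multilinear f -> brp i j f (fun=> 0) s = 0.
Proof. by move=> hf; rewrite brpC brp0l // sg0 oppr0. Qed.

Lemma brt_homogeneous p q f g : multilinear f -> multilinear g ->
  homogeneous p f -> homogeneous q g -> brt f g = brp (odd p) (odd q) f g.
Proof.
move=> hf hg hp hq; apply: funext => s; rewrite /brt.
have := prt_id hp; have := prt_odd hp; have := prt_id hq; have := prt_odd hq.
by case: (odd p); case: (odd q) => /= -> -> -> ->;
  rewrite ?(brp0l _ _ _ (@mlin0 _ _ A)) ?brp0l ?brp0r //; abel.
Qed.

End Lift.

(** * The operations on homogeneous cochains *)
Section Formulas.
Variables (k : fieldType) (A : algType k).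
Implicit Types (f g h : seq A -> A) (s t u : seq A) (b : bool).

Lemma spl_bigop (T : Type) (V : zmodType) (G : seq T -> seq T -> V) (s : seq T) :
  spl G s = \sum_(i < (size s).+1) G (take i s) (drop i s).
Proof.
elim: s G => [|a s IH] G; first by rewrite big_ord_recl big_ord0 addr0.
by rewrite big_ord_recl /= (IH (fun x y => G (a :: x) y)).
Qed.

Lemma spl_at (T : Type) (V : zmodType) (n : nat) (G : seq T -> seq T -> V) (s : seq T) :
  (forall x y, x ++ y = s -> size x != n -> G x y = 0) ->
  spl G s = if (n <= size s)%N then G (take n s) (drop n s) else 0.
Proof.
move=> h; rewrite spl_bigop; case: leqP => [le|lt].
  rewrite (bigD1 (Ordinal (le : n < (size s).+1)%N)) //= big1 ?addr0 // => i ne.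
  apply: h; first exact: cat_take_drop.
  by rewrite size_takel ?ltnS; [exact: ne | rewrite -ltnS].
rewrite big1 // => i _; apply: h; first exact: cat_take_drop.
have le : (i <= size s)%N by rewrite -ltnS.
by rewrite size_takel // ltn_eqF // (leq_ltn_trans le).
Qed.

Lemma hcup_homogeneous p q f g : homogeneous p f -> homogeneous q g ->
  hcup p q f g = cup f g.
Proof.
move=> hf hg; apply: funext => s; rewrite /hcup /cup (@spl_at _ _ p).
  by case: leqP => // lt; rewrite hf ?mul0r // take_oversize ?ltn_eqF // ltnW.
by move=> x y _ ne; rewrite hf ?mul0r.
Qed.

Lemma hcirc_homogeneous p q f g : madd f -> homogeneous p f -> homogeneous q g ->
  hcirc p q f g = (fun s => sg (~~ odd p && ~~ odd q) (ins (~~ odd q) g f s)).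
Proof.
move=> fD hf hg; apply: funext => s; rewrite /hcirc signE oddM /=; congr sg.
have [E|ne] := eqVneq (size s).+1 (p + q)%N; last first.
  rewrite (ins_homogeneous _ fD hf hg ne) big1 // => i _.
  have [E|nq] := eqVneq (size (take q (drop i s))) q; last first.
    by rewrite hg // madd0 // scaler0.
  rewrite hf ?scaler0 //; apply: contraNneq ne => <-.
  have le : (q <= size (drop i s))%N by rewrite -E size_take_min geq_minr.
  move: le; rewrite size_cat /= size_take_min !size_drop /minn.
  by case: ltnP => h1 h2; apply/eqP; lia.
have insE x t : x ++ t = s -> insl g (fun u => f (x ++ u)) t =
    if (q <= size t)%N then f (x ++ g (take q t) :: drop q t) else 0.
  by move=> _; apply: spl_at => y z _ ne; rewrite hg // madd0.
rewrite /ins sweepE spl_bigop.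
rewrite -(big_mkord xpredT (fun i => sg (~~ odd q && odd (size (take i s)))
   (insl g (fun u => f (take i s ++ u)) (drop i s)))) E.
rewrite (big_cat_nat (n := p)) ?leq_addr //= [X in _ + X]big1_seq ?addr0; last first.
  move=> i /andP[_]; rewrite mem_index_iota => /andP[pi iq].
  rewrite insE ?cat_take_drop // size_drop leqNgt.
  have -> : (size s - i < q)%N by lia.
  by rewrite sg0.
rewrite big_mkord; apply: eq_bigr => i _.
have ip := ltn_ord i.
rewrite insE ?cat_take_drop // size_drop drop_drop addnC size_takel; last by lia.
have -> : (q <= size s - i)%N by lia.
by rewrite signE oddM /= andbC.
Qed.

Lemma hbracket_homogeneous p q f g : madd f -> madd g ->
  homogeneous p f -> homogeneous q g ->
  hbracket p q f g = brp (odd p) (odd q) f g.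
Proof.
move=> fD gD hf hg; apply: funext => s; rewrite /hbracket /brp signE oddM.
rewrite (hcirc_homogeneous fD hf hg) (hcirc_homogeneous gD hg hf) /=.
by case: (odd p); case: (odd q); rewrite /sg /= ?opprK.
Qed.

Lemma exact_cupC i j f g : cocycle f -> cocycle g -> par i f -> par j g ->
  exact (fun s => cup f g s - sg (i && j) (cup g f s)).
Proof.
move=> cf cg pf pg; exists (fun s => sg (~~ j || i) (ins (~~ j) g f s)).
  by apply: hcochain_sg; apply: hcochain_ins; [case: cf | case: cg].
move=> s; rewrite hdiff_sg (hdiff_ins_cocycle s cf cg pf pg).
by case: (i); case: (j); rewrite /sg /=; abel.
Qed.

Lemma hcochain_ins2 j1 j2 g1 g2 f : hcochain g1 -> hcochain g2 -> hcochain f ->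
  hcochain (ins2 j1 j2 g1 g2 f).
Proof.
move=> [h1 [N1 H1]] [h2 [N2 H2]] [h [N H]]; split; first exact: mlin_ins2.
have fD := multilinear_madd h.
exists (N + N1 + N2)%N => s hs; rewrite /ins2 sweepE spl_eq0 // => x t E.
rewrite /insl2 spl_eq0 ?sg0 // => y r E'.
have [le|lt1] := leqP N1 (size y).
  by apply: ins0 => u _; rewrite H1 // madd0.
apply: ins_vanish => u v w E''.
have [le|lt2] := leqP N2 (size v).
  by rewrite H2 //; have := madd0 (x ++ g1 y :: u) w fD; rewrite -catA.
apply: H; move: hs; rewrite -E -E' -E'' !size_cat /= size_cat /=; lia.
Qed.

Lemma brp_leibniz l j1 j2 c f g : cocycle c -> cocycle f -> cocycle g ->
  par l c -> par j1 f -> par j2 g ->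
  exact (fun s => brp l (j1 (+) j2) c (cup f g) s - cup (brp l j1 c f) g s
                  - sg (~~ l && j1) (cup f (brp l j2 c g) s)).
Proof.
move=> cc cf cg pc pf pg.
exists (fun s => sg (~~ l && ~~ (j1 (+) j2) (+) (j1 (+) j2)) (ins2 j1 j2 f g c s)).
  by apply: hcochain_sg; apply: hcochain_ins2; [case: cf|case: cg|case: cc].
have mc := cocycle_ml cc.
move=> s; rewrite hdiff_sg.
rewrite (hdiff_ins2 pf pg cf.2 cg.2 s (multilinear_madd mc) pc cc.2).
have E1 : cup (brp l j1 c f) g s = sg (~~ l && ~~ j1) (cup (ins (~~ j1) f c) g s)
    - cup (ins (~~ l) c f) g s.
  by rewrite -cup_sgl -cupNl -cupDl.
have E2 : cup f (brp l j2 c g) s = sg (~~ l && ~~ j2) (cup f (ins (~~ j2) g c) s)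
    - cup f (ins (~~ l) c g) s.
  by rewrite -cup_sgr -cupNr -cupDr.
have E3 : cup (gm (~~ l) f) (ins (~~ l) c g) s = sg (~~ l && j1) (cup f (ins (~~ l) c g) s).
  by rewrite -cup_sgl; apply: eq_cup => // u; exact: gm_par.
rewrite {1}/brp ins_cup E1 E2 E3.
by case: (l); case: (j1); case: (j2); rewrite /sg /=; abel.
Qed.

End Formulas.

Section InvariantClasses.
Variables (k : fieldType) (A : algType k).
Variables (eps : {scalar A}) (sigma : {lrmorphism A -> A}).
Hypothesis frob : frobenius_form eps.
Hypothesis nak : nakayama_automorphism eps sigma.
Variables (S : seq k) (tau : A -> A).
Hypotheses (S0 : forall l, l \in S -> l != 0) (spec : spectrum sigma S).
Hypotheses (sigmaK : cancel sigma tau) (tauK : cancel tau sigma).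
Implicit Types (f g h : seq A -> A) (s t u : seq A) (b : bool).

Local Notation conn := (conn eps sigma).
Local Notation invc := (invc sigma).

Lemma hcochain_conn f : hcochain f -> hcochain (conn f).
Proof.
move=> [hf [N hN]]; split; first exact: conn_multilinear.
exists N => s hs; apply: (rep0 frob nak); first exact: mlin_nrm (mlin_eps _ hf).
move=> a; apply: (@cyc_vanish _ _ sigma (fun w r => eps (f (w ++ r)))) => w r _ E.
by rewrite hN ?raddf0 // E /= ltnW.
Qed.

Lemma conn0 f : (forall s, f s = 0) -> forall s, conn f s = 0.
Proof.
move=> f0 s; have hf : multilinear f by move=> x z c a b; rewrite !f0 scaler0 addr0.
apply: (rep0 frob nak); first exact: mlin_nrm (mlin_eps _ hf).
move=> a; apply: (@cyc_vanish _ _ sigma (fun w r => eps (f (w ++ r)))) => w r _ _.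
by rewrite f0 raddf0.
Qed.

Lemma cocycle_conn f : cocycle f -> invc f -> cocycle (conn f).
Proof.
move=> [hf df] invf; split; first exact: hcochain_conn.
move=> s; have [mf _] := hf.
have := conn_hdiff frob nak s tauK mf (mlin_hdiff0 df).
by rewrite conn0 // addr0 => ->; rewrite /twist invf sigmaK subrr.
Qed.

Lemma connD f g s : multilinear f -> multilinear g ->
  conn (fun s => f s + g s) s = conn f s + conn g s.
Proof.
move=> hf hg; rewrite -[conn f s]scale1r -(conn_lin frob nak) //; congr (conn _ s).
by apply: funext => u; rewrite scale1r.
Qed.

(** This holds in each degree by [inv_exact]. *)
Lemma exact_conn f : cocycle f -> invc f -> exact f -> exact (conn f).
Proof.
move=> cf invf ef; have [N [_ ->]] := hcl_comp cf.
have invn n : invc (dcomp n f).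
  by move=> s; rewrite /dcomp size_map invf; case: ifP => //; rewrite raddf0.
have mn n : multilinear (dcomp n f) by apply: comp_multilinear; exact: cocycle_ml.
have mN m : multilinear (fun s => \sum_(n < m) dcomp n f s).
  have [[h _] _] := cocycle_sum m (fun n => cocycle_comp n cf).
  by case: h.
have en n : exact (conn (dcomp n f)).
  case: n => [|n].
    apply: exact0 => s; apply: (conn_homogeneous0 frob nak) => //.
    exact: comp_homogeneous.
  case: ef => h hh hE.
  apply: (inv_exact frob nak S0 spec sigmaK tauK (n := n) (h := dcomp n h)) => //.
  - exact: comp_homogeneous.
  - by apply: comp_multilinear; case: hh.
  - exact: comp_homogeneous.
  - by move=> s; rewrite hdiff_comp /dcomp hE.
elim: N => [|N IH].
  by apply: exact0; apply: conn0 => s; rewrite big_ord0.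
apply: (eq_exact (exactD IH (en N))) => s; rewrite -connD //; congr (conn _ s).
by apply: funext => u; rewrite big_ord_recr.
Qed.

Lemma HH_deg_inv n x : HH_deg n x ->
  exists f, [/\ cocycle f, homogeneous n f, invc f & hcl f = x].
Proof.
move=> /HH_degP[f [[hf df] hn <-]]; have [mf _] := hf.
have [f' [mf' hf' If' df' e]] := inv_rep frob nak S0 spec sigmaK tauK mf hn df.
have cf' : cocycle f' by split=> //; exact: homogeneous_hcochain hf'.
exists f'; split=> //; apply/hcl_eqP => //.
by apply: (eq_exact (exactN e)) => s; rewrite opprB.
Qed.

(** Every class has an invariant representative. *)
Lemma inv_class x : exists f, [/\ cocycle f, invc f & hcl f = x].
Proof.
move: x; apply: HH_ind.
- exists (fun=> 0); split; [exact: cocycle0 | by move=> s; rewrite raddf0|].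
  by apply/hcl_eq0P; [exact: cocycle0 | exact: exact0].
- move=> x y [f [cf If <-]] [g [cg Ig <-]]; exists (fun s => f s + g s).
  split; [exact: cocycleD | by move=> s; rewrite If Ig raddfD | exact: hclD].
- by move=> n x /HH_deg_inv[f [cf _ If E]]; exists f.
Qed.

(** The Connes operator on cohomology. *)
Lemma conn_HH : exists B : {linear HH A -> HH A},
  forall f, cocycle f -> invc f -> B (hcl f) = hcl (conn f).
Proof.
have [rp rpP] := choice inv_class.
pose B0 x := hcl (conn (rp x)).
have BE f : cocycle f -> invc f -> B0 (hcl f) = hcl (conn f).
  move=> cf If; have [cr Ir Er] := rpP (hcl f).
  apply/hcl_eqP; [exact: cocycle_conn | exact: cocycle_conn |].
  move/(hcl_eqP cr cf): Er => e.
  have c' : cocycle (fun s => -1 *: f s + rp (hcl f) s) by exact: cocycle_lin.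
  have I' : invc (fun s => -1 *: f s + rp (hcl f) s).
    by move=> s; rewrite linearP /= If Ir.
  have e' : exact (fun s => -1 *: f s + rp (hcl f) s).
    by apply: (eq_exact e) => s; rewrite scaleN1r addrC.
  apply: (eq_exact (exact_conn c' I' e')) => s.
  rewrite (conn_lin frob nak); [|exact: cocycle_ml|exact: cocycle_ml].
  by rewrite scaleN1r addrC.
have Blin : linear B0.
  move=> c x y; have [f [cf If <-]] := inv_class x; have [g [cg Ig <-]] := inv_class y.
  rewrite -hcl_lin // !BE //; first last.
  - by move=> s; rewrite linearP /= If Ig.
  - exact: cocycle_lin.
  rewrite -hcl_lin; [|exact: cocycle_conn|exact: cocycle_conn].
  congr hcl; apply: funext => s.
  by apply: (conn_lin frob nak); exact: cocycle_ml.
pose B : {linear HH A -> HH A} := HB.pack B0 (GRing.isLinear.Build k (HH A) (HH A) _ B0 Blin).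
by exists B.
Qed.

End InvariantClasses.

(** * The Batalin-Vilkovisky structure *)

Section Structure.
Variables (k : fieldType) (A : algType k).
Variables cup' br' : HH A -> HH A -> HH A.
Hypotheses (cupB : bilinear_map cup') (brB : bilinear_map br').
Hypothesis cupE : forall f g : seq A -> A, cocycle f -> cocycle g ->
  cup' (hcl f) (hcl g) = hcl (cup f g).
Hypothesis brE : forall f g : seq A -> A, cocycle f -> cocycle g ->
  br' (hcl f) (hcl g) = hcl (brt f g).

Local Notation W := (@HH_deg k A).

Lemma brE_homogeneous p q (f g : seq A -> A) : cocycle f -> cocycle g ->
  homogeneous p f -> homogeneous q g ->
  br' (hcl f) (hcl g) = hcl (brp (odd p) (odd q) f g).
Proof.
by move=> cf cg hf hg; rewrite brE // (brt_homogeneous _ _ hf hg) //; exact: cocycle_ml.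
Qed.

Lemma cup'_induced : induced_on_HH (@hcup k A) cup'.
Proof.
move=> p q f g hf hg.
have cfg : cocycle (cup f g) by apply: cocycle_cup; exact: cocycle_val.
exists (insubd (0 : hcocycle A) (cup f g)).
  by rewrite val_insub_cocycle // (hcup_homogeneous hf hg).
by rewrite -!hcl_val cupE ?val_insub_cocycle //; exact: cocycle_val.
Qed.

Lemma br'_induced : induced_on_HH (@hbracket k A) br'.
Proof.
move=> p q f g hf hg.
have [cf cg] := (cocycle_val f, cocycle_val g).
have cfg : cocycle (brp (odd p) (odd q) f g).
  by apply: cocycle_brp => //; exact: homogeneous_par.
exists (insubd (0 : hcocycle A) (brp (odd p) (odd q) f g)).
  rewrite val_insub_cocycle // (hbracket_homogeneous _ _ hf hg) //;
  exact: multilinear_madd (cocycle_ml _).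
by rewrite -!hcl_val (brE_homogeneous cf cg hf hg) val_insub_cocycle.
Qed.

Lemma cup'_assoc a b c : cup' a (cup' b c) = cup' (cup' a b) c.
Proof.
have [f cf <-] := hcl_surj a; have [g cg <-] := hcl_surj b.
have [h ch <-] := hcl_surj c.
rewrite !cupE //; try exact: cocycle_cup.
by congr hcl; apply: funext => s; exact: cup_assoc.
Qed.

Lemma cup'_unit : exists e, W 0 e /\ forall a, cup' e a = a /\ cup' a e = a.
Proof.
pose u (s : seq A) : A := if s is [::] then 1 else 0.
have cu : cocycle u.
  split.
    split; first by move=> [|? ?] *; rewrite /= scaler0 addr0.
    by exists 1%N => -[].
  move=> s; rewrite hdiffE cup_iotal cup_iotar; case: s => [|a [|b s]] //=.
  - by rewrite /sg subrr addr0.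
  - by rewrite /sg /u /= mulr1 mul1r subrr subr0 subrr.
  - have -> : mrg1 b (fun=> 0 : A) s = 0 by case: (s).
    by rewrite mulr0 mul0r sg0 mrg0 !subr0 addr0.
exists (hcl u); split; first by apply/HH_degP; exists u; split=> // -[].
move=> a; have [f cf <-] := hcl_surj a; rewrite !cupE //.
split; congr hcl; apply: funext => s; rewrite /cup.
  by rewrite spl_first ?mul1r // => *; rewrite mul0r.
by rewrite spl_last ?mulr1 // => ? [|? ?] ?; rewrite /= mulr0.
Qed.

Lemma cup'_degree p q a b : W p a -> W q b -> W (p + q)%N (cup' a b).
Proof.
move=> /HH_degP[f [cf hf <-]] /HH_degP[g [cg hg <-]]; apply/HH_degP.
exists (cup f g); split; [exact: cocycle_cup|exact: cup_homogeneous|by rewrite cupE].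
Qed.

Lemma cup'_comm p q a b : W p a -> W q b ->
  cup' a b = (-1) ^+ (p * q) *: cup' b a.
Proof.
move=> /HH_degP[f [cf hf <-]] /HH_degP[g [cg hg <-]].
rewrite signE oddM !cupE // -hcl_sg; last exact: cocycle_cup.
apply/hcl_eqP; [exact: cocycle_cup|by apply: cocycle_sg; exact: cocycle_cup|].
by apply: exact_cupC => //; exact: homogeneous_par.
Qed.

Lemma brp_homogeneous p q n (f g : seq A -> A) : multilinear f -> multilinear g ->
  homogeneous p f -> homogeneous q g -> (p + q)%N = n.+1 ->
  homogeneous n (brp (odd p) (odd q) f g).
Proof.
move=> mf mg hf hg E s ne; rewrite /brp.
rewrite (ins_homogeneous _ (multilinear_madd mf) hf hg) ?E ?eqSS //.
rewrite (ins_homogeneous _ (multilinear_madd mg) hg hf) ?sg0 ?subr0 //.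
by rewrite addnC E eqSS.
Qed.

Lemma br'_degree p q n a b : W p a -> W q b -> (p + q)%N = n.+1 -> W n (br' a b).
Proof.
move=> /HH_degP[f [cf hf <-]] /HH_degP[g [cg hg <-]] E; apply/HH_degP.
exists (brp (odd p) (odd q) f g); split.
- by apply: cocycle_brp => //; exact: homogeneous_par.
- by apply: brp_homogeneous E => //; exact: cocycle_ml.
- by rewrite (brE_homogeneous cf cg hf hg).
Qed.

Lemma br'_degree0 a b : W 0 a -> W 0 b -> br' a b = 0.
Proof.
move=> /HH_degP[f [cf hf <-]] /HH_degP[g [cg hg <-]].
rewrite (brE_homogeneous cf cg hf hg); apply/hcl_eq0P.
  by apply: cocycle_brp => //; [exact: (homogeneous_par hf)|exact: (homogeneous_par hg)].
apply: exact0 => s; rewrite /brp.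
rewrite (ins_homogeneous _ (multilinear_madd (cocycle_ml cf)) hf hg) //.
by rewrite (ins_homogeneous _ (multilinear_madd (cocycle_ml cg)) hg hf) // sg0 subrr.
Qed.

Lemma br'_anticomm p q a b : W p a -> W q b ->
  br' a b = - ((-1) ^+ (p.+1 * q.+1) *: br' b a).
Proof.
move=> /HH_degP[f [cf hf <-]] /HH_degP[g [cg hg <-]].
have pf := homogeneous_par hf; have pg := homogeneous_par hg.
rewrite signE oddM (brE_homogeneous cf cg hf hg) (brE_homogeneous cg cf hg hf).
rewrite -sg_negb -hcl_sg; last exact: cocycle_brp.
by congr hcl; apply: funext => s; rewrite brpC sg_negb.
Qed.

Lemma br'_leibniz p q c a b : W p c -> W q a ->
  br' c (cup' a b) = cup' (br' c a) b + (-1) ^+ (p.+1 * q) *: cup' a (br' c b).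
Proof.
move=> /HH_degP[f [cf hf <-]] /HH_degP[g [cg hg <-]].
have pf := homogeneous_par hf; have pg := homogeneous_par hg.
rewrite signE oddM /=; move: b; apply: HH_ind.
- by rewrite !(bil0r cupB) !(bil0r brB) (bil0r cupB) sg0 addr0.
- move=> x y; rewrite !(bilDr cupB) !(bilDr brB) (bilDr cupB) sgD => -> ->; abel.
move=> r b /HH_degP[h [ch hh <-]]; have ph := homogeneous_par hh.
have cgh : cocycle (cup g h) by exact: cocycle_cup.
have cfg : cocycle (brp (odd p) (odd q) f g) by exact: cocycle_brp.
have cfh : cocycle (brp (odd p) (odd r) f h) by exact: cocycle_brp.
have pgh : par (odd q (+) odd r) (cup g h) by exact: par_cup.
have cfgh : cocycle (brp (odd p) (odd q (+) odd r) f (cup g h)) by exact: cocycle_brp.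
rewrite cupE // (brE_homogeneous cf cgh hf (cup_homogeneous hg hh)).
rewrite (brE_homogeneous cf cg hf hg) (brE_homogeneous cf ch hf hh) !cupE //.
rewrite -hcl_sg; last exact: cocycle_cup.
rewrite -hclD; [|exact: cocycle_cup|by apply: cocycle_sg; exact: cocycle_cup].
rewrite oddD; apply/hcl_eqP => //.
  by apply: cocycleD; [|apply: cocycle_sg]; exact: cocycle_cup.
apply: (eq_exact (brp_leibniz cf cg ch pf pg ph)) => s; abel.
Qed.

Section Operator.
Variables (eps : {scalar A}) (sigma : {lrmorphism A -> A}).
Hypothesis frob : frobenius_form eps.
Hypothesis nak : nakayama_automorphism eps sigma.
Variables (S : seq k) (tau : A -> A).
Hypotheses (S0 : forall l, l \in S -> l != 0) (spec : spectrum sigma S).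
Hypotheses (sigmaK : cancel sigma tau) (tauK : cancel tau sigma).
Variable B : {linear HH A -> HH A}.
Hypothesis BE : forall f : seq A -> A, cocycle f -> invc sigma f ->
  B (hcl f) = hcl (conn eps sigma f).

Lemma B_operator : bv_operator W cup' br' B.
Proof.
have inv_rep' n x := @HH_deg_inv k A eps sigma frob nak S tau S0 spec sigmaK tauK n x.
have cconn f : cocycle f -> invc sigma f -> cocycle (conn eps sigma f).
  by move=> cf If; exact: (cocycle_conn frob nak sigmaK tauK).
split.
- move=> n a /inv_rep'[f [cf hf If <-]]; rewrite BE //; apply/HH_degP.
  exists (conn eps sigma f); split=> //; first exact: cconn.
  by apply: (conn_homogeneous frob nak) => //; exact: cocycle_ml.
- move=> a /inv_rep'[f [cf hf If <-]]; rewrite BE //; apply/hcl_eq0P; first exact: cconn.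
  apply: exact0 => s; apply: (conn_homogeneous0 frob nak) => //; exact: cocycle_ml.
- move=> a; have [f [cf If <-]] := inv_class frob nak S0 spec sigmaK tauK a.
  have mf := cocycle_ml cf; have cg := cconn f cf If.
  have Ig : invc sigma (conn eps sigma f) by exact: (invc_conn frob nak).
  rewrite !BE //; apply/hcl_eq0P; first exact: cconn.
  pose h u := conn eps sigma f (1 :: 1 :: u).
  have mh : multilinear h.
    apply: (@mlin_cons _ _ A (fun u => conn eps sigma f (1 :: u))).
    exact: (@mlin_cons _ _ A (conn eps sigma f) _ (cocycle_ml cg)).
  have mN := mlin_nrm sigma (mlin_ph eps mh).
  exists (rep eps (nrm sigma (ph eps h))).
    split; first exact: (rep_multilinear frob nak).
    have [[_ [N hN]] _] := cg; exists N => s hs; apply: (rep0 frob nak mN) => b.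
    apply: (@cyc_vanish _ _ sigma (fun w r => ph eps h (w ++ r))) => w r _ E.
    case: (w ++ r) E => [|c u] //= [E]; rewrite /h hN ?mulr0 ?raddf0 //=.
    by rewrite E; lia.
  by move=> s; exact: (conn_sq frob nak _ mf If cg.2).
- move=> p a b /inv_rep'[f [cf hf If <-]]; rewrite signE signE.
  have mf := cocycle_ml cf; have pf := homogeneous_par hf.
  move: b; apply: HH_ind.
  + by rewrite (bil0r brB) !(bil0r cupB) raddf0 !(bil0r cupB) sg0 subrr subr0 sg0.
  + move=> x y Ex Ey; rewrite (bilDr brB) !(bilDr cupB) !raddfD /= (bilDr cupB) Ex Ey.
    by case: (odd p); rewrite /sg /=; abel.
  move=> q b /inv_rep'[g [cg hg Ig <-]].
  have mg := cocycle_ml cg; have pg := homogeneous_par hg.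
  have cfg : cocycle (cup f g) by exact: cocycle_cup.
  have Ifg : invc sigma (cup f g) by exact: invc_cup.
  have cBf := cconn f cf If; have cBg := cconn g cg Ig; have cBfg := cconn _ cfg Ifg.
  have cbr : cocycle (brp (odd p) (odd q) f g) by exact: cocycle_brp.
  have pBf : par (~~ odd p) (conn eps sigma f).
    case: (p) hf => [|p'] hf'; last first.
      by rewrite /= negbK; apply: homogeneous_par; exact: (conn_homogeneous frob nak).
    by move=> s; rewrite (conn_homogeneous0 frob nak) // !sg0.
  have [h hh hE] := conn_cup frob nak mf mg hf hg cf.2 cg.2 If Ig.
  have eC := exact_cupC cg cBf pg pBf.
  rewrite (brE_homogeneous cf cg hf hg) cupE // !BE // !cupE //.
  have c1 : cocycle (cup (conn eps sigma f) g) by exact: cocycle_cup.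
  have c2 : cocycle (cup f (conn eps sigma g)) by exact: cocycle_cup.
  have E : hcl (brp (odd p) (odd q) f g) +
      hcl (fun s => sg (odd p) (cup (conn eps sigma f) g s)) +
      hcl (cup f (conn eps sigma g)) =
      hcl (fun s => sg (odd p) (conn eps sigma (cup f g) s)).
    rewrite -!hclD //; try (by apply: cocycle_sg); last first.
      by apply: cocycleD => //; exact: cocycle_sg.
    apply/hcl_eqP; last 1 first.
    - have e1 : exact (hdiff h) by exists h.
      have e2 := exactB (exact_sg (odd p) e1)
        (exact_sg (odd p (+) odd q (+) (odd p && odd q)) eC).
      apply: (eq_exact e2) => s; rewrite hE /brp.
      by case: (odd p); case: (odd q); rewrite /sg /=; abel.
    - by apply: cocycleD => //; apply: cocycleD => //; exact: cocycle_sg.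
    - exact: cocycle_sg.
  rewrite !hcl_sg // in E.
  rewrite !sgB sgK -E; abel.
Qed.

End Operator.
End Structure.

Theorem corollary6p7 (k : closedFieldType) (A : algType k)
    (eps : {scalar A}) (sigma : {lrmorphism A -> A})
    (A_frobenius : frobenius_form eps)
    (sigma_nakayama : nakayama_automorphism eps sigma)
    (sigma_diag : diagonalisable_map sigma) :
  exists cup bracket : HH A -> HH A -> HH A,
    [/\ induced_on_HH (@hcup k A) cup,
        induced_on_HH (@hbracket k A) bracket
      & bv_algebra (@HH_deg k A) cup bracket].
Proof.
have [S [S0 spec]] := finite_spectrum A_frobenius sigma_nakayama sigma_diag.
have [tau sigmaK tauK] := sigma_nakayama.1.
have [cup' [cupB cupE]] := cup_HH A.
have [br' [brB brE]] := brt_HH A.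
have [B BE] := conn_HH A_frobenius sigma_nakayama S0 spec sigmaK tauK.
have bv := B_operator cupB brB cupE brE A_frobenius sigma_nakayama S0 spec
  sigmaK tauK BE.
exists cup', br'; split; [exact: cup'_induced|exact: br'_induced|].
split; last by exists B.
have br_deg := br'_degree brE; have br_deg0 := br'_degree0 brE.
have leib := br'_leibniz cupB brB cupE brE.
split.
- exact: HH_deg_submod.
- exact: HH_graded.
- exact: cupB.
- exact: cup'_degree.
- exact: cup'_assoc.
- exact: cup'_unit.
- exact: cup'_comm.
- exact: brB.
- exact: br_deg.
- exact: br_deg0.
- exact: br'_anticomm.
- move=> p q r a b c ha hb _.
  exact: (bv_jacobi cupB brB br_deg br_deg0 leib bv).
- exact: leib.
Qed.
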